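(* There exists an absolute constant $C>0$ such that the following holds. Let $n\ge 1$ and let $W_1,\ldots,W_n$ be independent and identically distributed real-valued random variables with mean zero, variance $\sigma^2>0$ and $\mathbb{E}[|W_1|^4]<\infty$. Let $Z\sim N(0,1)$, $v(b)=\mathbb{E}[e^{ibW_1}]$, $\beta_3=\mathbb{E}[|W_1|^3]$, and for $t\in\mathbb{R}$ set \[ \Delta_{n,\mathrm{ReLU}}(t):=\mathbb{E}\left[\left(\frac{1}{\sqrt{n\sigma^2}}\sum_{i=1}^nW_i-t\right)_+\right]-\mathbb{E}[(Z-t)_+]. \] Then for all $t\in\mathbb{R}$, \[ \left|\Delta_{n,\mathrm{ReLU}}(t)-\frac{te^{-t^2/2}\,\mathbb{E}[W_1^3]}{6\sqrt{2\pi n}\,\sigma^3}\right|\le C\left[\frac{\mathbb{E}[|W_1|^4]}{\sigma^4n}+n^6\left(\sup_{|b|\ge\sigma^2/(12\beta_3)}|v(b)|+\frac{1}{2n}\right)^n\right]\kappa(t), \] where \[ \kappa(t):=\begin{cases}\dfrac{1}{3(1+t)^3}, & t\ge0,\\[2mm] \dfrac23-\dfrac{1}{3(1-t)^3}, & t<0.\end{cases} \] Moreover, \[ \left|\int_0^\infty\Delta_{n,\mathrm{ReLU}}(t)\,dt-\frac{\mathbb{E}[W_1^3]}{(\mathbb{E}[|W_1|^2])^{3/2}}\,\frac{1}{6\sqrt{2\pi n}}\right|\le\frac{C}{6}\left[\frac{\mathbb{E}[|W_1|^4]}{\sigma^4n}+n^6\left(\sup_{|b|\ge\sigma^2/(12\beta_3)}|v(b)|+\frac{1}{2n}\right)^n\right].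 \]
   Context: $(x)_+=\max\{x,0\}$ denotes the positive part (ReLU function). *)

(* Defs.v *)
From HB Require Import structures.
From mathcomp Require Import all_boot all_order all_algebra.
From mathcomp Require Import complex.
From mathcomp Require Import all_classical all_reals all_analysis.

Set Implicit Arguments.
Unset Strict Implicit.
Unset Printing Implicit Defensive.

Import Order.TTheory GRing.Theory Num.Theory.
Import numFieldNormedType.Exports.

Local Open Scope classical_set_scope.
Local Open Scope ring_scope.

Definition relu {R : realType} (x : R) : R := Num.max x 0.

(* Mutual independence: the product rule over every finite subfamily. *)
Definition mutually_independent {d} {T : measurableType d} {R : realType}
    (P : probability T R) (I : finType) (X : I -> {RV P >-> R}) : Prop :=
  forall (J : {set I}) (A : I -> set R),
    (forall i, i \in J -> measurable (A i)) ->
    P (\bigcap_(i in [set` J]) (X i @^-1` A i)) =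
      (\prod_(i in J) P (X i @^-1` A i))%E.

Definition identically_distributed {d} {T : measurableType d} {R : realType}
    (P : probability T R) (I : Type) (X : I -> {RV P >-> R}) : Prop :=
  forall (i j : I) (A : set R), measurable A ->
    distribution P (X i) A = distribution P (X j) A.

Definition has_distribution {d} {T : measurableType d} {R : realType}
    (P : probability T R) (X : {RV P >-> R}) (mu : set R -> \bar R) : Prop :=
  forall A : set R, measurable A -> distribution P X A = mu A.

(* Real-valued expectation.  [fine] maps infinite values to 0, so this is only
   meaningful for integrable X. *)
Definition rexpectation {d} {T : measurableType d} {R : realType}
    (P : probability T R) (X : T -> R) : R := fine ('E_P[X])%E.

(* E[e^(ibX)], the expectation of a complex random variable being taken
   componentwise. *)
Definition char_fun {d} {T : measurableType d} {R : realType}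
    (P : probability T R) (X : T -> R) (b : R) : R[i] :=
  Complex (rexpectation P (fun w => cos (b * X w)))
          (rexpectation P (fun w => sin (b * X w))).

Definition kappa {R : realType} (t : R) : R :=
  if 0 <= t then 1 / (3 * (1 + t) ^+ 3) else 2 / 3 - 1 / (3 * (1 - t) ^+ 3).

(* Extended-real-valued, so that an inequality `|Delta_relu - x| <= y between
   finite x and y includes the finiteness of both expectations. *)
Definition Delta_relu {d d'} {T : measurableType d} {T' : measurableType d'}
    {R : realType} (P : probability T R) (Q : probability T' R) (n : nat)
    (W : 'I_n -> {RV P >-> R}) (Z : {RV Q >-> R}) (sigma t : R) : \bar R :=
  ('E_P[fun w => relu (1 / Num.sqrt (n%:R * sigma ^+ 2)
                         * (\sum_(i < n) W i w) - t)%R]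
   - 'E_Q[fun z => relu (Z z - t)%R])%E.

(* E|W|^4 / (sigma^4 n)
     + n^6 (sup_{|b| >= sigma^2 / (12 beta3)} |v(b)| + 1/(2n))^n,
   where W stands for any of the W_i, beta3 = E|W|^3 and v is the
   characteristic function of W. *)
Definition error_term {d} {T : measurableType d} {R : realType}
    (P : probability T R) (n : nat) (W : T -> R) (sigma : R) : R :=
  let beta3 := rexpectation P (fun w => `|W w| ^+ 3) in
  rexpectation P (fun w => `|W w| ^+ 4) / (sigma ^+ 4 * n%:R)
  + n%:R ^+ 6 *
    (sup [set ComplexField.Normc.normc (char_fun P W b)
         | b in [set b : R | sigma ^+ 2 / (12 * beta3) <= `|b|]]
     + 1 / (2 * n%:R)) ^+ n.

(* Main.v *)
(** Write [r t = (-t)_+], [T f = E f(. - W)] for a standardised summand [W], [g_u]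
    for the density of N(0, u) and [rho_u = g_u * r].  Then [E(S_n - t)_+] is
    [T^n r], and the quantity to control is
    [E_n = T^n r - rho_n + n (E W^3 / 6) g_n'].  We show
    [(1 + |t| / sqrt n)^3 |E_n t| <= K E W^4 / sqrt n] with an absolute constant [K],
    by strong induction on [n] and entirely in real space: this is stronger than
    required, and about the characteristic-function term of the claimed bound only
    its nonnegativity matters.

    If [n < B E W^4] the bound follows from the fourth moment of [S_n].  Otherwise
    smooth with N(0, s), [s = A E W^4], and exchange the summands one at a time for
    Gaussian ones.  Since [r''] is a Dirac mass, an exchange made on [rho] leaves only
    a Taylor remainder of Gaussian densities; one made on [E_i] costs a kernel of mass
    [O(sqrt (E W^4) u^(-3/2))], [u] being the variance of its Gaussian factor, and these
    masses are summable.  The price of smoothing, [T^n (rho_s - r)], is at most a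
    multiple of [sqrt (s s') T^n g_s'] with [s' = B E W^4], and [T^n g_s'] is in turn
    controlled by [E_(n-1)], because [g_s'] is the convolution of its own second
    derivative with [r].  Altogether [K] is reproduced with a factor
    [C (sqrt (A / B) + 1 / sqrt A)], which is less than 1 for [1 << A << B]. *)
Require Import Defs.
From HB Require Import structures.
From mathcomp Require Import all_boot all_order all_algebra.
From mathcomp Require Import complex.
From mathcomp Require Import all_classical all_reals all_analysis.
From mathcomp Require Import ring lra measurable_realfun.

Set Implicit Arguments.
Unset Strict Implicit.
Unset Printing Implicit Defensive.

Import Order.TTheory GRing.Theory Num.Theory.
Import numFieldNormedType.Exports.

Local Open Scope classical_set_scope.
Local Open Scope ring_scope.

(** The weight [(1 + |t| / a)^3] is submultiplicative, so a convolution is bounded by the weighted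
    mass of its kernel times the weighted supremum of its argument, and all errors can be compared
    at the single scale [a = sqrt n]. The power is 3 because four moments are available and the
    linear growth of the ramp takes one of them.

    The obstacle is the smoothing, the one step without cancellation: [rho_s - r] has size [sqrt s]
    on a width [sqrt s], and what remains is to estimate how much of the law of the sum lies near a
    point. A Gaussian window of variance [s] would do this at the price [s] times an error divided
    by [s], and [K] would come back with a factor that is not small. A window of the larger variance
    [s'] raises the price to [sqrt (s s')] but divides the error by [s'], and [K] comes back
    multiplied by [sqrt (s / s') = sqrt (A / B)].

    In the exchanges the bound on [E_i] brings [i^(-1/2)], so the masses add up to
    [sum_i (n + s - 1 - i)^(-3/2) i^(-1/2)], which is of order [1 / sqrt (n s)]; this is the origin
    of [1 / sqrt A]. *)

Section ge0_real_integral.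
Context d (T : measurableType d) {R : realType} (m : {measure set T -> \bar R}).
Implicit Types f g : T -> R.

Lemma ge0_int_le f g : measurable_fun setT f -> measurable_fun setT g ->
  (forall x, 0 <= f x) -> (forall x, f x <= g x) ->
  (\int[m]_x (f x)%:E <= \int[m]_x (g x)%:E)%E.
Proof.
move=> mf mg f0 fg; apply: ge0_le_integral => //.
- by move=> x _; rewrite lee_fin.
- exact/measurable_EFinP.
- exact/measurable_EFinP.
- by move=> x _; rewrite lee_fin.
Qed.

Lemma ge0_intZl (c : R) f : measurable_fun setT f -> (forall x, 0 <= f x) ->
  0 <= c -> (\int[m]_x (c * f x)%:E = c%:E * \int[m]_x (f x)%:E)%E.
Proof.
move=> mf f0 c0; under eq_integral do rewrite EFinM.
rewrite ge0_integralZl_EFin//; first by move=> x _; rewrite lee_fin.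
exact/measurable_EFinP.
Qed.

Lemma ge0_int_ge0 f : (forall x, 0 <= f x) -> (0 <= \int[m]_x (f x)%:E)%E.
Proof. by move=> f0; apply: integral_ge0 => x _; rewrite lee_fin. Qed.

Lemma ge0_intD f g : measurable_fun setT f -> measurable_fun setT g ->
  (forall x, 0 <= f x) -> (forall x, 0 <= g x) ->
  (\int[m]_x (f x + g x)%:E = \int[m]_x (f x)%:E + \int[m]_x (g x)%:E)%E.
Proof.
move=> mf mg f0 g0; under eq_integral do rewrite EFinD.
rewrite ge0_integralD//.
- by move=> x _; rewrite lee_fin.
- exact/measurable_EFinP.
- by move=> x _; rewrite lee_fin.
- exact/measurable_EFinP.
Qed.

Lemma int_lty_integrable f : measurable_fun setT f ->
  (\int[m]_x (`|f x|)%:E < +oo)%E -> m.-integrable setT (fun x => (f x)%:E).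
Proof. by move=> mf fy; apply/integrableP; split => //; exact/measurable_EFinP. Qed.

Lemma integrable_int_lty f : m.-integrable setT (fun x => (f x)%:E) ->
  (\int[m]_x (`|f x|)%:E < +oo)%E.
Proof. by case/integrableP. Qed.

Lemma le_integrableR f g : measurable_fun setT f ->
  (forall x, `|f x| <= g x) -> m.-integrable setT (fun x => (g x)%:E) ->
  m.-integrable setT (fun x => (f x)%:E).
Proof.
move=> mf fg; apply: le_integrable => //; first exact/measurable_EFinP.
by move=> x _ /=; rewrite lee_fin (le_trans (fg x))// ler_norm.
Qed.

Lemma Rintegral_EFin f : m.-integrable setT (fun x => (f x)%:E) ->
  (\int[m]_x f x)%:E = (\int[m]_x (f x)%:E)%E.
Proof. by move=> fi; rewrite /Rintegral fineK//; exact: integrable_fin_num. Qed.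

End ge0_real_integral.

(** * Convolutions with Lipschitz functions *)

Section convolution.
Context {R : realType}.
Local Notation mR := (measurableTypeR R).
Implicit Types (f g k : R -> R) (t x y : R).

(** The class of test functions: it contains the ramp, which is unbounded, and convolution with an
    integrable kernel preserves it. *)
Definition lip f := exists L, forall x y, `|f x - f y| <= L * `|x - y|.

(* The convolution of the signed measure [k m] with [f]. *)
Definition cv (m : {measure set mR -> \bar R}) k f t : R :=
  \int[m]_x (k x * f (t - x)).

(** Lipschitz functions grow at most linearly, so a first absolute moment makes [cv m k f] converge
    absolutely. Taken with [k = cst 1] this is a condition on the measure [m] itself. *)
Definition kernel1 (m : {measure set mR -> \bar R}) k :=
  measurable_fun [set: R] k /\
  m.-integrable [set: R] (fun x => (k x * (1 + `|x|))%:E).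

Lemma lip_ge0 f : lip f -> exists2 L, 0 <= L &
  forall x y, `|f x - f y| <= L * `|x - y|.
Proof.
move=> [L fL]; exists `|L| => // x y; apply: le_trans (fL x y) _.
by rewrite ler_wpM2r// ler_norm.
Qed.

Lemma lip_continuous f : lip f -> continuous f.
Proof.
move=> /lip_ge0[L L0 fL] x; apply/cvgrPdist_le => e e0.
have L1 : 0 < L + 1 by rewrite ltr_wpDl.
near=> y; apply: le_trans (fL _ _) _.
have : `|x - y| <= e / (L + 1).
  near: y; have /cvgr_dist_le : id y @[y --> x] --> x by exact: cvg_id.
  by apply; rewrite divr_gt0.
rewrite ler_pdivlMr// => h; apply: le_trans h; rewrite mulrC ler_wpM2l//.
by rewrite lerDl.
Unshelve. all: by end_near. Qed.

Lemma lip_measurable f : lip f -> measurable_fun [set: R] f.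
Proof. by move=> /lip_continuous/continuous_measurable_fun. Qed.

Lemma lip_growth f : lip f -> exists2 C, 0 <= C &
  forall x, `|f x| <= C * (1 + `|x|).
Proof.
move=> /lip_ge0[L L0 fL]; exists (L + `|f 0|); first by rewrite addr_ge0.
move=> x; have := fL x 0; rewrite subr0 => h.
have : `|f x| <= `|f x - f 0| + `|f 0| by rewrite -[in leLHS](subrK (f 0) (f x)) ler_normD.
by have := mulr_ge0 (normr_ge0 (f 0)) (normr_ge0 x); lra.
Qed.

Lemma lipN f : lip f -> lip (fun x => - f x).
Proof. by move=> [L fL]; exists L => x y; rewrite -opprD normrN. Qed.

Lemma lipD f g : lip f -> lip g -> lip (fun x => f x + g x).
Proof.
move=> [L fL] [M gM]; exists (L + M) => x y; rewrite opprD addrACA mulrDl.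
exact: le_trans (ler_normD _ _) (lerD _ _).
Qed.

Lemma lipB f g : lip f -> lip g -> lip (fun x => f x - g x).
Proof. by move=> lf lg; apply: lipD => //; exact: lipN. Qed.

Lemma lipZ a f : lip f -> lip (fun x => a * f x).
Proof.
move=> [L fL]; exists (`|a| * L) => x y.
by rewrite -mulrBr normrM -mulrA ler_wpM2l.
Qed.

Lemma lip_comp_sub f t : lip f -> lip (fun x => f (t - x)).
Proof.
move=> [L fL]; exists L => x y; apply: le_trans (fL _ _) _.
by rewrite (_ : t - x - (t - y) = - (x - y)) ?normrN//; ring.
Qed.

Lemma kernel1_norm m k : kernel1 m k -> kernel1 m (fun x => `|k x|).
Proof.
move=> [mk ik]; split; first exact: measurableT_comp.
apply: le_integrable ik => //.
  apply/measurable_EFinP/measurable_funM; first exact: measurableT_comp.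
  by apply: measurable_funD => //; exact: measurableT_comp.
by move=> x _ /=; rewrite lee_fin !normrM normr_id.
Qed.

Lemma kernel1_integrable m k : kernel1 m k ->
  m.-integrable [set: R] (fun x => (k x)%:E).
Proof.
move=> [mk ik]; apply: le_integrable ik => //; first exact/measurable_EFinP.
move=> x _ /=; rewrite lee_fin normrM ler_peMr//.
by rewrite ger0_norm ?addr_ge0// lerDl.
Qed.

Lemma cv_measurable k f t : measurable_fun [set: R] k -> lip f ->
  measurable_fun [set: R] (fun x => k x * f (t - x)).
Proof.
by move=> mk lf; apply: measurable_funM => //; apply: lip_measurable; exact: lip_comp_sub.
Qed.

Lemma growth_shift f C t x : (forall x, `|f x| <= C * (1 + `|x|)) -> 0 <= C ->
  `|f (t - x)| <= C * (1 + `|t|) * (1 + `|x|).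
Proof.
move=> fC C0; apply: le_trans (fC _) _; rewrite -mulrA ler_wpM2l//.
by have := ler_normB t x; have := mulr_ge0 (normr_ge0 t) (normr_ge0 x); lra.
Qed.

Lemma cv_integrable m k f t : kernel1 m k -> lip f ->
  m.-integrable [set: R] (fun x => (k x * f (t - x))%:E).
Proof.
move=> [mk ik] lf; have [C C0 fC] := lip_growth lf.
have ik' := integrableZl measurableT (C * (1 + `|t|)) ik.
apply: le_integrable ik' => //.
  by apply/measurable_EFinP; exact: cv_measurable.
move=> x _ /=; rewrite lee_fin !normrM mulrCA ler_wpM2l//.
rewrite (ger0_norm (addr_ge0 _ (normr_ge0 x)))// (ger0_norm C0).
by rewrite (ger0_norm (addr_ge0 _ (normr_ge0 t)))// growth_shift.
Qed.

Lemma cvD m k f g t : kernel1 m k -> lip f -> lip g ->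
  cv m k (fun x => f x + g x) t = cv m k f t + cv m k g t.
Proof.
move=> kk lf lg; rewrite /cv -RintegralD//; [|exact: cv_integrable..].
by apply: eq_Rintegral => x _; rewrite mulrDr.
Qed.

Lemma cvZ m k a f t : kernel1 m k -> lip f ->
  cv m k (fun x => a * f x) t = a * cv m k f t.
Proof.
move=> kk lf; rewrite /cv -RintegralZl//; last exact: cv_integrable.
by apply: eq_Rintegral => x _; rewrite mulrCA.
Qed.

Lemma cvB m k f g t : kernel1 m k -> lip f -> lip g ->
  cv m k (fun x => f x - g x) t = cv m k f t - cv m k g t.
Proof.
move=> kk lf lg; rewrite /cv -RintegralB//; [|exact: cv_integrable..].
by apply: eq_Rintegral => x _; rewrite mulrBr.
Qed.

Lemma cvBk m k k' f t : kernel1 m k -> kernel1 m k' -> lip f ->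
  cv m (fun x => k x - k' x) f t = cv m k f t - cv m k' f t.
Proof.
move=> kk kk' lf; rewrite /cv -RintegralB//; [|exact: cv_integrable..].
by apply: eq_Rintegral => x _; rewrite mulrBl.
Qed.

Lemma eq_cv m k f g t : f =1 g -> cv m k f t = cv m k g t.
Proof. by move=> fg; apply: eq_Rintegral => x _; rewrite fg. Qed.

Lemma eq_cvk m k k' f t : k =1 k' -> cv m k f t = cv m k' f t.
Proof. by move=> kk'; apply: eq_Rintegral => x _; rewrite kk'. Qed.

Lemma cv_lip m k f : kernel1 m k -> lip f -> lip (cv m k f).
Proof.
move=> kk lf; have [L L0 fL] := lip_ge0 lf.
have ik := kernel1_integrable kk; have ink := kernel1_integrable (kernel1_norm kk).
exists (\int[m]_x `|k x| * L) => s t; rewrite /cv -RintegralB//;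
  [|exact: cv_integrable..].
apply: le_trans (le_normr_Rintegral _ _) _ => //.
  exact: (integrableB measurableT (cv_integrable s kk lf) (cv_integrable t kk lf)).
rewrite -mulrA -RintegralZr//; apply: le_Rintegral => //.
- apply: integrable_norm.
  exact: (integrableB measurableT (cv_integrable s kk lf) (cv_integrable t kk lf)).
- by have := integrableZr measurableT (L * `|s - t|) ink.
- move=> x _; rewrite -mulrBr normrM ler_wpM2l//.
  by apply: le_trans (fL _ _) _; rewrite opprB addrA subrK.
Qed.

(** Fubini. The inequality [1 + |x + y| <= (1 + |x|) (1 + |y|)] shares the growth of [f] between the
    two kernels, so the majorant is a product of two integrable functions. *)
Lemma cv_comm (m m' : {sigma_finite_measure set mR -> \bar R}) k k' f t :
  kernel1 m k -> kernel1 m' k' -> lip f ->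
  cv m k (cv m' k' f) t = cv m' k' (cv m k f) t.
Proof.
move=> kk kk' lf; have [C C0 fC] := lip_growth lf.
pose F (z : mR * mR) := (k z.1 * (k' z.2 * f (t - z.1 - z.2)))%:E.
have mF : measurable_fun setT F.
  apply/measurable_EFinP/measurable_funM.
    by apply: (measurableT_comp kk.1); exact: measurable_fst.
  apply: measurable_funM.
    by apply: (measurableT_comp kk'.1); exact: measurable_snd.
  apply: (measurableT_comp (lip_measurable lf)).
  apply: measurable_funB; last exact: measurable_snd.
  by apply: measurable_funB => //; exact: measurable_fst.
have iF : ((m \x m')%E).-integrable setT F.
  apply/integrable12ltyP => //.
  have meas k0 : measurable_fun setT k0 ->
      measurable_fun setT (fun y : mR => `|k0 y| * (1 + `|y|)).
    move=> mk0; apply: measurable_funM; first exact: measurableT_comp mk0.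
    by apply: measurable_funD => //; exact: measurableT_comp.
  have fin (mm : {measure set mR -> \bar R}) k0 : kernel1 mm k0 ->
      (\int[mm]_x (`|k0 x| * (1 + `|x|))%:E < +oo)%E.
    move=> [_ /integrable_int_lty]; apply: le_lt_trans.
    rewrite le_eqVlt; apply/orP; left; apply/eqP; apply: eq_integral => x _.
    by rewrite normrM [`|1 + _|]ger0_norm// addr_ge0.
  have p0 k0 (y : R) : 0 <= `|k0 y| * (1 + `|y|) by rewrite mulr_ge0// addr_ge0.
  set I := (\int[m']_y (`|k' y| * (1 + `|y|))%:E)%E.
  have If : I \is a fin_num by rewrite ge0_fin_numE ?fin// ge0_int_ge0.
  have I0 : 0 <= fine I by rewrite fine_ge0// ge0_int_ge0.
  have Ct : 0 <= C * (1 + `|t|) by rewrite mulr_ge0// addr_ge0.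
  apply: (@le_lt_trans _ _ (\int[m]_x
      (C * (1 + `|t|) * fine I * (`|k x| * (1 + `|x|)))%:E)%E); last first.
    rewrite ge0_intZl//; [|exact: meas kk.1|exact: mulr_ge0].
    by apply: lte_mul_pinfty => //; [rewrite lee_fin mulr_ge0|exact: fin].
  apply: ge0_le_integral => //.
  - by move=> x _; exact: integral_ge0.
  - have /= := measurable_fun_fubini_tonelli_F (m2 := m') (abse \o F).
    by apply => //; exact: measurableT_comp.
  - apply/measurable_EFinP; apply: measurable_funM => //; exact: meas kk.1.
  - move=> x _; rewrite mulrAC [in leRHS]EFinM fineK// -ge0_intZl//.
    + apply: ge0_int_le => //.
      * apply: measurableT_comp => //; apply/measurable_EFinP.
        exact: measurableT_comp mF (pair1_measurable x).
      * by apply: measurable_funM => //; exact: meas kk'.1.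
      * move=> y /=; rewrite !normrM.
        have := growth_shift t (x + y) fC C0; rewrite opprD addrA => h.
        have h2 : 1 + `|x + y| <= (1 + `|x|) * (1 + `|y|).
          by have := ler_normD x y; have := mulr_ge0 (normr_ge0 x) (normr_ge0 y); lra.
        have h3 : `|f (t - x - y)| <= C * (1 + `|t|) * ((1 + `|x|) * (1 + `|y|)).
          by apply: le_trans h _; rewrite ler_wpM2l.
        rewrite [leRHS](_ : _ = `|k x| * (`|k' y| *
          (C * (1 + `|t|) * ((1 + `|x|) * (1 + `|y|))))); last by ring.
        by do 2 rewrite ler_wpM2l//.
    + exact: meas kk'.1.
    + by rewrite mulr_ge0.
have := Fubini iF; rewrite /F /= => FF.
rewrite /cv /Rintegral; congr fine.
transitivity (\int[m]_x \int[m']_y (k x * (k' y * f (t - x - y)))%:E)%E.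
  apply: eq_integral => x _; rewrite EFinM -[(fine _)%:E]fineK//= fineK//.
    by rewrite -integralZl//; exact: cv_integrable.
  by apply: integrable_fin_num => //; exact: cv_integrable.
rewrite FF; apply: eq_integral => y _.
rewrite EFinM fineK//; last by apply: integrable_fin_num => //; exact: cv_integrable.
rewrite -integralZl//; last exact: cv_integrable.
by apply: eq_integral => x _; rewrite -EFinM mulrCA addrAC.
Qed.

End convolution.

(** * Translations and reflections of Lebesgue measure *)

Section lebesgue_invariance.
Context {R : realType}.
Local Notation mR := (measurableTypeR R).
Local Notation leb := (@lebesgue_measure R).

Lemma lebesgue_measure_shift (a : R) (A : set R) : measurable A ->
  pushforward leb ((fun x => x + a) : _ -> mR) A = leb A.
Proof.
move=> mA.
have mphi : measurable_fun setT ((fun x => x + a) : mR -> mR).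
  exact: measurable_funD.
pose phi : {mfun mR >-> mR} :=
  MeasurableFun.Pack (MeasurableFun.Class (isMeasurableFun.Build _ _ mR mR _ mphi)).
apply/esym.
apply: (@lebesgue_measure_unique R (pushforward leb phi)) => //= _ [[b c]] _ <-.
rewrite /pushforward /= (_ : _ @^-1` _ = `]b - a, c - a]%classic).
  rewrite !lebesgue_measure_itv/= !lte_fin ltrD2r; case: ifP => // _.
  by rewrite -!EFinB; congr EFin; ring.
by apply/seteqP; split => x /=; rewrite !in_itv/= ltrBlDr lerBrDr.
Qed.

Lemma integral_invariant (phi : mR -> mR) (f : R -> \bar R) :
  measurable_fun setT phi ->
  (forall A, measurable A -> pushforward leb phi A = leb A) ->
  measurable_fun setT f ->
  (\int[leb]_x f (phi x) = \int[leb]_x f x)%E.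
Proof.
move=> mphi inv mf.
pose psi : {mfun mR >-> mR} :=
  MeasurableFun.Pack (MeasurableFun.Class (isMeasurableFun.Build _ _ mR mR _ mphi)).
have ge0 g : measurable_fun setT g -> (forall x, (0 <= g x)%E) ->
    (\int[leb]_x g (phi x) = \int[leb]_x g x)%E.
  move=> mg g0.
  have := ge0_integral_pushforward mphi leb measurableT mg (fun x _ => g0 x).
  rewrite preimage_setT => <-.
  apply: (@eq_measure_integral _ mR _ _ _ (pushforward leb psi)) => A mA _.
  exact: inv.
rewrite integralE [RHS]integralE.
congr (_ - _)%E.
- have <- := ge0 _ (measurable_funepos mf) (funepos_ge0 f).
  by apply: eq_integral => x _; rewrite !funeposE.
- have <- := ge0 _ (measurable_funeneg mf) (funeneg_ge0 f).
  by apply: eq_integral => x _; rewrite !funenegE.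
Qed.

Lemma integral_shift (a : R) (f : R -> \bar R) : measurable_fun setT f ->
  (\int[leb]_x f (x + a)%R = \int[leb]_x f x)%E.
Proof.
apply: (@integral_invariant (fun x => x + a)); last exact: lebesgue_measure_shift.
exact: measurable_funD.
Qed.

Lemma integral_reflect (a : R) (f : R -> \bar R) : measurable_fun setT f ->
  (\int[leb]_x f (a - x)%R = \int[leb]_x f x)%E.
Proof.
move=> mf; rewrite -(integral_shift a mf).
rewrite -(@integral_invariant (-%R) (fun x => f (x + a)%R)) //=.
- by apply: eq_integral => x _; rewrite addrC.
- exact: lebesgue_measureN.
- by apply: (measurableT_comp mf); exact: measurable_funD.
Qed.

End lebesgue_invariance.

(** * Smoothing a law by a density; weighted bounds and derivatives of convolutions *)

Section density_kernels.
Context {R : realType}.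
Local Notation mR := (measurableTypeR R).
Local Notation leb := (@lebesgue_measure R).
Implicit Types (f g k : R -> R) (t x y : R).

Lemma cv_sym k f t : measurable_fun setT k -> measurable_fun setT f ->
  cv leb k f t = cv leb f k t.
Proof.
move=> mk mf; rewrite /cv /Rintegral; congr fine.
rewrite -(integral_reflect t).
  by apply: eq_integral => x _; rewrite opprB addrCA subrr addr0 mulrC.
apply/measurable_EFinP/measurable_funM => //.
by apply: measurableT_comp => //; exact: measurable_funB.
Qed.

(** It serves twice: with [f = 1 + |x|] and [t = 0] it gives the first moment of the smoothed
    density, and with a general [f] it justifies Fubini in the associativity of convolution. *)
Lemma shift_kernel_integrable (nu : probability mR R) k f t :
  kernel1 nu (cst 1) -> kernel1 leb k -> lip f ->
  (leb \x nu)%E.-integrable setT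
    (fun z : mR * mR => (k (z.1 - z.2) * f (t - z.1))%:E).
Proof.
move=> nu1 kk lf; have [C C0 fC] := lip_growth lf.
have mg y : measurable_fun setT (fun x => `|k x * f (t - y - x)|).
  by apply: measurableT_comp => //; apply: cv_measurable => //; case: kk.
have ms y : measurable_fun setT (fun x : mR => x - y) by exact: measurable_funB.
have mF : measurable_fun setT (fun z : mR * mR => (k (z.1 - z.2) * f (t - z.1))%:E).
  apply/measurable_EFinP/measurable_funM.
    apply: (measurableT_comp kk.1); apply: measurable_funB.
      exact: measurable_fst.
    exact: measurable_snd.
  apply: (measurableT_comp (lip_measurable lf)).
  by apply: measurable_funB => //; exact: measurable_fst.
apply/integrable21ltyP => //=.
have inner y : (\int[leb]_x `|k (x - y) * f (t - x)|%:E =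
    \int[leb]_x (`|k x * f (t - y - x)|)%:E)%E.
  rewrite -(@integral_shift _ (- y) (fun x => (`|k x * f (t - y - x)|)%:E)).
    by apply: eq_integral => x _; rewrite opprD opprK addrACA addNr addr0.
  exact/measurable_EFinP.
have [mk1 ik1] := kernel1_norm kk.
set I := (\int[leb]_x (`|k x| * (1 + `|x|))%:E)%E.
have Ifin : I \is a fin_num by exact: integrable_fin_num.
have p0 x : 0 <= `|k x| * (1 + `|x|) by rewrite mulr_ge0// addr_ge0.
have I0 : 0 <= fine I by rewrite fine_ge0// ge0_int_ge0.
have mp : measurable_fun setT (fun x => `|k x| * (1 + `|x|)).
  by apply: measurable_funM => //; apply: measurable_funD => //; exact: measurableT_comp.
have mq : measurable_fun setT (fun y : mR => 1 + `|y|).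
  by apply: measurable_funD => //; exact: measurableT_comp.
apply: (@le_lt_trans _ _ (\int[nu]_y (C * (1 + `|t|) * fine I * (1 + `|y|))%:E)%E); last first.
  rewrite ge0_intZl//; last by rewrite !mulr_ge0// addr_ge0.
  apply: lte_mul_pinfty => //; first by rewrite lee_fin !mulr_ge0// addr_ge0.
  have [_ /integrable_int_lty] := nu1; apply: le_lt_trans.
  apply: ge0_int_le => //.
  - by apply: measurableT_comp => //; apply: measurable_funM.
  - by move=> y; rewrite mul1r ler_norm.
apply: ge0_le_integral => //.
- by move=> y _; exact: integral_ge0.
- have /= := measurable_fun_fubini_tonelli_G (m1 := leb)
    (abse \o (fun z : mR * mR => (k (z.1 - z.2) * f (t - z.1))%:E)).
  by apply => //; exact: measurableT_comp.
- by apply/measurable_EFinP; apply: measurable_funM.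
- move=> y _ /=; rewrite inner.
  rewrite mulrAC [in leRHS]EFinM fineK// -ge0_intZl//.
  + apply: ge0_int_le => //; [exact: mg|by apply: measurable_funM|].
    move=> x; rewrite normrM.
    have h := growth_shift (t - y) x fC C0.
    have h2 : 1 + `|t - y| <= (1 + `|t|) * (1 + `|y|).
      by have := ler_normB t y; have := mulr_ge0 (normr_ge0 t) (normr_ge0 y); lra.
    rewrite mulrCA ler_wpM2l//; apply: le_trans h _.
    rewrite -!mulrA ler_wpM2l// mulrA ler_wpM2r// addr_ge0//.
  + by rewrite !mulr_ge0// addr_ge0.
Qed.

Lemma smooth_kernel1 (nu : probability mR R) k :
  kernel1 nu (cst 1) -> kernel1 leb k -> lip k ->
  kernel1 leb (cv nu (cst 1) k).
Proof.
move=> nu1 kk lk; split.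
  by apply: lip_measurable; exact: cv_lip.
have l1 : lip (fun x : R => 1 + `|x|).
  exists 1 => x y; rewrite mul1r [X in `|X|](_ : _ = `|x| - `|y|); last by ring.
  exact: ler_dist_dist.
have := integrable_fubini_F (shift_kernel_integrable 0 nu1 kk l1).
apply: eq_integrable => // x _; rewrite /fubini_F/= sub0r normrN EFinM.
under eq_integral do rewrite EFinM.
have ik := cv_integrable x nu1 lk.
rewrite integralZr//; last first.
  by apply: eq_integrable ik => // y _; rewrite mul1r.
rewrite Rintegral_EFin//; congr (_ * _)%E.
by apply: eq_integral => y _; rewrite mul1r.
Qed.

Lemma cv_smooth_kernel (nu : probability mR R) k f t :
  kernel1 nu (cst 1) -> kernel1 leb k -> lip k -> lip f ->
  cv leb (cv nu (cst 1) k) f t = cv nu (cst 1) (cv leb k f) t.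
Proof.
move=> nu1 kk lk lf.
have := Fubini (shift_kernel_integrable t nu1 kk lf); rewrite /= => FF.
rewrite {1 3}/cv /Rintegral; congr fine.
transitivity (\int[leb]_x \int[nu]_y (k (x - y) * f (t - x))%:E)%E.
  apply: eq_integral => x _; rewrite EFinM.
  under [RHS]eq_integral do rewrite EFinM.
  have ik := cv_integrable x nu1 lk.
  rewrite integralZr//; last by apply: eq_integrable ik => // y _; rewrite mul1r.
  rewrite Rintegral_EFin//; congr (_ * _)%E.
  by apply: eq_integral => y _; rewrite mul1r.
rewrite FF; apply: eq_integral => y _.
rewrite mul1r Rintegral_EFin; last exact: cv_integrable.
rewrite -(@integral_shift _ (- y) (fun x => (k x * f (t - y - x))%:E)).
  by apply: eq_integral => x _; rewrite opprD opprK addrACA addNr addr0.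
by apply/measurable_EFinP; apply: cv_measurable => //; case: kk.
Qed.

(** Submultiplicativity gives [w t <= w x * w (t - x)] under the integral: one factor goes to the
    kernel and the other to [f]. *)
Lemma cv_weight (m : {measure set mR -> \bar R}) (w k f : R -> R) (A B t : R) :
  kernel1 m k -> lip f -> measurable_fun setT w -> (forall x, 0 <= w x) ->
  (forall x y, w (x + y) <= w x * w y) ->
  (\int[m]_x (w x * `|k x|)%:E <= A%:E)%E ->
  (forall x, w x * `|f x| <= B) ->
  w t * `|cv m k f t| <= A * B.
Proof.
move=> kk lf mw w0 wM kA fB.
have B0 : 0 <= B by apply: le_trans (fB 0); rewrite mulr_ge0.
have ic := cv_integrable t kk lf.
have mkn : measurable_fun setT (fun x => `|k x|).
  by apply: measurableT_comp => //; case: kk.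
have mcn : measurable_fun setT (fun x => `|k x * f (t - x)|).
  by apply: measurableT_comp => //; apply: cv_measurable => //; case: kk.
rewrite -lee_fin EFinM EFin_normr_Rintegral//.
apply: (@le_trans _ _ ((w t)%:E * \int[m]_x `|k x * f (t - x)|%:E)%E).
  rewrite lee_wpmul2l ?lee_fin//; apply: le_abse_integral => //.
  by case/integrableP : ic.
rewrite -ge0_intZl//.
apply: (@le_trans _ _ (\int[m]_x (B * (w x * `|k x|))%:E)%E).
  apply: ge0_int_le => //.
  - by apply: measurable_funM.
  - by apply: measurable_funM => //; apply: measurable_funM.
  - by move=> x; rewrite mulr_ge0.
  - move=> x; have := wM x (t - x); rewrite addrCA subrr addr0 => h.
    rewrite normrM; apply: (@le_trans _ _ (w x * w (t - x) * (`|k x| * `|f (t - x)|))).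
      by rewrite ler_wpM2r// mulr_ge0.
    rewrite [leLHS](_ : _ = w x * `|k x| * (w (t - x) * `|f (t - x)|)); last by ring.
    by rewrite mulrC ler_wpM2r// mulr_ge0.
rewrite ge0_intZl//; [|by apply: measurable_funM|by move=> x; rewrite mulr_ge0].
by rewrite mulrC EFinM lee_wpmul2l// lee_fin.
Qed.

Lemma is_derive_lip f f1 M : (forall x : R, is_derive x 1 f (f1 x)) ->
  (forall x, `|f1 x| <= M) -> lip f.
Proof.
move=> df fM; exists M.
have cf : continuous f.
  by move=> x; apply: differentiable_continuous; apply/derivable1_diffP; case: (df x).
suff key a b : a <= b -> `|f b - f a| <= M * `|b - a|.
  move=> x y; have [/key|/ltW/key//] := leP x y.
  by rewrite distrC [`|y - x|]distrC.
move=> ab; have [] := @MVT_segment _ f f1 a b ab => //.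
  exact: continuous_subspaceT.
by move=> c _ ->; rewrite normrM ler_wpM2r.
Qed.

Lemma taylor1_lip f f1 L x h : (forall x : R, is_derive x 1 f (f1 x)) ->
  (forall x y, `|f1 x - f1 y| <= L * `|x - y|) -> 0 <= L ->
  `|f (x + h) - f x - h * f1 x| <= L * h ^+ 2.
Proof.
move=> df lf L0.
have cf : continuous f.
  by move=> y; apply: differentiable_continuous; apply/derivable1_diffP; case: (df y).
have key a b : a <= b -> exists2 c, a <= c <= b & f b - f a = f1 c * (b - a).
  move=> ab; have [] := @MVT_segment _ f f1 a b ab => //.
    exact: continuous_subspaceT.
  by move=> c; rewrite in_itv/= => cab ->; exists c.
have bound c : `|c - x| <= `|h| -> `|(f1 c - f1 x) * h| <= L * h ^+ 2.
  move=> ch; rewrite normrM; apply: (@le_trans _ _ (L * `|c - x| * `|h|)).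
    by rewrite ler_wpM2r.
  rewrite (_ : h ^+ 2 = `|h| * `|h|); last by rewrite -expr2 real_normK ?num_real.
  by rewrite mulrA ler_wpM2r// ler_wpM2l.
have [h0|h0] := leP 0 h.
  have [|c /andP[c1 c2] e] := key x (x + h); first by rewrite lerDl.
  rewrite e (_ : _ - _ = (f1 c - f1 x) * h); last by ring.
  by apply: bound; rewrite !ger0_norm//; lra.
have [|c /andP[c1 c2] e] := key (x + h) x; first by lra.
rewrite (_ : f (x + h) - f x - h * f1 x = (f1 c - f1 x) * h); last first.
  by rewrite -[f (x + h) - f x]opprB e; ring.
by apply: bound; rewrite !ler0_norm//; lra.
Qed.

Lemma is_derive_quadratic f (l L x : R) :
  (forall h, `|f (x + h) - f x - h * l| <= L * h ^+ 2) -> is_derive x 1 f l.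
Proof.
move=> fL; have L0 : 0 <= L by have := le_trans (normr_ge0 _) (fL 1); rewrite expr1n mulr1.
have cvl : h^-1 *: ((f \o shift x) (h *: 1) - f x) @[h --> 0^'] --> (l : R^o).
  apply/cvgrPdist_le => e e0; near=> h.
  have h0 : h != 0 by near: h; exact: nbhs_dnbhs_neq.
  rewrite distrC [X in `|X|](_ : _ = h^-1 * (f (x + h) - f x - h * l)); last first.
    by rewrite /= [h *: 1]mulr1 [h + x]addrC /GRing.scale/=; field.
  rewrite normrM normfV ler_pdivrMl ?normr_gt0//.
  apply: le_trans (fL h) _.
  have hh : h ^+ 2 = `|h| * `|h| by rewrite -expr2 real_normK ?num_real.
  rewrite hh mulrCA ler_wpM2l// mulrC.
  have : `|h| <= e / (L + 1).
    near: h; apply: dnbhs0_le; rewrite divr_gt0// ltr_wpDl//.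
  rewrite ler_pdivlMr ?ltr_wpDl// => hL; apply: le_trans hL.
  by rewrite ler_wpM2l// lerDl.
by apply: DeriveDef; [apply/cvg_ex; exists l|exact/cvg_lim].
Unshelve. all: by end_near. Qed.

(** A Lipschitz derivative gives a quadratic Taylor remainder that is uniform in the base point. It
    can be integrated against [|k|], so no limit has to be exchanged with the integral. *)
Lemma cv_derive (m : {measure set mR -> \bar R}) k f f1 t : kernel1 m k ->
  (forall x : R, is_derive x 1 f (f1 x)) -> lip f -> lip f1 ->
  is_derive t 1 (cv m k f) (cv m k f1 t).
Proof.
move=> kk df lf lf1; have [L L0 fL] := lip_ge0 lf1.
have ik := kernel1_integrable (kernel1_norm kk).
apply: (@is_derive_quadratic _ _ (\int[m]_x `|k x| * L)) => h.
have i1 := cv_integrable t kk lf1.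
have ih := cv_integrable (t + h) kk lf; have i0 := cv_integrable t kk lf.
have ihB := integrableB measurableT ih i0.
have ihD := integrableB measurableT ihB (integrableZl measurableT h i1).
rewrite /cv -RintegralB// -RintegralZl// -RintegralB//; last first.
  exact: (integrableZl measurableT h i1).
apply: le_trans (le_normr_Rintegral _ _) _ => //.
rewrite -mulrA -RintegralZr//; apply: le_Rintegral => //.
- exact: integrable_norm.
- by have := integrableZr measurableT (L * h ^+ 2) ik.
- move=> x _; rewrite [X in `|X|](_ : _ = k x *
    (f (t - x + h) - f (t - x) - h * f1 (t - x))); last first.
    by rewrite (_ : t + h - x = t - x + h); ring.
  by rewrite normrM ler_wpM2l//; exact: taylor1_lip.
Qed.

End density_kernels.

(** * The fundamental theorem of calculus on unbounded intervals *)

Section improper_FTC.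
Context {R : realType}.
Local Notation leb := (@lebesgue_measure R).
Implicit Types (f F : R -> R) (a C : R).

(** The theorem is applied on the segments that exhaust [D]; dominated convergence with majorant
    [|f|] then passes to the limit. *)
Lemma FTC_exhaust f F (D : set R) (a_ b_ : nat -> R) (l : R) :
  measurable D -> (forall x : R, is_derive x 1 F (f x)) -> continuous f ->
  leb.-integrable setT (fun x => (f x)%:E) ->
  (forall n, a_ n < b_ n) -> (forall n, `[a_ n, b_ n] `<=` D) ->
  (forall x, D x -> \forall n \near \oo, a_ n <= x <= b_ n) ->
  F (b_ n) - F (a_ n) @[n --> \oo] --> l ->
  \int[leb]_(x in D) f x = l.
Proof.
move=> mD dF cf fi ab abD nab Fl.
have cF : continuous F.
  by move=> x; apply: differentiable_continuous; apply/derivable1_diffP; case: (dF x).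
have FTC n : (\int[leb]_(x in `[a_ n, b_ n]) (f x)%:E = (F (b_ n) - F (a_ n))%:E)%E.
  rewrite (@continuous_FTC2 _ f F)//.
  - exact: continuous_subspaceT.
  - split=> [x _||].
    + by case: (dF x).
    + by apply: cvg_at_right_filter; exact: cF.
    + by apply: cvg_at_left_filter; exact: cF.
  - by move=> x _; rewrite derive1E; have [_ ->] := dF x.
pose f_ (n : nat) := (fun x => (f x)%:E) \_ `[a_ n, b_ n].
have mf : measurable_fun setT (fun x => (f x)%:E) by case/integrableP : fi.
have mf_ n : measurable_fun D (f_ n).
  apply: measurable_funTS; apply/(measurable_restrictT _ _).1 => //.
  exact: measurable_funTS.
have [] := @dominated_convergence _ _ _ leb D mD f_ (fun x => (f x)%:E)
   (fun x => `|f x|%:E) mf_ (measurable_funTS mf).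
- apply: aeW => x Dx; apply: cvg_near_cst.
  near=> n; rewrite /f_ patchE mem_set//=; rewrite in_itv/=.
  by near: n; exact: nab.
- by apply: (@integrableS _ _ _ leb setT) => //; have := integrable_norm fi.
- apply: aeW => x n Dx; rewrite /f_ patchE; case: ifP => // _.
  by rewrite abse0 lee_fin.
move=> _ _ cv; rewrite /Rintegral; suff -> : (\int[leb]_(x in D) (f x)%:E = l%:E)%E by [].
apply: (cvg_unique _ cv) => //.
rewrite (_ : [sequence _]_n = fun n => (F (b_ n) - F (a_ n))%:E).
  exact: cvg_EFin (nearW _ _) _.
apply/funext => n /=; rewrite -FTC [LHS]integral_mkcond [RHS]integral_mkcond; apply: eq_integral => x _.
rewrite !patchE; case: ifPn => // xD.
case: ifPn => // /set_mem /abD/mem_set; by rewrite (negbTE xD).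
Unshelve. all: by end_near. Qed.

Lemma decay_cvg0 F C (b_ : nat -> R) (c : R) : (forall x, (1 + `|x|) * `|F x| <= C) ->
  (forall n, n%:R - c <= `|b_ n|) -> F (b_ n) @[n --> \oo] --> 0.
Proof.
move=> FC bn; apply/cvgrPdist_le => e e0; near=> n; rewrite sub0r normrN.
have C0 : 0 <= C by apply: le_trans (FC 0); rewrite mulr_ge0// addr_ge0.
have nC : C / e + c <= n%:R by near: n; exact: nbhs_infty_ger.
have h := FC (b_ n); have hb := bn n.
have p0 : 0 < 1 + `|b_ n| by rewrite ltr_wpDr.
have : C <= e * (1 + `|b_ n|).
  rewrite mulrC -ler_pdivrMr//; lra.
move=> /(le_trans h); rewrite mulrC ler_pM2r//.
Unshelve. all: by end_near. Qed.

Lemma FTC_halfline f F a C : (forall x : R, is_derive x 1 F (f x)) -> continuous f ->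
  leb.-integrable setT (fun x => (f x)%:E) -> (forall x, (1 + `|x|) * `|F x| <= C) ->
  \int[leb]_(x in `[a, +oo[) f x = - F a.
Proof.
move=> dF cf fi FC.
apply: (@FTC_exhaust f F _ (fun=> a) (fun n => a + n.+1%:R)) => //.
- by move=> n; rewrite ltrDl.
- by move=> n x /=; rewrite !in_itv/= andbT => /andP[].
- move=> x /=; rewrite in_itv/= andbT => ax; near=> n; rewrite ax andTb.
  rewrite -lerBlDl -[n.+1%:R]natr1 (@le_trans _ _ n%:R)// ?lerDl//.
  by near: n; exact: nbhs_infty_ger.
- rewrite -[X in _ --> X]add0r; apply: (@cvgB _ R^o); last exact: cvg_cst.
  apply: (@decay_cvg0 _ C _ `|a|) => // n.
  have := lerB_normD (n.+1%:R) a; rewrite [`|n.+1%:R|]ger0_norm// [n.+1%:R + a]addrC.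
  have : n%:R <= n.+1%:R :> R by rewrite ler_nat.
  by lra.
Unshelve. all: by end_near. Qed.

Lemma FTC_line f F C : (forall x : R, is_derive x 1 F (f x)) -> continuous f ->
  leb.-integrable setT (fun x => (f x)%:E) -> (forall x, (1 + `|x|) * `|F x| <= C) ->
  \int[leb]_x f x = 0.
Proof.
move=> dF cf fi FC.
apply: (@FTC_exhaust f F _ (fun n => - n.+1%:R) (fun n => n.+1%:R)) => //.
- by move=> n; rewrite gtrN.
- move=> x _; near=> n; rewrite -ler_norml -natr1 (@le_trans _ _ n%:R) ?lerDl//.
  by near: n; exact: nbhs_infty_ger.
- rewrite -[X in _ --> X](subr0 0); apply: (@cvgB _ R^o).
    by apply: (@decay_cvg0 _ C _ 0) => // n; rewrite ger0_norm// subr0 ler_nat.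
  by apply: (@decay_cvg0 _ C _ 0) => // n; rewrite normrN ger0_norm// subr0 ler_nat.
Unshelve. all: by end_near. Qed.

End improper_FTC.

(** * Derivatives of Gaussian densities *)

Section gaussian_derivatives.
Context {R : realType}.
Local Notation mR := (measurableTypeR R).
Local Notation leb := (@lebesgue_measure R).
Implicit Types (u v x y t : R) (m : nat).

(** The recursion is the one obtained by differentiating [H(y) exp(- y^2 / 2)]; the result is
    [(-1)^m] times the usual probabilists' Hermite polynomial. *)
Fixpoint hermite m : {poly R} :=
  if m is k.+1 then (hermite k)^`() - 'X * hermite k else 1.

Definition std_gauss x : R := (Num.sqrt (2 * pi))^-1 * expR (- (x ^+ 2) / 2).

(* [u] is the variance, not the standard deviation. *)
Definition gauss_der u m x : R :=
  (Num.sqrt u)^-1 ^+ m.+1 *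
  ((hermite m).[x / Num.sqrt u] * std_gauss (x / Num.sqrt u)).

Local Notation gd := gauss_der.

Lemma is_derive_std_gauss x : is_derive x 1 std_gauss (- x * std_gauss x).
Proof.
rewrite /std_gauss; apply: is_derive_eq.
by rewrite /GRing.scale/=; field; rewrite sqrtr_eq0 -ltNge mulr_gt0// pi_gt0.
Qed.

Lemma is_derive_gd u m x : is_derive x 1 (gd u m) (gd u m.+1 x).
Proof.
pose s := (Num.sqrt u)^-1.
have d1 : is_derive x 1 (fun x => x * s) s.
  by apply: is_derive_eq; rewrite /GRing.scale/= mulr0 mulr1 add0r.
pose H (y : R) := (hermite m).[y] * std_gauss y.
have d2 (y : R) : is_derive y 1 H ((hermite m.+1).[y] * std_gauss y).
  have dp := is_derive_poly (hermite m) y.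
  have dg := is_derive_std_gauss y.
  have := is_deriveM dp dg; rewrite /GRing.scale/= => dd.
  apply: (is_derive_eq dd); rewrite /= hornerD hornerN hornerM hornerX; ring.
have d3 := @is_derive1_comp _ H (fun x => x * s) x _ _ (d2 (x * s)) d1.
have d4 := is_deriveZ (s ^+ m.+1) d3.
suff -> : gd u m.+1 x = s ^+ m.+1 *: ((hermite m.+1).[x * s] * std_gauss (x * s) * s).
  exact: d4.
by rewrite /gd -/s /GRing.scale/= exprS; ring.
Qed.

Lemma gd_continuous u m : continuous (gd u m).
Proof.
move=> x; apply: differentiable_continuous; apply/derivable1_diffP.
by case: (is_derive_gd u m x).
Qed.

Lemma gd_measurable u m : measurable_fun setT (gd u m).
Proof. by apply: continuous_measurable_fun; exact: gd_continuous. Qed.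

Lemma std_gauss_gt0 x : 0 < std_gauss x.
Proof. by rewrite mulr_gt0 ?expR_gt0// invr_gt0 sqrtr_gt0 mulr_gt0// pi_gt0. Qed.

Lemma gd0_scale u x : gd u 0 x = (Num.sqrt u)^-1 * std_gauss (x / Num.sqrt u).
Proof. by rewrite /gd expr1 hornerC mul1r. Qed.

Lemma gd0_gt0 u x : 0 < u -> 0 < gd u 0 x.
Proof.
move=> u0; rewrite gd0_scale mulr_gt0 ?std_gauss_gt0//.
by rewrite invr_gt0 sqrtr_gt0.
Qed.

Lemma gd0E u x : 0 < u -> gd u 0 x = normal_pdf 0 (Num.sqrt u) x.
Proof.
move=> u0; have s0 : Num.sqrt u != 0 by rewrite gt_eqF// sqrtr_gt0.
rewrite normal_pdfE// /normal_peak /normal_fun gd0_scale /std_gauss.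
rewrite mulrA -invfM -(sqrtrM _ (ltW u0)) subr0; congr (_^-1 * expR _).
- by congr Num.sqrt; rewrite sqr_sqrtr ?ltW//; ring.
- rewrite exprMn exprVn -[in RHS]mulr_natr; field.
  by rewrite s0.
Qed.

Lemma integral_gd0 u : 0 < u -> (\int[leb]_x (gd u 0 x)%:E = 1)%E.
Proof.
move=> u0; rewrite -(integral_normal_pdf 0 (Num.sqrt u)).
by apply: eq_integral => x _; rewrite gd0E.
Qed.

Lemma integral_gd0_shift u y : 0 < u -> (\int[leb]_x (gd u 0 (x - y))%:E = 1)%E.
Proof.
move=> u0; rewrite -(integral_gd0 u0).
apply: (@integral_shift _ (- y) (fun x => (gd u 0 x)%:E)).
by apply/measurable_EFinP; exact: gd_measurable.
Qed.

Lemma poly_growth (p : {poly R}) : exists2 C, 0 <= C &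
  forall x, `|p.[x]| <= C * (1 + `|x|) ^+ size p.
Proof.
exists (\sum_(i < size p) `|p`_i|); first exact: sumr_ge0.
move=> x; rewrite horner_coef mulr_suml; apply: le_trans (ler_norm_sum _ _ _) _.
apply: ler_sum => i _; rewrite normrM ler_wpM2l// normrX.
apply: (@le_trans _ _ ((1 + `|x|) ^+ i)).
  by apply: lerXn2r; rewrite ?nnegrE ?addr_ge0// lerDr.
by rewrite ler_weXn2l// ?lerDl// ltnW.
Qed.

(** Only half of the Gaussian exponent [x^2 / 2] is given up, which later turns variance [u] into
    [2 u]. The bound rests on [N |x| <= N^2 + x^2 / 4]. *)
Lemma poly_expR (p : {poly R}) : exists2 C, 0 <= C &
  forall x, (1 + `|x|) ^+ 5 * `|p.[x]| <= C * expR (x ^+ 2 / 4).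
Proof.
have [C C0 pC] := poly_growth p; pose N := (5 + size p)%N.
exists (C * expR (N%:R ^+ 2)); first by rewrite mulr_ge0// expR_ge0.
move=> x; apply: (@le_trans _ _ (C * (1 + `|x|) ^+ N)).
  by rewrite exprD mulrCA ler_wpM2l.
rewrite -mulrA ler_wpM2l// -expRD.
apply: (@le_trans _ _ (expR (N%:R * `|x|))).
  rewrite expRM_natl lerXn2r// ?nnegrE ?expR_ge0 ?addr_ge0//.
  exact: expR_ge1Dx.
rewrite ler_expR -[x ^+ 2]real_normK ?num_real//.
have := sqr_ge0 (N%:R - `|x| / 2); rewrite sqrrB; lra.
Qed.

(** Domination by a multiple of a probability density, weight included: its supremum and its
    integral are both explicit, so the weighted sup and mass bounds on all derivatives come from
    this one estimate. *)
Lemma gd_bound m : exists2 C, 0 <= C & forall u x, 0 < u ->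
  (1 + `|x| / Num.sqrt u) ^+ 5 * `|gd u m x| <=
  C * ((Num.sqrt u)^-1 ^+ m * gd (2 * u) 0 x).
Proof.
have [C C0 pC] := poly_expR (hermite m).
exists (C * Num.sqrt 2); first by rewrite mulr_ge0.
move=> u x u0; set s := Num.sqrt u.
have s0 : 0 < s by rewrite sqrtr_gt0.
have si0 : 0 < s^-1 by rewrite invr_gt0.
have r2 : 0 < Num.sqrt 2 :> R by rewrite sqrtr_gt0.
have := pC (x / s); rewrite normrM normfV (gtr0_norm s0) => h.
have g0 := std_gauss_gt0 (x / s).
rewrite [gd u m x]/gauss_der -/s [`|_ * (_ * _)|]normrM [`|_ * std_gauss _|]normrM.
rewrite (gtr0_norm g0) (ger0_norm (exprn_ge0 m.+1 (ltW si0))).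
rewrite gd0_scale sqrtrM// -/s.
have e1 : std_gauss (x / (Num.sqrt 2 * s)) = std_gauss (x / s) * expR ((x / s) ^+ 2 / 4).
  rewrite /std_gauss -mulrA -expRD; congr (_ * expR _).
  rewrite !exprMn !exprVn exprMn sqr_sqrtr//; field.
  by rewrite gt_eqF.
rewrite e1.
rewrite [leLHS](_ : _ = s^-1 ^+ m.+1 * std_gauss (x / s) *
    ((1 + `|x| / s) ^+ 5 * `|(hermite m).[x / s]|)); last by ring.
rewrite [leRHS](_ : _ = s^-1 ^+ m.+1 * std_gauss (x / s) *
    (C * expR ((x / s) ^+ 2 / 4))); last first.
  by rewrite [s^-1 ^+ m.+1]exprS; field; rewrite !gt_eqF.
by rewrite ler_wpM2l// mulr_ge0 ?(ltW g0)// exprn_ge0// invr_ge0 ltW.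
Qed.

End gaussian_derivatives.

(** * Weighted norms of Gaussian derivatives and their action on the ramp *)

Section gaussian_kernels.
Context {R : realType}.
Local Notation mR := (measurableTypeR R).
Local Notation leb := (@lebesgue_measure R).
Local Notation gd := gauss_der.
Implicit Types (u v x y t a b : R) (m : nat) (f k : R -> R).

Lemma is_derive_mulf (f g : R -> R) x p q : is_derive x 1 f p -> is_derive x 1 g q ->
  is_derive x 1 (fun y => f y * g y) (p * g x + f x * q).
Proof.
move=> df dg; suff -> : p * g x + f x * q = f x *: q + g x *: p.
  exact: (is_deriveM df dg).
by rewrite /GRing.scale/=; ring.
Qed.

Lemma is_derive_addf (f g : R -> R) x p q : is_derive x 1 f p -> is_derive x 1 g q ->
  is_derive x 1 (fun y => f y + g y) (p + q).
Proof. by move=> df dg; exact: (is_deriveD df dg). Qed.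

Definition wgt a x := 1 + `|x| / a.

Lemma wgt_ge1 a x : 0 < a -> 1 <= wgt a x.
Proof. by move=> a0; rewrite lerDl divr_ge0// ltW. Qed.

Lemma wgt_ge0 a x : 0 < a -> 0 <= wgt a x.
Proof. by move=> a0; apply: le_trans (wgt_ge1 x a0). Qed.

Lemma wgtM a x y : 0 < a -> wgt a (x + y) <= wgt a x * wgt a y.
Proof.
move=> a0; have p0 (z : R) : 0 <= `|z| / a by rewrite divr_ge0// ltW.
have : `|x + y| / a <= `|x| / a + `|y| / a.
  by rewrite -mulrDl ler_pM2r ?invr_gt0//; exact: ler_normD.
by have := mulr_ge0 (p0 x) (p0 y); rewrite /wgt; lra.
Qed.

Lemma wgtXM j a x y : 0 < a -> wgt a (x + y) ^+ j <= wgt a x ^+ j * wgt a y ^+ j.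
Proof.
move=> a0; rewrite -exprMn lerXn2r ?nnegrE ?mulr_ge0 ?wgt_ge0//.
exact: wgtM.
Qed.

Lemma wgtX_le i j a x : (i <= j)%N -> 0 < a -> wgt a x ^+ i <= wgt a x ^+ j.
Proof. by move=> ij a0; rewrite ler_weXn2l// wgt_ge1. Qed.

Lemma wgt_measurable j a : measurable_fun setT (fun x => wgt a x ^+ j).
Proof.
apply: measurable_funX; apply: measurable_funD => //.
by apply: measurable_funM => //; exact: measurableT_comp.
Qed.

Lemma wgt_anti j a b x : 0 < a -> a <= b -> wgt b x ^+ j <= wgt a x ^+ j.
Proof.
move=> a0 ab; have b0 := lt_le_trans a0 ab.
rewrite lerXn2r ?nnegrE ?wgt_ge0// lerD2l ler_wpM2l// lef_pV2//.
Qed.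

(** The variances met during the exchange go up to [4 n], hence the scales up to [2 sqrt n]; a
    weight at scale [sqrt n] is compared with theirs at the price of a constant. *)
Lemma wgt_double j a b x : 0 < a -> 0 < b -> b <= 2 * a ->
  wgt a x ^+ j <= 2 ^+ j * wgt b x ^+ j.
Proof.
move=> a0 b0 ba; rewrite -exprMn lerXn2r ?nnegrE ?mulr_ge0 ?wgt_ge0//.
rewrite /wgt mulrDr mulr1 lerD ?lerDl// mulrCA ler_wpM2l//.
by rewrite -[leLHS]mul1r ler_pdivrMr// mulrAC ler_pdivlMr// mul1r.
Qed.

Lemma wgt1_le a x : 0 < a -> 1 + `|x| <= (1 + a) * wgt a x.
Proof.
move=> a0; rewrite /wgt.
have -> : (1 + a) * (1 + `|x| / a) = 1 + a + `|x| / a + `|x|.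
  by field; rewrite gt_eqF.
have : 0 <= `|x| / a by rewrite divr_ge0// ltW.
lra.
Qed.

Lemma std_gauss_le x : std_gauss x <= (Num.sqrt (2 * pi))^-1.
Proof.
rewrite /std_gauss ler_piMr ?invr_ge0// -expR0 ler_expR.
by rewrite mulNr oppr_le0 divr_ge0// sqr_ge0.
Qed.

Lemma gd_sup m : exists2 C, 0 <= C & forall u x, 0 < u ->
  wgt (Num.sqrt u) x ^+ 5 * `|gd u m x| <= C * (Num.sqrt u)^-1 ^+ m.+1.
Proof.
have [C C0 gC] := @gd_bound R m; exists (C * (Num.sqrt (2 * pi))^-1).
  by rewrite mulr_ge0// invr_ge0.
move=> u x u0; rewrite /wgt; apply: (le_trans (gC u x u0)).
have s0 : 0 < Num.sqrt u by rewrite sqrtr_gt0.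
rewrite -mulrA ler_wpM2l// exprSr [leRHS]mulrCA ler_wpM2l ?exprn_ge0 ?invr_ge0//.
rewrite gd0_scale [leRHS]mulrC ler_pM ?invr_ge0 ?(ltW (std_gauss_gt0 _))//; last exact: std_gauss_le.
rewrite lef_pV2 ?posrE ?sqrtr_gt0 ?mulr_gt0// ler_sqrt ?mulr_gt0//.
  by rewrite ler_peMl// ?ltW// ltr1n.
by rewrite mulr_ge0// ltW.
Qed.

Lemma gd_intw m : exists2 C, 0 <= C & forall u, 0 < u ->
  (\int[leb]_x (wgt (Num.sqrt u) x ^+ 5 * `|gd u m x|)%:E <=
   (C * (Num.sqrt u)^-1 ^+ m)%:E)%E.
Proof.
have [C C0 gC] := @gd_bound R m; exists C => // u u0.
have u20 : 0 < 2 * u by rewrite mulr_gt0.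
have s0 : 0 < Num.sqrt u by rewrite sqrtr_gt0.
apply: (@le_trans _ _ (\int[leb]_x (C * (Num.sqrt u)^-1 ^+ m * gd (2 * u) 0 x)%:E)%E).
  apply: ge0_int_le.
  - apply: measurable_funM; first exact: wgt_measurable.
    by apply: measurableT_comp => //; exact: gd_measurable.
  - by apply: measurable_funM => //; exact: gd_measurable.
  - by move=> x; rewrite mulr_ge0 ?exprn_ge0 ?wgt_ge0.
  - by move=> x; rewrite -mulrA; exact: gC.
rewrite ge0_intZl ?integral_gd0 ?mule1//.
- exact: gd_measurable.
- by move=> x; exact/ltW/gd0_gt0.
- by rewrite mulr_ge0// exprn_ge0// invr_ge0 ltW.
Qed.

(** The qualitative companion of [gd_sup]: here [C] depends on [u]. It disposes of boundary terms
    and yields boundedness. *)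
Lemma gd_decay u m : 0 < u ->
  exists2 C, 0 <= C & forall x, (1 + `|x|) ^+ 5 * `|gd u m x| <= C.
Proof.
move=> u0; have [C C0 gC] := gd_sup m; have s0 : 0 < Num.sqrt u by rewrite sqrtr_gt0.
exists ((1 + Num.sqrt u) ^+ 5 * (C * (Num.sqrt u)^-1 ^+ m.+1)).
  by rewrite !mulr_ge0 ?exprn_ge0 ?addr_ge0 ?invr_ge0 ?sqrtr_ge0.
move=> x; apply: (@le_trans _ _ ((1 + Num.sqrt u) ^+ 5 *
    (wgt (Num.sqrt u) x ^+ 5 * `|gd u m x|))); last first.
  by rewrite ler_wpM2l ?gC// exprn_ge0// addr_ge0// sqrtr_ge0.
rewrite mulrA ler_wpM2r// -exprMn lerXn2r ?nnegrE ?mulr_ge0 ?addr_ge0 ?wgt_ge0 ?sqrtr_ge0//.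
exact: wgt1_le.
Qed.

Lemma gd_bounded u m : 0 < u -> exists2 C, 0 <= C & forall x, `|gd u m x| <= C.
Proof.
move=> u0; have [C C0 gC] := gd_decay m u0; exists C => // x.
apply: le_trans (gC x); rewrite ler_peMl// exprn_ege1// lerDl//.
Qed.

Lemma gd_lip u m : 0 < u -> lip (gd u m).
Proof.
move=> u0; have [C C0 gC] := gd_bounded m.+1 u0.
by apply: (is_derive_lip _ gC) => x; exact: is_derive_gd.
Qed.

Lemma gd_integrable u m (h : R -> R) M : 0 < u -> measurable_fun setT h ->
  (forall x, `|h x| <= M * (1 + `|x|) ^+ 5) ->
  leb.-integrable setT (fun x => (gd u m x * h x)%:E).
Proof.
move=> u0 mh hM; have [C C0 gC] := gd_intw m.
have s0 : 0 < Num.sqrt u by rewrite sqrtr_gt0.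
have M0 : 0 <= M by have := le_trans (normr_ge0 _) (hM 0); rewrite normr0 addr0 expr1n mulr1.
apply: int_lty_integrable; first by apply: measurable_funM => //; exact: gd_measurable.
have mw : measurable_fun setT (fun x => wgt (Num.sqrt u) x ^+ 5 * `|gd u m x|).
  apply: measurable_funM; first exact: wgt_measurable.
  by apply: measurableT_comp => //; exact: gd_measurable.
apply: (@le_lt_trans _ _ (\int[leb]_x (M * (1 + Num.sqrt u) ^+ 5 *
    (wgt (Num.sqrt u) x ^+ 5 * `|gd u m x|))%:E)%E).
  apply: ge0_int_le => //.
  - apply: measurableT_comp => //; apply: measurable_funM => //; exact: gd_measurable.
  - by apply: measurable_funM.
  - move=> x; rewrite normrM mulrC [leRHS]mulrA ler_wpM2r//.
    apply: le_trans (hM x) _; rewrite -mulrA ler_wpM2l// -exprMn.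
    rewrite lerXn2r ?nnegrE ?mulr_ge0 ?addr_ge0 ?wgt_ge0 ?sqrtr_ge0//.
    exact: wgt1_le.
rewrite ge0_intZl//.
- apply: lte_mul_pinfty; rewrite ?lee_fin ?mulr_ge0 ?exprn_ge0 ?addr_ge0 ?sqrtr_ge0//.
  by apply: le_lt_trans (gC u u0) _; rewrite ltry.
- by move=> x; rewrite mulr_ge0 ?exprn_ge0 ?wgt_ge0.
- by rewrite ?mulr_ge0 ?exprn_ge0 ?addr_ge0 ?sqrtr_ge0.
Qed.

Lemma gd_kernel1 u m : 0 < u -> kernel1 leb (gd u m).
Proof.
move=> u0; split; first exact: gd_measurable.
apply: (@gd_integrable u m _ 1) => //.
  by apply: measurable_funD => //; exact: measurableT_comp.
move=> x; rewrite mul1r ger0_norm ?addr_ge0//.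
by rewrite -[leLHS]expr1 ler_weXn2l// lerDl.
Qed.

(** With this sign [(x - t)_+ = neg_relu (t - x)], so the mean of the ramp is a convolution
    evaluated at [t]. *)
Definition neg_relu t : R := relu (- t).

Lemma lip_neg_relu : lip neg_relu.
Proof.
exists 1 => x y; rewrite mul1r /neg_relu /relu.
have h1 := ler_norm (x - y); have h2 := ler_norm (- (x - y)); rewrite normrN in h2.
have h0 := normr_ge0 (x - y).
by rewrite ler_norml !maxEle; case: ifP => a1; case: ifP => a2; lra.
Qed.

Lemma lip_id : lip (fun x : R => x).
Proof. by exists 1 => x y; rewrite mul1r. Qed.

Lemma cv_gd_neg_relu u m t : 0 < u -> cv leb (gd u m.+2) neg_relu t = gd u m t.
Proof.
move=> u0; have kk := gd_kernel1 m.+2 u0.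
have li : lip (fun x : R => - x) by apply: lipN; exact: lip_id.
have ci := cv_integrable t kk li.
transitivity (\int[leb]_(x in `[t, +oo[) (gd u m.+2 x * - (t - x))).
  rewrite [RHS]Rintegral_mkcond; apply: eq_Rintegral => x _.
  rewrite patchE; case: ifPn => [/set_mem|/negP xt] /=.
    rewrite in_itv/= andbT => tx; rewrite /neg_relu /relu maxEle.
    by case: ifPn => // h; congr (_ * _); lra.
  have {}xt : x < t.
    by rewrite ltNge; apply/negP => tx; apply: xt; rewrite inE/= in_itv/= andbT.
  rewrite /neg_relu /relu maxEle; case: ifPn => h; first by rewrite mulr0.
  by exfalso; move: h; rewrite -ltNge; lra.
(* Integrating by parts twice on [[t, +oo[], where the ramp equals [x - t], leads to this
   antiderivative; at [x = t] its first term vanishes. *)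
pose F x := gd u m.+1 x * - (t - x) + - gd u m x.
have [C1 C10 gC1] := gd_decay m.+1 u0; have [C2 C20 gC2] := gd_decay m u0.
transitivity (- F t); last by rewrite /F subrr oppr0 mulr0 add0r opprK.
apply: (@FTC_halfline _ _ F t ((1 + `|t|) * C1 + C2)).
- move=> x; have d1 := is_derive_gd u m.+1 x; have d2 := is_derive_gd u m x.
  have d3 : is_derive x 1 (fun x : R => - (t - x)) 1.
    by apply: is_derive_eq; ring.
  apply: (is_derive_eq (is_derive_addf (is_derive_mulf d1 d3) (is_deriveN d2))).
  by ring.
- move=> x; apply: cvgM; first exact: gd_continuous.
  by apply: cvgN; apply: cvgB; [exact: cvg_cst|exact: cvg_id].
- exact: ci.
- move=> x; apply: le_trans (ler_wpM2l _ (ler_normB _ _)) _; first by rewrite addr_ge0.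
  rewrite mulrDr lerD//.
    rewrite normrM normrN; have h := ler_normB t x.
    have h3 : `|t - x| <= (1 + `|t|) * (1 + `|x|).
      by have := mulr_ge0 (normr_ge0 t) (normr_ge0 x); lra.
    apply: (@le_trans _ _ ((1 + `|x|) * (`|gd u m.+1 x| * ((1 + `|t|) * (1 + `|x|))))).
      by rewrite ler_wpM2l ?addr_ge0// ler_wpM2l.
    rewrite [leLHS](_ : _ = (1 + `|t|) * ((1 + `|x|) ^+ 2 * `|gd u m.+1 x|)); last by ring.
    rewrite ler_wpM2l ?addr_ge0//; apply: le_trans (gC1 x).
    by rewrite ler_wpM2r// ler_weXn2l// lerDl.
  apply: le_trans (gC2 x); rewrite ler_wpM2r//.
  by rewrite -[leLHS]expr1 ler_weXn2l// lerDl.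
Qed.

Lemma Rintegral_gdS u m : 0 < u -> \int[leb]_x gd u m.+1 x = 0.
Proof.
move=> u0; have [C C0 gC] := gd_decay m u0.
apply: (@FTC_line _ _ (gd u m) C).
- by move=> x; exact: is_derive_gd.
- exact: gd_continuous.
- exact/kernel1_integrable/gd_kernel1.
- move=> x; apply: le_trans (gC x); rewrite ler_wpM2r//.
  by rewrite -[leLHS]expr1 ler_weXn2l// lerDl.
Qed.

(** The antiderivative used for the ramp now runs over the whole line, where both boundary terms
    vanish. This supplies the condition on the identity function when the ramp is traded for its
    reflection in the tail estimates. *)
Lemma cv_gdSS_id u m t : 0 < u -> cv leb (gd u m.+2) (fun x => x) t = 0.
Proof.
move=> u0; have kk := gd_kernel1 m.+2 u0.
have [C1 C10 gC1] := gd_decay m.+1 u0; have [C2 C20 gC2] := gd_decay m u0.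
apply: (@FTC_line _ _ (fun x => gd u m.+1 x * (t - x) + gd u m x) ((1 + `|t|) * C1 + C2)).
- move=> x; have d1 := is_derive_gd u m.+1 x; have d2 := is_derive_gd u m x.
  have d3 : is_derive x 1 (fun x : R => t - x) (- 1).
    by apply: is_derive_eq; ring.
  apply: (is_derive_eq (is_derive_addf (is_derive_mulf d1 d3) d2)).
  by ring.
- move=> x; apply: cvgM; first exact: gd_continuous.
  by apply: cvgB; [exact: cvg_cst|exact: cvg_id].
- exact: (cv_integrable t kk lip_id).
- move=> x; apply: le_trans (ler_wpM2l _ (ler_normD _ _)) _; first by rewrite addr_ge0.
  rewrite mulrDr lerD//.
    rewrite normrM; have h := ler_normB t x.
    have h3 : `|t - x| <= (1 + `|t|) * (1 + `|x|).
      by have := mulr_ge0 (normr_ge0 t) (normr_ge0 x); lra.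
    apply: (@le_trans _ _ ((1 + `|x|) * (`|gd u m.+1 x| * ((1 + `|t|) * (1 + `|x|))))).
      by rewrite ler_wpM2l ?addr_ge0// ler_wpM2l.
    rewrite [leLHS](_ : _ = (1 + `|t|) * ((1 + `|x|) ^+ 2 * `|gd u m.+1 x|)); last by ring.
    rewrite ler_wpM2l ?addr_ge0//; apply: le_trans (gC1 x).
    by rewrite ler_wpM2r// ler_weXn2l// lerDl.
  apply: le_trans (gC2 x); rewrite ler_wpM2r//.
  by rewrite -[leLHS]expr1 ler_weXn2l// lerDl.
Qed.

End gaussian_kernels.

(** * Gaussian laws, their convolutions and their moments *)

Section gaussian_measure.
Context {R : realType}.
Local Notation mR := (measurableTypeR R).
Local Notation leb := (@lebesgue_measure R).
Local Notation gd := gauss_der.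
Implicit Types (u v x y t a b : R) (m : nat) (f k : R -> R).

Definition gprob v : probability mR R := normal_prob 0 (Num.sqrt v).

(** The Radon-Nikodym derivative and [normal_pdf] have the same integral over every measurable set,
    so they agree almost everywhere. *)
Lemma ge0_integral_gprob v f : 0 < v -> measurable_fun setT f ->
  (forall x, 0 <= f x) ->
  (\int[gprob v]_x (f x)%:E = \int[leb]_x (gd v 0 x * f x)%:E)%E.
Proof.
move=> v0 mf f0.
have dom : gprob v `<< leb := normal_prob_dominates 0 (Num.sqrt v).
have mfE : measurable_fun setT (fun x => (f x)%:E) by exact/measurable_EFinP.
rewrite -(Radon_Nikodym_SigmaFinite.change_of_variables dom)//.
have iRN := Radon_Nikodym_SigmaFinite.f_integrable dom.
transitivity (\int[leb]_x ((f x)%:E * (normal_pdf 0 (Num.sqrt v) x)%:E))%E.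
  apply: ae_eq_integral => //.
  - by apply: emeasurable_funM => //; exact: measurable_int iRN.
  - apply: emeasurable_funM => //; apply/measurable_EFinP.
    exact: measurable_normal_pdf.
  - apply: ae_eqe_mul2l; apply: integral_ae_eq => //.
      apply/measurable_EFinP; exact: measurable_normal_pdf.
    by move=> E _ mE; rewrite -(Radon_Nikodym_SigmaFinite.f_integral dom).
by apply: eq_integral => x _; rewrite -EFinM mulrC gd0E.
Qed.

Lemma integral_gprob v f : 0 < v -> measurable_fun setT f ->
  (\int[gprob v]_x (f x)%:E = \int[leb]_x (gd v 0 x * f x)%:E)%E.
Proof.
move=> v0 mf; rewrite integralE [RHS]integralE; congr (_ - _)%E.
- transitivity (\int[gprob v]_x (Num.max (f x) 0)%:E)%E.
    by apply: eq_integral => x _; rewrite funeposE EFin_max.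
  rewrite ge0_integral_gprob//; last by move=> x; rewrite le_max lexx orbT.
    apply: eq_integral => x _; rewrite funeposE -EFin_max; congr EFin.
    by rewrite maxr_pMr ?mulr0// ltW// gd0_gt0.
  exact: measurable_maxr.
- transitivity (\int[gprob v]_x (Num.max (- f x) 0)%:E)%E.
    by apply: eq_integral => x _; rewrite funenegE EFin_max.
  rewrite ge0_integral_gprob//; last by move=> x; rewrite le_max lexx orbT.
    apply: eq_integral => x _; rewrite funenegE -EFinN -EFin_max; congr EFin.
    by rewrite -mulrN maxr_pMr ?mulr0// ltW// gd0_gt0.
  by apply: measurable_maxr => //; exact: measurableT_comp.
Qed.

Lemma gprob_integrable v f : 0 < v -> measurable_fun setT f ->
  leb.-integrable setT (fun x => (gd v 0 x * f x)%:E) ->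
  (gprob v).-integrable setT (fun x => (f x)%:E).
Proof.
move=> v0 mf /integrable_int_lty fi; apply: int_lty_integrable => //.
rewrite ge0_integral_gprob//; last exact: measurableT_comp.
apply: le_lt_trans fi; rewrite le_eqVlt; apply/orP; left; apply/eqP.
by apply: eq_integral => x _; rewrite normrM (gtr0_norm (gd0_gt0 x v0)).
Qed.

Lemma gprob_kernel1 v : 0 < v -> kernel1 (gprob v) (cst 1).
Proof.
move=> v0; split => //.
apply: (eq_integrable measurableT) (gprob_integrable v0 _ (gd_kernel1 0 v0).2).
  by move=> x _; rewrite mul1r.
by apply: measurable_funD => //; exact: measurableT_comp.
Qed.

Lemma cv_gprob v f t : 0 < v -> lip f ->
  cv (gprob v) (cst 1) f t = cv leb (gd v 0) f t.
Proof.
move=> v0 lf; rewrite /cv /Rintegral; congr fine.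
under eq_integral do rewrite mul1r.
rewrite integral_gprob//; apply: lip_measurable; exact: lip_comp_sub.
Qed.

(** Completing the square. In terms of independent Gaussians, the joint density of a summand and the
    sum is written as the density of the sum at [t] times the conditional density of the summand, of
    mean [v t / (u + v)] and variance [u v / (u + v)]. *)
Lemma gd0_mul u v x t : 0 < u -> 0 < v ->
  gd v 0 x * gd u 0 (t - x) =
  gd (u + v) 0 t * gd (u * v / (u + v)) 0 (x - v * t / (u + v)).
Proof.
move=> u0 v0; have uv0 : 0 < u + v by rewrite addr_gt0.
have w0 : 0 < u * v / (u + v) by rewrite divr_gt0// mulr_gt0.
have sq (w : R) : 0 < w -> 0 < Num.sqrt w by rewrite sqrtr_gt0.
rewrite !gd0_scale /std_gauss.
have e (w y : R) : 0 < w -> - (y / Num.sqrt w) ^+ 2 / 2 = - y ^+ 2 / (2 * w).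
  move=> w0'; rewrite exprMn exprVn sqr_sqrtr ?ltW//; field.
  by rewrite gt_eqF.
rewrite !e//; set c := (Num.sqrt (2 * pi))^-1.
rewrite [LHS](_ : _ = c ^+ 2 * ((Num.sqrt v)^-1 * (Num.sqrt u)^-1) *
   (expR (- x ^+ 2 / (2 * v)) * expR (- (t - x) ^+ 2 / (2 * u)))); last by ring.
rewrite [RHS](_ : _ = c ^+ 2 * ((Num.sqrt (u + v))^-1 * (Num.sqrt (u * v / (u + v)))^-1) *
   (expR (- t ^+ 2 / (2 * (u + v))) *
    expR (- (x - v * t / (u + v)) ^+ 2 / (2 * (u * v / (u + v)))))); last by ring.
rewrite -!expRD; congr (_ * _ * expR _).
  rewrite -!invfM -!sqrtrM ?ltW//; congr (Num.sqrt _)^-1.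
  by field; rewrite gt_eqF.
by field; rewrite !gt_eqF.
Qed.

Lemma cv_gd0_gd0 u v t : 0 < u -> 0 < v -> cv leb (gd v 0) (gd u 0) t = gd (u + v) 0 t.
Proof.
move=> u0 v0; have uv0 : 0 < u + v by rewrite addr_gt0.
have w0 : 0 < u * v / (u + v) by rewrite divr_gt0// mulr_gt0.
rewrite /cv /Rintegral; under eq_integral do rewrite gd0_mul//.
rewrite ge0_intZl ?(ltW (gd0_gt0 _ _))//.
- by rewrite integral_gd0_shift// mule1.
- by apply: measurableT_comp; [exact: gd_measurable|exact: measurable_funB].
- by move=> x; exact/ltW/gd0_gt0.
Qed.

(** Induction on [m]: both sides of the identity for [m] are differentiated in [t]. *)
Lemma cv_gd0_gd u v m t : 0 < u -> 0 < v -> cv leb (gd v 0) (gd u m) t = gd (u + v) m t.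
Proof.
move=> u0 v0; elim: m t => [|m IH] t; first exact: cv_gd0_gd0.
have d1 := cv_derive t (gd_kernel1 0 v0) (is_derive_gd u m) (gd_lip m u0) (gd_lip m.+1 u0).
have d2 := is_derive_gd (u + v) m t.
have e : cv leb (gd v 0) (gd u m) = gd (u + v) m by exact/funext.
rewrite e in d1; have [_ <-] := d1; by have [_ <-] := d2.
Qed.

Lemma cv_gd1 v f f1 t M : 0 < v -> (forall x : R, is_derive x 1 f (f1 x)) ->
  lip f -> lip f1 -> (forall x, `|f x| <= M) ->
  cv leb (gd v 1) f t = cv leb (gd v 0) f1 t.
Proof.
move=> v0 df lf lf1 fM.
have i1 := cv_integrable t (gd_kernel1 1 v0) lf.
have i0 := cv_integrable t (gd_kernel1 0 v0) lf1.
apply/eqP; rewrite -subr_eq0; apply/eqP; rewrite /cv -RintegralB//.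
have [C C0 gC] := gd_decay 0 v0.
apply: (@FTC_line _ _ (fun x => gd v 0 x * f (t - x)) (C * M)).
- move=> x; have d3 : is_derive x 1 (fun x : R => t - x) (- 1).
    by apply: is_derive_eq; ring.
  have d4 := @is_derive1_comp _ f (fun x : R => t - x) x _ _ (df (t - x)) d3.
  apply: (is_derive_eq (is_derive_mulf (is_derive_gd v 0 x) d4)).
  by rewrite /=; ring.
- have ct (g : R -> R) : lip g -> continuous (fun x => g (t - x)).
    by move=> lg; apply: lip_continuous; exact: lip_comp_sub.
  move=> x; apply: cvgB; apply: cvgM; try exact: gd_continuous; exact: ct.
- exact: (integrableB measurableT i1 i0).
- move=> x; rewrite normrM mulrA; apply: ler_pM => //.
  apply: le_trans (gC x); rewrite ler_wpM2r//.
  by rewrite -[leLHS]expr1 ler_weXn2l// lerDl.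
Qed.

Lemma cv_gd2_gd1 u v t : 0 < u -> 0 < v -> cv leb (gd u 2) (gd v 1) t = gd (u + v) 3 t.
Proof.
move=> u0 v0; rewrite cv_sym; [|exact: gd_measurable..].
have [M M0 gM] := gd_bounded 2 u0.
rewrite (cv_gd1 t v0 (is_derive_gd u 2) (gd_lip 2 u0) (gd_lip 3 u0) gM).
exact: cv_gd0_gd.
Qed.

Lemma gd1E u x : 0 < u -> gd u 1 x = - (x / u) * gd u 0 x.
Proof.
move=> u0; have s0 : Num.sqrt u != 0 by rewrite gt_eqF// sqrtr_gt0.
have e : u = Num.sqrt u ^+ 2 by rewrite sqr_sqrtr// ltW.
rewrite gd0_scale /gd /= derivC mulr1 add0r hornerN hornerX.
have -> : x / u = x / Num.sqrt u ^+ 2 by rewrite -e.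
by field.
Qed.

(** This is [g' = - (x / u) g] differentiated [m + 1] times. *)
Lemma gd_recr u m x : 0 < u ->
  gd u m.+2 x = - (x / u) * gd u m.+1 x - m.+1%:R / u * gd u m x.
Proof.
move=> u0; elim: m x => [|m IH] x.
  have d1 : is_derive x 1 (gd u 1) (gd u 2 x) := is_derive_gd u 1 x.
  have d0 := is_derive_gd u 0 x.
  have dx : is_derive x 1 (fun y : R => - (y / u)) (- (1 / u)).
    by apply: is_derive_eq; rewrite /GRing.scale/=; ring.
  have := is_derive_mulf dx d0.
  have -> : (fun y => - (y / u) * gd u 0 y) = gd u 1 by apply/funext => y; rewrite gd1E.
  move=> d2; have [_ <-] := d1; have [_ ->] := d2; ring.
have d1 : is_derive x 1 (gd u m.+2) (gd u m.+3 x) := is_derive_gd u m.+2 x.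
have dx : is_derive x 1 (fun y : R => - (y / u)) (- (1 / u)).
  by apply: is_derive_eq; rewrite /GRing.scale/=; ring.
have d2 := is_derive_addf (is_derive_mulf dx (is_derive_gd u m.+1 x))
   (is_derive_mulf (is_derive_cst (- (m.+1%:R / u)) x 1) (is_derive_gd u m x)).
have e : (fun y => - (y / u) * gd u m.+1 y + cst (- (m.+1%:R / u)) y * gd u m y) = gd u m.+2.
  by apply/funext => y; rewrite IH /=; ring.
rewrite e in d2; have [_ <-] := d1; have [_ ->] := d2.
by rewrite -[m.+2%:R]natr1 /=; ring.
Qed.

Lemma gd0_moment_integrable u j : 0 < u -> (j <= 5)%N ->
  leb.-integrable setT (fun x => (gd u 0 x * x ^+ j)%:E).
Proof.
move=> u0 j5; apply: (@gd_integrable _ u 0 _ 1) => //.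
move=> x; rewrite mul1r normrX.
apply: (@le_trans _ _ ((1 + `|x|) ^+ j)).
  by rewrite lerXn2r ?nnegrE ?addr_ge0// lerDr.
by rewrite ler_weXn2l// lerDl.
Qed.

(** Every derivative of the density integrates to zero, and by the recurrence the derivative of
    order [j] is a combination of the functions [x^i g] with [i <= j]. The moments follow one after
    the other. *)
Lemma gd0_moments u : 0 < u ->
  [/\ \int[leb]_x (gd u 0 x * x) = 0, \int[leb]_x (gd u 0 x * x ^+ 2) = u,
      \int[leb]_x (gd u 0 x * x ^+ 3) = 0 & \int[leb]_x (gd u 0 x * x ^+ 4) = 3 * u ^+ 2].
Proof.
move=> u0; have u00 : u != 0 by rewrite gt_eqF.
have i0 : leb.-integrable setT (fun x => (gd u 0 x)%:E).
  exact/kernel1_integrable/gd_kernel1.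
have I0 : \int[leb]_x gd u 0 x = 1 by rewrite /Rintegral integral_gd0.
have i1 : leb.-integrable setT (fun x => (gd u 0 x * x)%:E).
  by have := @gd0_moment_integrable u 1 u0 isT; apply: eq_integrable => // x _; rewrite expr1.
have i2 := @gd0_moment_integrable u 2 u0 isT.
have i3 := @gd0_moment_integrable u 3 u0 isT.
have i4 := @gd0_moment_integrable u 4 u0 isT.
have g1 x := gd1E x u0.
have g1' x : gd u 1 x = gd u 0 x * x * - u^-1 by rewrite g1; ring.
have g2 x : gd u 2 x = gd u 0 x * x ^+ 2 / u ^+ 2 - gd u 0 x / u.
  by rewrite gd_recr// g1; field.
have g3 x : gd u 3 x = gd u 0 x * x * (3 / u ^+ 2) - gd u 0 x * x ^+ 3 / u ^+ 3.
  by rewrite gd_recr// g2 g1; field.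
have g4 x : gd u 4 x = gd u 0 x * x ^+ 4 / u ^+ 4 - gd u 0 x * x ^+ 2 * (6 / u ^+ 3)
     + gd u 0 x * (3 / u ^+ 2).
  by rewrite gd_recr// g3 g2; field.
have Z m := @Rintegral_gdS R u m u0.
have iZ (f : R -> R) (c : R) : leb.-integrable setT (fun x => (f x)%:E) ->
    leb.-integrable setT (fun x => (f x * c)%:E).
  by move=> fi; have := integrableZr measurableT c fi.
have M1 : \int[leb]_x (gd u 0 x * x) = 0.
  have := Z 0; under eq_Rintegral => x _ do rewrite g1'.
  rewrite RintegralZr// => /eqP; rewrite mulf_eq0 oppr_eq0 invr_eq0 (negbTE u00) orbF.
  by move/eqP.
have M2 : \int[leb]_x (gd u 0 x * x ^+ 2) = u.
  have := Z 1; under eq_Rintegral do rewrite g2.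
  rewrite RintegralB//; [|exact: iZ..]; rewrite !RintegralZr// I0 => h.
  have -> : \int[leb]_x (gd u 0 x * x ^+ 2) = ((\int[leb]_x (gd u 0 x * x ^+ 2)) / u ^+ 2 - 1 / u) * u ^+ 2 + u by field.
  by rewrite h mul0r add0r.
split => //.
- have := Z 2; under eq_Rintegral do rewrite g3.
  rewrite RintegralB//; [|exact: iZ..]; rewrite !RintegralZr// M1 mul0r sub0r => /eqP.
  rewrite oppr_eq0 mulf_eq0 invr_eq0 expf_eq0 (negbTE u00) andbF orbF.
  by move/eqP.
- have := Z 3; under eq_Rintegral do rewrite g4.
  have i42 := integrableB measurableT (iZ _ (u ^+ 4)^-1 i4) (iZ _ (6 / u ^+ 3) i2).
  rewrite RintegralD//; [|exact: iZ].
  rewrite RintegralB//; [|exact: iZ..]; rewrite !RintegralZr// I0 M2 => h.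
  set Y := \int[leb]_x (gd u 0 x * x ^+ 4) in h *.
  have -> : Y = (Y / u ^+ 4 - u * (6 / u ^+ 3) + 1 * (3 / u ^+ 2)) * u ^+ 4 + 3 * u ^+ 2 by field.
  by rewrite h mul0r add0r.
Qed.

Lemma cv_gd0_id u t : 0 < u -> cv leb (gd u 0) (fun x => x) t = t.
Proof.
move=> u0; have [M1 _ _ _] := gd0_moments u0.
have i0 : leb.-integrable setT (fun x => (gd u 0 x)%:E).
  exact/kernel1_integrable/gd_kernel1.
have i1 : leb.-integrable setT (fun x => (gd u 0 x * x)%:E).
  by have := @gd0_moment_integrable u 1 u0 isT; apply: eq_integrable => // x _; rewrite expr1.
rewrite /cv; under eq_Rintegral do rewrite mulrBr.
rewrite RintegralB//; last by have := integrableZr measurableT t i0.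
by rewrite RintegralZr// M1 subr0 /Rintegral integral_gd0// mul1r.
Qed.

(* [rho u t] is E(Y - t)_+ for Y ~ N(0, u). *)
Definition rho u t := cv leb (gd u 0) neg_relu t.

Lemma rho_lip u : 0 < u -> lip (rho u).
Proof. by move=> u0; apply: cv_lip; [exact: gd_kernel1|exact: lip_neg_relu]. Qed.

Lemma cv_gd0_rho u v t : 0 < u -> 0 < v -> cv leb (gd v 0) (rho u) t = rho (u + v) t.
Proof.
move=> u0 v0; rewrite -cv_gprob//; last exact: rho_lip.
rewrite -cv_smooth_kernel; [|exact: gprob_kernel1|exact: gd_kernel1|exact: gd_lip|exact: lip_neg_relu].
apply: eq_cvk => x; rewrite cv_gprob//; last exact: gd_lip.
exact: cv_gd0_gd0.
Qed.

Lemma cv_gdSS_rho u v m t : 0 < u -> 0 < v ->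
  cv leb (gd u m.+2) (rho v) t = gd (u + v) m t.
Proof.
move=> u0 v0; rewrite -cv_comm; [|exact: gd_kernel1|exact: gd_kernel1|exact: lip_neg_relu].
transitivity (cv leb (gd v 0) (gd u m) t); last exact: cv_gd0_gd.
by apply: eq_cv => x; exact: cv_gd_neg_relu.
Qed.

End gaussian_measure.

(** * The third-order Taylor remainder of a translated Gaussian density *)

Section taylor_kernel.
Context {R : realType}.
Local Notation mR := (measurableTypeR R).
Local Notation leb := (@lebesgue_measure R).
Local Notation gd := gauss_der.
Implicit Types (u v x y z t a b : R) (f k : R -> R).

Definition std_law (nu : probability mR R) (m3 b4 : R) :=
  [/\ nu.-integrable setT (fun y => (y ^+ 4)%:E),
      \int[nu]_y y = 0, \int[nu]_y y ^+ 2 = 1, \int[nu]_y y ^+ 3 = m3 &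
      \int[nu]_y y ^+ 4 <= b4].

Lemma prob_integrable_cst (nu : probability mR R) (c : R) :
  nu.-integrable setT (fun=> c%:E).
Proof. exact: finite_measure_integrable_cst. Qed.

Lemma prob_Rintegral_cst (nu : probability mR R) (c : R) : \int[nu]_x c = c.
Proof. by rewrite Rintegral_cst//= probability_setT/= mulr1. Qed.

Lemma norm_exp_le4 y j : (j <= 4)%N -> `|y| ^+ j <= 1 + y ^+ 4.
Proof.
move=> j4; have e4 : y ^+ 4 = `|y| ^+ 4 by rewrite -normrX ger0_norm// exprn_even_ge0.
rewrite e4; have [y1|y1] := leP `|y| 1.
  by rewrite ler_wpDr ?exprn_ge0// exprn_ile1.
by rewrite ler_wpDl// ler_weXn2l// ltW.
Qed.

Lemma moment_integrable (nu : probability mR R) j :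
  nu.-integrable setT (fun y => (y ^+ 4)%:E) -> (j <= 4)%N ->
  nu.-integrable setT (fun y => (y ^+ j)%:E).
Proof.
move=> i4 j4; have i1 := integrableD measurableT (prob_integrable_cst nu 1) i4.
apply: le_integrableR i1 => //.
by move=> x; rewrite normrX norm_exp_le4.
Qed.

Lemma moment_kernel1 (nu : probability mR R) :
  nu.-integrable setT (fun y => (y ^+ 4)%:E) -> kernel1 nu (cst 1).
Proof.
move=> i4; split => //.
have i1 := integrableD measurableT (prob_integrable_cst nu 2) i4.
apply: le_integrableR i1 => //.
  by apply: measurable_funM => //; apply: measurable_funD => //; exact: measurableT_comp.
move=> x; rewrite mul1r ger0_norm ?addr_ge0//.
by have := @norm_exp_le4 x 1 isT; rewrite expr1; lra.
Qed.

Lemma std_law_gprob : std_law (gprob 1) 0 3.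
Proof.
have [M1 M2 M3 M4] := @gd0_moments R 1 ltr01.
have I f : measurable_fun setT f ->
    \int[gprob 1]_y f y = \int[leb]_y (gd 1 0 y * f y).
  by move=> mf; rewrite /Rintegral integral_gprob.
split.
- apply: gprob_integrable => //; exact: gd0_moment_integrable.
- by rewrite I.
- by rewrite I ?M2.
- by rewrite I.
- by rewrite I// M4 expr1n mulr1.
Qed.

(** The mean value theorem replaces the integral form of the remainder: the factorials are given up,
    and the same [M] passes through all four steps of the expansion. *)
Lemma taylor_step f f1 (M r : R) j : f 0 = 0 ->
  (forall z : R, is_derive z 1 f (f1 z)) -> 0 <= M ->
  (forall z, `|z| <= r -> `|f1 z| <= M * `|z| ^+ j) ->
  forall z, `|z| <= r -> `|f z| <= M * `|z| ^+ j.+1.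
Proof.
move=> f0 df M0 f1M z zr.
have cf : continuous f.
  by move=> y; apply: differentiable_continuous; apply/derivable1_diffP; case: (df y).
have key a b : a <= b -> exists2 c, a <= c <= b & f b - f a = f1 c * (b - a).
  move=> ab; have [] := @MVT_segment _ f f1 a b ab => //.
    exact: continuous_subspaceT.
  by move=> c; rewrite in_itv/= => cab ->; exists c.
suff [c cz ->] : exists2 c, `|c| <= `|z| & f z = f1 c * z.
  rewrite normrM exprSr mulrA ler_wpM2r//.
  apply: le_trans (f1M c (le_trans cz zr)) _.
  by rewrite ler_wpM2l// lerXn2r// nnegrE.
have [z0|z0] := leP 0 z.
  have [c /andP[c0 cz]] := key 0 z z0.
  by rewrite f0 !subr0 => ->; exists c => //; rewrite !ger0_norm.
have [c /andP[c0 cz]] := key z 0 (ltW z0).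
rewrite f0 !sub0r mulrN => /oppr_inj ->; exists c => //.
by rewrite (ler0_norm (ltW z0)) ler0_norm// lerN2.
Qed.

(** The Taylor polynomial in [y] has degree 3, so its mean under a [std_law] is determined by the
    prescribed moments, while the remainder is of order [y^4]. *)
Definition gauss_rem u x y :=
  gd u 0 (x - y) - (gd u 0 x - y * gd u 1 x + y ^+ 2 / 2 * gd u 2 x
                    - y ^+ 3 / 6 * gd u 3 x).

Lemma gauss_rem_taylor u x y M : 0 <= M ->
  (forall z, `|z| <= `|y| -> `|gd u 4 (x - z)| <= M) ->
  `|gauss_rem u x y| <= M * `|y| ^+ 4.
Proof.
move=> M0 gM.
have dg j z : is_derive z 1 (fun z => gd u j (x - z)) (- gd u j.+1 (x - z)).
  have d3 : is_derive z 1 (fun z : R => x - z) (- 1) by apply: is_derive_eq; ring.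
  have d4 := @is_derive1_comp _ (gd u j) (fun z : R => x - z) z _ _
     (is_derive_gd u j (x - z)) d3.
  by apply: (is_derive_eq d4); rewrite mulrN1.
have dP (a b c : R) z : is_derive z 1 (fun z => a + b * z + c * z ^+ 2) (b + 2 * c * z).
  by apply: is_derive_eq; rewrite /GRing.scale/=; ring.
(* Up to sign, [f1], [f2] and [f3] are the first three derivatives of the remainder in [z]; the
   fourth is [gd u 4 (x - z)]. The bounds are established from the last one upwards. *)
pose f3 z := gd u 3 (x - z) + - (gd u 3 x).
pose f2 z := - gd u 2 (x - z) + (gd u 2 x + (- gd u 3 x) * z).
pose f1 z := gd u 1 (x - z) + - (gd u 1 x + (- gd u 2 x) * z + (gd u 3 x / 2) * z ^+ 2).
have b3 z : `|z| <= `|y| -> `|f3 z| <= M * `|z| ^+ 1.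
  move=> zy; apply: (@taylor_step f3 (fun z => - gd u 4 (x - z)) M `|y| 0) zy => //.
  - by rewrite /f3 subr0 subrr.
  - move=> w; apply: (is_derive_eq (is_derive_addf (dg 3%N w) (is_derive_cst _ w 1))).
    by rewrite addr0.
  - by move=> w wy; rewrite normrN expr0 mulr1 gM.
have b2 z : `|z| <= `|y| -> `|f2 z| <= M * `|z| ^+ 2.
  move=> zy; apply: (@taylor_step f2 f3 M `|y| 1) zy => //.
  - by rewrite /f2 subr0 mulr0 addr0 addNr.
  - move=> w.
    have d := dP (gd u 2 x) (- gd u 3 x) 0 w.
    have e : (fun z => - gd u 2 (x - z) + (gd u 2 x + - gd u 3 x * z + 0 * z ^+ 2)) = f2.
      by apply/funext => z'; rewrite /f2; ring.
    have := is_derive_addf (is_deriveN (dg 2%N w)) d; rewrite e => h.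
    by apply: (is_derive_eq h); rewrite /f3; ring.
have b1 z : `|z| <= `|y| -> `|f1 z| <= M * `|z| ^+ 3.
  move=> zy; apply: (@taylor_step f1 f2 M `|y| 2) zy => //.
  - by rewrite /f1 subr0 mulr0 expr2 !mulr0 !addr0 subrr.
  - move=> w.
    have d := dP (gd u 1 x) (- gd u 2 x) (gd u 3 x / 2) w.
    have := is_derive_addf (dg 1%N w) (is_deriveN d) => h.
    by apply: (is_derive_eq h); rewrite /f2; field.
apply: (@taylor_step (gauss_rem u x) (fun z => - f1 z) M `|y| 3) => //.
- by rewrite /gauss_rem subr0; ring.
- move=> w.
  have d : is_derive w 1 (fun z => - (gd u 0 x - z * gd u 1 x + z ^+ 2 / 2 * gd u 2 x
         - z ^+ 3 / 6 * gd u 3 x))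
       (gd u 1 x - w * gd u 2 x + w ^+ 2 / 2 * gd u 3 x).
    by apply: is_derive_eq; rewrite /GRing.scale/=; field.
  apply: (is_derive_eq (is_derive_addf (dg 0%N w) d)).
  by rewrite /f1; field.
- by move=> z zy; rewrite normrN b1.
Qed.

(** A shift by at most one standard deviation [sqrt u] is absorbed by a constant and a doubled
    variance: the difference of the exponents is [((x - 2 z)^2 + 2 (u - z^2) + 6 u) / (8 u)]. *)
Lemma gd0_shift u x z : 0 < u -> `|z| <= Num.sqrt u ->
  gd (2 * u) 0 (x - z) <= Num.sqrt 2 * expR 1 * gd (4 * u) 0 x.
Proof.
move=> u0 zu; have s0 : 0 < Num.sqrt u by rewrite sqrtr_gt0.
rewrite !gd0_scale /std_gauss.
have e (w y : R) : 0 < w -> - (y / Num.sqrt w) ^+ 2 / 2 = - y ^+ 2 / (2 * w).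
  move=> w0'; rewrite exprMn exprVn sqr_sqrtr ?ltW//; field.
  by rewrite gt_eqF.
rewrite !e ?mulr_gt0// (_ : 4 * u = 2 * (2 * u)); last by ring.
rewrite [in leRHS](sqrtrM (2 * u))// (invfM (Num.sqrt 2)).
set c := (Num.sqrt (2 * pi))^-1; set d := (Num.sqrt (2 * u))^-1.
have r2 : Num.sqrt 2 != 0 :> R by rewrite gt_eqF// sqrtr_gt0.
rewrite [leRHS](_ : _ = d * c * (expR 1 * expR (- x ^+ 2 / (2 * (2 * (2 * u)))))); last by field.
rewrite mulrA ler_wpM2l ?mulr_ge0 ?invr_ge0//.
rewrite -expRD ler_expR.
have z2 : z ^+ 2 <= u.
  by rewrite -[z ^+ 2]real_normK ?num_real// -[leRHS](sqr_sqrtr (ltW u0)) lerXn2r ?nnegrE// ltW.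
rewrite -subr_ge0 (_ : _ - _ = ((x - 2 * z) ^+ 2 + 2 * (u - z ^+ 2) + 6 * u) / (8 * u)).
  apply: divr_ge0; last by rewrite mulr_ge0// ltW.
  by have := sqr_ge0 (x - 2 * z); lra.
by field; rewrite gt_eqF.
Qed.

(** For [|y| <= sqrt u] Taylor's formula applies, with the fourth derivative controlled near [x] by
    [gd0_shift]. For [|y| > sqrt u] the terms are bounded one by one, every power [(|y| / sqrt u)^j]
    with [j <= 4] being at most the fourth. The right side is a sum of three probability densities
    in [x], ready to be integrated. *)
Lemma gauss_rem_bound : exists2 C, 0 <= C & forall u x y, 0 < u ->
  wgt (Num.sqrt u) x ^+ 4 * `|gauss_rem u x y| <=
  C * (y ^+ 4 / u ^+ 2) * (gd (2 * u) 0 (x - y) + gd (2 * u) 0 x + gd (4 * u) 0 x).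
Proof.
have [C0 C00 gC0] := @gd_bound R 0; have [C1 C10 gC1] := @gd_bound R 1.
have [C2 C20 gC2] := @gd_bound R 2; have [C3 C30 gC3] := @gd_bound R 3.
have [C4 C40 gC4] := @gd_bound R 4.
pose K := C4 * 16 * (Num.sqrt 2 * expR 1).
have K0 : 0 <= K by rewrite !mulr_ge0// expR_ge0.
exists (K + 16 * C0 + (C0 + C1 + C2 + C3)); first by rewrite !addr_ge0// mulr_ge0.
move=> u x y u0; set s := Num.sqrt u.
have s0 : 0 < s by rewrite sqrtr_gt0.
have g2y : 0 < gd (2 * u) 0 (x - y) by rewrite gd0_gt0// mulr_gt0.
have g2 : 0 < gd (2 * u) 0 x by rewrite gd0_gt0// mulr_gt0.
have g4 : 0 < gd (4 * u) 0 x by rewrite gd0_gt0// mulr_gt0.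
have Y0 : 0 <= y ^+ 4 / u ^+ 2 by apply: divr_ge0; [exact: exprn_even_ge0|exact: sqr_ge0].
have y4 : y ^+ 4 / u ^+ 2 = (`|y| / s) ^+ 4.
  rewrite exprMn exprVn -normrX (ger0_norm (exprn_even_ge0 _ _))//.
  by rewrite -[in LHS](sqr_sqrtr (ltW u0)) -exprM.
have wx (z : R) (j : nat) : (j <= 5)%N -> wgt s z ^+ j <= wgt s z ^+ 5.
  by move=> j5; exact: wgtX_le.
have [ys|sy] := leP `|y| s.
  pose M := C4 * 16 * (Num.sqrt 2 * expR 1) * (s^-1 ^+ 4 * gd (4 * u) 0 x) / wgt s x ^+ 4.
  have w0 : 0 < wgt s x ^+ 4 by rewrite exprn_gt0// (lt_le_trans _ (wgt_ge1 x s0)).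
  have M0 : 0 <= M by rewrite divr_ge0 ?(ltW w0)// mulr_ge0// mulr_ge0 ?exprn_ge0 ?invr_ge0 ?ltW.
  have := @gauss_rem_taylor u x y M M0.
  have hz z : `|z| <= `|y| -> `|gd u 4 (x - z)| <= M.
    move=> zy; rewrite ler_pdivlMr//.
    have zs : `|z| <= s := le_trans zy ys.
    have h1 : wgt s x ^+ 4 <= 16 * wgt s (x - z) ^+ 4.
      have -> : 16 = 2 ^+ 4 :> R by ring.
      rewrite -exprMn lerXn2r ?nnegrE ?mulr_ge0 ?wgt_ge0//.
      rewrite -[x in leLHS](subrK z x); apply: le_trans (wgtM _ _ s0) _.
      rewrite mulrC ler_wpM2r ?wgt_ge0//.
      by rewrite /wgt (_ : 2 = 1 + 1)// lerD2l ler_pdivrMr// mul1r.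
    apply: (@le_trans _ _ (16 * (wgt s (x - z) ^+ 5 * `|gd u 4 (x - z)|))).
      rewrite mulrC mulrA ler_wpM2r//; apply: le_trans h1 _.
      by rewrite ler_wpM2l// wx.
    apply: (@le_trans _ _ (16 * (C4 * (s^-1 ^+ 4 * gd (2 * u) 0 (x - z))))).
      by rewrite ler_wpM2l//; exact: gC4.
    rewrite [leLHS](_ : _ = C4 * 16 * s^-1 ^+ 4 * gd (2 * u) 0 (x - z)); last by ring.
    rewrite [leRHS](_ : _ = C4 * 16 * s^-1 ^+ 4 *
      (Num.sqrt 2 * expR 1 * gd (4 * u) 0 x)); last by ring.
    apply: ler_wpM2l; last exact: gd0_shift.
    apply: mulr_ge0; first by rewrite mulr_ge0.
    by rewrite exprn_ge0// invr_ge0 ltW.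
  move=> /(_ hz) h.
  apply: (@le_trans _ _ (wgt s x ^+ 4 * (M * `|y| ^+ 4))).
    by rewrite ler_wpM2l// ltW.
  rewrite y4 [leLHS](_ : _ = K * (`|y| / s) ^+ 4 * gd (4 * u) 0 x); last first.
    have wn : wgt s x != 0 by rewrite gt_eqF// (lt_le_trans _ (wgt_ge1 x s0)).
    by rewrite /M /K exprMn exprVn; field; rewrite wn gt_eqF.
  rewrite -y4; apply: ler_pM.
  - by rewrite mulr_ge0.
  - exact: ltW.
  - rewrite ler_wpM2r// -addrA lerDl !addr_ge0// mulr_ge0//.
  - by rewrite lerDr addr_ge0// ltW.
have y1 : 1 <= `|y| / s by rewrite ler_pdivlMr// mul1r ltW.
have yj j : (j <= 4)%N -> (`|y| / s) ^+ j <= y ^+ 4 / u ^+ 2.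
  by move=> j4; rewrite y4 ler_weXn2l.
(* Only this term is centred at [y]: the weight at [x] is split between [y] and [x - y], and
   [wgt s y <= 2 |y| / s] because [|y| > s]. *)
have t0 : wgt s x ^+ 4 * `|gd u 0 (x - y)| <=
    16 * C0 * (y ^+ 4 / u ^+ 2) * gd (2 * u) 0 (x - y).
  have hy : wgt s y ^+ 4 <= 16 * (y ^+ 4 / u ^+ 2).
    rewrite y4 (_ : 16 = 2 ^+ 4); last by ring.
    rewrite -exprMn lerXn2r ?nnegrE ?mulr_ge0 ?wgt_ge0 ?invr_ge0 ?(ltW s0)//.
    by rewrite /wgt; lra.
  apply: (@le_trans _ _ (wgt s y ^+ 4 * (wgt s (x - y) ^+ 5 * `|gd u 0 (x - y)|))).
    rewrite mulrA ler_wpM2r//.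
    have := @wgtXM R 4 s y (x - y) s0; rewrite addrCA subrr addr0 => h.
    by apply: le_trans h _; rewrite ler_wpM2l ?exprn_ge0 ?wgt_ge0// wx.
  rewrite [leRHS](_ : _ = 16 * (y ^+ 4 / u ^+ 2) * (C0 * gd (2 * u) 0 (x - y))); last by ring.
  apply: ler_pM => //.
  - by rewrite exprn_ge0// wgt_ge0.
  - by rewrite mulr_ge0// exprn_ge0// wgt_ge0.
  - by have := gC0 u (x - y) u0; rewrite expr0 mul1r.
have tj (j : nat) (Cj : R) : (j <= 3)%N -> 0 <= Cj ->
    (1 + `|x| / s) ^+ 5 * `|gd u j x| <= Cj * (s^-1 ^+ j * gd (2 * u) 0 x) ->
    wgt s x ^+ 4 * (`|y| ^+ j * `|gd u j x|) <= Cj * (y ^+ 4 / u ^+ 2) * gd (2 * u) 0 x.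
  move=> j3 Cj0 h.
  apply: (@le_trans _ _ (`|y| ^+ j * (wgt s x ^+ 5 * `|gd u j x|))).
    by rewrite mulrCA ler_wpM2l ?exprn_ge0// ler_wpM2r// wx.
  apply: (@le_trans _ _ (`|y| ^+ j * (Cj * (s^-1 ^+ j * gd (2 * u) 0 x)))).
    by rewrite ler_wpM2l ?exprn_ge0.
  rewrite [leLHS](_ : _ = Cj * (`|y| / s) ^+ j * gd (2 * u) 0 x); last first.
    by rewrite exprMn; ring.
  by rewrite ler_wpM2r ?(ltW g2)// ler_wpM2l// yj// (leq_trans j3).
have T0 := tj 0%N C0 isT C00 (gC0 u x u0); have T1 := tj 1%N C1 isT C10 (gC1 u x u0).
have T2 := tj 2%N C2 isT C20 (gC2 u x u0); have T3 := tj 3%N C3 isT C30 (gC3 u x u0).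
rewrite expr0 mul1r in T0; rewrite expr1 in T1.
have w0 : 0 <= wgt s x ^+ 4 by rewrite exprn_ge0// wgt_ge0.
have tri : `|gauss_rem u x y| <= `|gd u 0 (x - y)| + `|gd u 0 x| + `|y| * `|gd u 1 x| +
    `|y| ^+ 2 * `|gd u 2 x| + `|y| ^+ 3 * `|gd u 3 x|.
  rewrite /gauss_rem.
  have l2 : `|y ^+ 2 / 2 * gd u 2 x| <= `|y| ^+ 2 * `|gd u 2 x|.
    rewrite normrM ler_wpM2r// normrM normrX ler_piMr ?exprn_ge0//.
    by rewrite ger0_norm ?invr_ge0// invf_le1// ler1n.
  have l3 : `|y ^+ 3 / 6 * gd u 3 x| <= `|y| ^+ 3 * `|gd u 3 x|.
    rewrite normrM ler_wpM2r// normrM normrX ler_piMr ?exprn_ge0//.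
    by rewrite ger0_norm ?invr_ge0// invf_le1// ler1n.
  rewrite -(normrM y); set A := gd u 0 (x - y); set B := gd u 0 x.
  move: l2 l3; set D := y * _; set E := _ * gd u 2 x; set F := _ * gd u 3 x => l2 l3.
  have := ler_normB A (B - D + E - F); have := ler_normB (B - D + E) F.
  have := ler_normD (B - D) E; have := ler_normB B D; lra.
apply: (@le_trans _ _ (wgt s x ^+ 4 * (`|gd u 0 (x - y)| + `|gd u 0 x| + `|y| * `|gd u 1 x| +
    `|y| ^+ 2 * `|gd u 2 x| + `|y| ^+ 3 * `|gd u 3 x|))).
  by rewrite ler_wpM2l.
rewrite !mulrDr; set Y := y ^+ 4 / u ^+ 2 in t0 T0 T1 T2 T3 Y0 *.
have P (c g : R) : 0 <= c -> 0 < g -> 0 <= c * Y * g by move=> c0 /ltW g0; apply: mulr_ge0 g0; exact: mulr_ge0.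
have CC : 0 <= C0 + C1 + C2 + C3 by rewrite !addr_ge0.
have p1 := P K _ K0 g2y; have p2 := P K _ K0 g2.
have p3 := P _ _ (addr_ge0 (addr_ge0 K0 (mulr_ge0 (ler0n R 16) C00)) CC) g4.
have p4 := P _ _ (mulr_ge0 (ler0n R 16) C00) g2.
have p5 := P _ _ CC g2y.
lra.
Qed.

End taylor_kernel.

(** * Mass of the one-step kernel after its third-order term is removed *)

Section smoothing_remainder.
Context {R : realType}.
Local Notation mR := (measurableTypeR R).
Local Notation leb := (@lebesgue_measure R).
Local Notation gd := gauss_der.
Implicit Types (u v x y z t a b : R) (f k : R -> R).

Lemma gauss_rem_measurable u :
  measurable_fun setT (fun z : mR * mR => gauss_rem u z.1 z.2).
Proof.
have m1 : measurable_fun setT (fun z : mR * mR => z.1) by exact: measurable_fst.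
have m2 : measurable_fun setT (fun z : mR * mR => z.2) by exact: measurable_snd.
have mg j : measurable_fun setT (fun z : mR * mR => gd u j z.1).
  by apply: (measurableT_comp (gd_measurable u j)).
rewrite /gauss_rem; apply: measurable_funB.
  by apply: (measurableT_comp (gd_measurable u 0)); exact: measurable_funB.
apply: measurable_funB.
  apply: measurable_funD; first by apply: measurable_funB => //; exact: measurable_funM.
  apply: measurable_funM => //; apply: measurable_funM => //; exact: measurable_funX.
by apply: measurable_funM => //; apply: measurable_funM => //; exact: measurable_funX.
Qed.

Lemma cv_gauss_rem (nu : probability mR R) m3 b4 u x : 0 < u -> std_law nu m3 b4 ->
  nu.-integrable setT (fun y => (gauss_rem u x y)%:E) /\
  cv nu (cst 1) (gd u 0) x - gd u 0 x - gd u 2 x / 2 + m3 / 6 * gd u 3 x =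
  \int[nu]_y gauss_rem u x y.
Proof.
move=> u0 [i4 M1 M2 M3 _].
have nu1 := moment_kernel1 i4.
have ig := cv_integrable x nu1 (gd_lip 0 u0).
have ij j (c : R) : (j <= 4)%N -> nu.-integrable setT (fun y => (y ^+ j * c)%:E).
  by move=> j4; have := integrableZr measurableT c (moment_integrable i4 j4).
have i0 : nu.-integrable setT (fun y => (gd u 0 (x - y))%:E).
  by apply: eq_integrable ig => // y _; rewrite mul1r.
have j0 := integrableB measurableT i0 (prob_integrable_cst nu (gd u 0 x)).
have j1 := integrableD measurableT j0 (ij 1%N (gd u 1 x) isT).
have j2 := integrableB measurableT j1 (ij 2%N (gd u 2 x / 2) isT).
have j3 := integrableD measurableT j2 (ij 3%N (gd u 3 x / 6) isT).
have e y : gauss_rem u x y = gd u 0 (x - y) - gd u 0 x + y ^+ 1 * gd u 1 x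
   - y ^+ 2 * (gd u 2 x / 2) + y ^+ 3 * (gd u 3 x / 6).
  by rewrite /gauss_rem expr1; field.
split; first by apply: eq_integrable j3 => // y _; rewrite e.
under [RHS]eq_Rintegral do rewrite e.
rewrite RintegralD//; last exact: ij.
rewrite RintegralB//; last exact: ij.
rewrite RintegralD//; last exact: ij.
rewrite RintegralB//; last exact: prob_integrable_cst.
rewrite prob_Rintegral_cst !RintegralZr//; [|exact: moment_integrable i4 _..].
under [in X in _ = _ - _ + X * _ - _ + _]eq_Rintegral do rewrite expr1.
rewrite M1 M2 M3 mul0r addr0 mul1r; congr (_ - _ - _ + _); last by field.
by apply: eq_Rintegral => y _; rewrite mul1r.
Qed.

(** By Tonelli the integral in [x] is taken first: the three densities contribute 3, and the
    remaining [y^4 / u^2] integrates to at most [b4 / u^2]. *)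
Lemma gauss_rem_int : exists2 C, 0 <= C &
  forall (nu : probability mR R) m3 b4 u, 0 < u -> std_law nu m3 b4 ->
  (\int[leb]_x (wgt (Num.sqrt u) x ^+ 4 *
     `|cv nu (cst 1) (gd u 0) x - gd u 0 x - gd u 2 x / 2 + m3 / 6 * gd u 3 x|)%:E
   <= (C * (b4 / u ^+ 2))%:E)%E.
Proof.
have [C C0 remC] := @gauss_rem_bound R; exists (3 * C); first by rewrite mulr_ge0.
move=> nu m3 b4 u u0 hnu; have [i4 M1 M2 M3 M4] := hnu.
set s := Num.sqrt u; have s0 : 0 < s by rewrite sqrtr_gt0.
have w0 x : 0 <= wgt s x ^+ 4 by rewrite exprn_ge0// wgt_ge0.
pose F (z : mR * mR) := (wgt s z.1 ^+ 4 * `|gauss_rem u z.1 z.2|)%:E.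
have mF : measurable_fun setT F.
  apply/measurable_EFinP; apply: measurable_funM.
    by apply: (measurableT_comp (wgt_measurable 4 s)); exact: measurable_fst.
  by apply: measurableT_comp => //; exact: gauss_rem_measurable.
have F0 p : (0 <= F p)%E by rewrite lee_fin mulr_ge0.
have mfx x : measurable_fun setT (fun y => gauss_rem u x y).
  exact: measurableT_comp (gauss_rem_measurable u) (pair1_measurable x).
apply: (@le_trans _ _ (\int[leb]_x \int[nu]_y F (x, y))%E).
  apply: ge0_le_integral => //.
  - by move=> x _; rewrite lee_fin mulr_ge0.
  - apply/measurable_EFinP; apply: measurable_funM; first exact: wgt_measurable.
    apply: measurableT_comp => //; apply: measurable_funD.
      apply: measurable_funB; last by apply: measurable_funM => //; exact: gd_measurable.
      apply: measurable_funB; last exact: gd_measurable.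
      by apply: lip_measurable; apply: cv_lip (moment_kernel1 i4) _; exact: gd_lip.
    by apply: measurable_funM => //; exact: gd_measurable.
  - by have /= := measurable_fun_fubini_tonelli_F (m2 := nu) F; apply.
  - move=> x _; have [ir ->] := cv_gauss_rem x u0 hnu.
    rewrite EFinM EFin_normr_Rintegral// /F/= ge0_intZl//.
      rewrite lee_wpmul2l ?lee_fin//; apply: le_abse_integral => //.
      by apply/measurable_EFinP; exact: mfx.
    by apply: measurableT_comp => //; exact: mfx.
rewrite (fubini_tonelli F)//.
apply: (@le_trans _ _ (\int[nu]_y (3 * C / u ^+ 2 * y ^+ 4)%:E)%E).
  apply: ge0_le_integral => //.
  - by move=> y _; exact: integral_ge0.
  - by have /= := measurable_fun_fubini_tonelli_G (m1 := leb) F; apply.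
  - apply/measurable_EFinP; apply: measurable_funM => //.
  - move=> y _; rewrite /F/=.
    have p2 : 0 < 2 * u by rewrite mulr_gt0.
    have p4 : 0 < 4 * u by rewrite mulr_gt0.
    have Y0 : 0 <= C * (y ^+ 4 / u ^+ 2).
      by rewrite mulr_ge0// mulr_ge0 ?invr_ge0 ?sqr_ge0// exprn_even_ge0.
    have ms : measurable_fun setT (fun x => gd (2 * u) 0 (x - y)).
      by apply: (measurableT_comp (gd_measurable _ 0)); exact: measurable_funB.
    have g1 x : 0 <= gd (2 * u) 0 (x - y) by exact/ltW/gd0_gt0.
    have g2 x : 0 <= gd (2 * u) 0 x by exact/ltW/gd0_gt0.
    have g3 x : 0 <= gd (4 * u) 0 x by exact/ltW/gd0_gt0.
    have mg (j : nat) (w : R) : measurable_fun setT (gd w j) by exact: gd_measurable.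
    have ms2 : measurable_fun setT (fun x => gd (2 * u) 0 (x - y) + gd (2 * u) 0 x).
      by apply: measurable_funD => //; exact: mg.
    have ms3 : measurable_fun setT (fun x => gd (2 * u) 0 (x - y) + gd (2 * u) 0 x + gd (4 * u) 0 x).
      by apply: measurable_funD => //; exact: mg.
    apply: (@le_trans _ _ (\int[leb]_x (C * (y ^+ 4 / u ^+ 2) *
        (gd (2 * u) 0 (x - y) + gd (2 * u) 0 x + gd (4 * u) 0 x))%:E)%E).
      apply: ge0_int_le.
      - apply: measurable_funM; first exact: wgt_measurable.
        apply: measurableT_comp => //.
        exact: measurableT_comp (gauss_rem_measurable u) (pair2_measurable y).
      - by apply: measurable_funM => //; exact: ms3.
      - by move=> x; rewrite mulr_ge0.
      - by move=> x; exact: remC.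
    rewrite (ge0_intZl leb ms3)//; last by move=> x; rewrite !addr_ge0.
    rewrite (ge0_intD leb ms2 (mg _ _))//; last by move=> x; rewrite addr_ge0.
    rewrite (ge0_intD leb ms (mg _ _))// integral_gd0_shift// !integral_gd0//.
    by rewrite -!EFinD -EFinM lee_fin le_eqVlt; apply/orP; left; apply/eqP; ring.
rewrite ge0_intZl//.
- rewrite -Rintegral_EFin// -EFinM lee_fin [leRHS]mulrA [leRHS]mulrAC ler_wpM2l//.
  by rewrite !mulr_ge0// invr_ge0 sqr_ge0.
- by move=> y; rewrite exprn_even_ge0.
- by rewrite !mulr_ge0// invr_ge0 sqr_ge0.
Qed.

(** The standard Gaussian has the first two moments of [mu] and third moment 0, so the leading term
    of the exchange is [- m3 / 6] times the third derivative; adding it back leaves an error of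
    fourth order. *)
Definition rem_kernel (mu : probability mR R) m3 u x :=
  cv mu (cst 1) (gd u 0) x - gd (u + 1) 0 x + m3 / 6 * gd u 3 x.

Lemma std_law_ge1 (nu : probability mR R) m3 b4 : std_law nu m3 b4 -> 1 <= b4.
Proof.
move=> [i4 _ M2 _ M4].
have i2 := @moment_integrable _ nu 2 i4 isT.
have i1 := integrableD measurableT (prob_integrable_cst nu (1/2)) (integrableZl measurableT (1/2) i4).
have : \int[nu]_y (y ^+ 2) <= \int[nu]_y (1/2 + 1/2 * y ^+ 4).
  apply: le_Rintegral => // y _; have := sqr_ge0 (y ^+ 2 - 1).
  rewrite sqrrB -exprM expr1n; lra.
rewrite M2 RintegralD//; [|exact: prob_integrable_cst|exact: (integrableZl measurableT (1/2) i4)].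
rewrite prob_Rintegral_cst RintegralZl//; lra.
Qed.

(** The Cauchy-Schwarz bound, obtained by integrating [y^2 (L - |y|)^2 >= 0] with [L = sqrt b4]. *)
Lemma third_moment_le (nu : probability mR R) m3 b4 : std_law nu m3 b4 ->
  \int[nu]_y `|y| ^+ 3 <= Num.sqrt b4 /\ `|m3| <= Num.sqrt b4.
Proof.
move=> h; have b1 := std_law_ge1 h; have [i4 M1 M2 M3 M4] := h.
set L := Num.sqrt b4; have L0 : 0 < L by rewrite sqrtr_gt0 (lt_le_trans _ b1).
have LL : L ^+ 2 = b4 by rewrite sqr_sqrtr// (le_trans _ b1).
have i2 := @moment_integrable _ nu 2 i4 isT.
have i3 := @moment_integrable _ nu 3 i4 isT.
have in3 : nu.-integrable setT (fun y => (`|y| ^+ 3)%:E).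
  by have := integrable_norm i3; apply: eq_integrable => // y _; rewrite /= normrX.
have i22 := integrableZl measurableT (L / 2) i2.
have i44 := integrableZl measurableT (1 / (2 * L)) i4.
have i5 := integrableD measurableT i22 i44.
have h3 : \int[nu]_y `|y| ^+ 3 <= L.
  apply: (@le_trans _ _ (\int[nu]_y (L / 2 * y ^+ 2 + 1 / (2 * L) * y ^+ 4))).
    apply: le_Rintegral => // y _.
    rewrite -subr_ge0 (_ : _ - _ = (y ^+ 2) * (L - `|y|) ^+ 2 / (2 * L)).
      by apply: divr_ge0; [apply: mulr_ge0; exact: sqr_ge0|rewrite mulr_ge0// ltW].
    have e2 : y ^+ 2 = `|y| ^+ 2 by rewrite real_normK ?num_real.
    have e4 : y ^+ 4 = `|y| ^+ 4 by rewrite (exprM _ 2 2) e2 -exprM.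
    by rewrite e2 e4; field; rewrite gt_eqF.
  rewrite RintegralD// !RintegralZl// M2 mulr1.
  have : 1 / (2 * L) * \int[nu]_y y ^+ 4 <= 1 / (2 * L) * b4.
    by rewrite ler_wpM2l// divr_ge0// mulr_ge0// ltW.
  have -> : 1 / (2 * L) * b4 = L / 2 by rewrite -LL; field; rewrite gt_eqF.
  lra.
split => //; rewrite -M3; apply: le_trans (le_normr_Rintegral _ _) _ => //.
by under eq_Rintegral do rewrite normrX.
Qed.

(** The kernel is the difference of the Taylor remainders of [mu] and of the standard Gaussian,
    whose fourth moment is 3; since [b4 >= 1], [b4 + 3 <= 4 b4]. *)
Lemma rem_kernel_int : exists2 C, 0 <= C &
  forall (mu : probability mR R) m3 b4 u, 0 < u -> std_law mu m3 b4 ->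
  (\int[leb]_x (wgt (Num.sqrt u) x ^+ 4 * `|rem_kernel mu m3 u x|)%:E
   <= (C * (b4 / u ^+ 2))%:E)%E.
Proof.
have [C C0 hC] := gauss_rem_int; exists (4 * C); first by rewrite mulr_ge0.
move=> mu m3 b4 u u0 hmu; have b1 := std_law_ge1 hmu.
have s0 : 0 < Num.sqrt u by rewrite sqrtr_gt0.
set w := fun x => wgt (Num.sqrt u) x ^+ 4.
have w0 x : 0 <= w x by rewrite exprn_ge0// wgt_ge0.
set E := fun (nu : probability mR R) c x =>
  `|cv nu (cst 1) (gd u 0) x - gd u 0 x - gd u 2 x / 2 + c / 6 * gd u 3 x|.
have mE nu c b : std_law nu c b -> measurable_fun setT (fun x => w x * E nu c x).
  move=> [i4 _ _ _ _].
  apply: measurable_funM; first exact: wgt_measurable.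
  apply: measurableT_comp => //; apply: measurable_funD.
    apply: measurable_funB; last by apply: measurable_funM => //; exact: gd_measurable.
    apply: measurable_funB; last exact: gd_measurable.
    by apply: lip_measurable; apply: cv_lip (moment_kernel1 i4) _; exact: gd_lip.
  by apply: measurable_funM => //; exact: gd_measurable.
have m1 := mE mu m3 b4 hmu; have m2 := mE _ _ _ (@std_law_gprob R).
have E0 nu c x : 0 <= w x * E nu c x by apply: mulr_ge0; [exact: w0|exact: normr_ge0].
apply: (@le_trans _ _ (\int[leb]_x (w x * E mu m3 x + w x * E (gprob 1) 0 x)%:E)%E).
  apply: ge0_int_le.
  - apply: measurable_funM; first exact: wgt_measurable.
    apply: measurableT_comp => //; apply: measurable_funD.
      apply: measurable_funB; last exact: gd_measurable.
      have [i4 _ _ _ _] := hmu.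
      by apply: lip_measurable; apply: cv_lip (moment_kernel1 i4) _; exact: gd_lip.
    by apply: measurable_funM => //; exact: gd_measurable.
  - exact: measurable_funD.
  - by move=> x; rewrite mulr_ge0 ?w0.
  - move=> x; rewrite -mulrDr ler_wpM2l ?w0// /E.
    rewrite [X in cv (gprob 1) X]/= cv_gprob//; last exact: gd_lip.
    rewrite cv_gd0_gd0// /rem_kernel.
    set A := cv mu _ _ _; set B := gd (u + 1) 0 x.
    rewrite (_ : A - B + _ = (A - gd u 0 x - gd u 2 x / 2 + m3 / 6 * gd u 3 x) -
      (B - gd u 0 x - gd u 2 x / 2 + 0 / 6 * gd u 3 x)); last by ring.
    exact: ler_normB.
rewrite ge0_intD//.
apply: (@le_trans _ _ ((C * (b4 / u ^+ 2))%:E + (C * (3 / u ^+ 2))%:E)%E).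
  apply: leeD; first exact: hC.
  exact: (hC _ _ _ _ u0 (@std_law_gprob R)).
rewrite -EFinD lee_fin.
rewrite [leLHS](_ : _ = C / u ^+ 2 * (b4 + 3)); last by ring.
rewrite [leRHS](_ : _ = C / u ^+ 2 * (4 * b4)); last by ring.
rewrite ler_wpM2l ?divr_ge0 ?sqr_ge0//; lra.
Qed.

End smoothing_remainder.

(** * Weighted decay of convolutions with the ramp *)

Section tails.
Context {R : realType}.
Local Notation mR := (measurableTypeR R).
Local Notation leb := (@lebesgue_measure R).
Local Notation gd := gauss_der.
Implicit Types (u v x y z t a b : R) (f k h : R -> R).

Lemma cv_abs_le (m : {measure set mR -> \bar R}) k f h t (w B : R) :
  kernel1 m k -> lip f -> measurable_fun setT h -> 0 <= w ->
  (forall x, w * `|f (t - x)| <= h x) ->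
  (\int[m]_x (h x * `|k x|)%:E <= B%:E)%E -> w * `|cv m k f t| <= B.
Proof.
move=> kk lf mh w0 fh hB.
have h0 x : 0 <= h x by apply: le_trans (fh x); rewrite mulr_ge0.
have mkf : measurable_fun setT (fun x => k x * f (t - x)).
  by apply: cv_measurable lf; case: kk.
rewrite -lee_fin; apply: le_trans hB.
rewrite EFinM EFin_normr_Rintegral//; last exact: cv_integrable.
apply: (@le_trans _ _ (w%:E * \int[m]_x (`|k x * f (t - x)|)%:E)%E).
  rewrite lee_wpmul2l ?lee_fin//; apply: le_abse_integral => //.
  exact/measurable_EFinP.
rewrite -ge0_intZl//; last exact: measurableT_comp.
apply: ge0_int_le.
- by apply: measurable_funM => //; exact: measurableT_comp.
- by apply: measurable_funM => //; apply: measurableT_comp => //; case: kk.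
- by move=> x; rewrite mulr_ge0.
- by move=> x; rewrite normrM mulrCA mulrC ler_wpM2r// fh.
Qed.

(* Subtracting the affine part makes the kernel see [neg_relu] only on
   [|x| >= |t|]: for [t < 0] replace (x - t)_+ by (t - x)_+ + (x - t). *)
Lemma cv_neg_relu_tail (m : {measure set mR -> \bar R}) k h c t (w B : R) :
  kernel1 m k -> cv m k (fun x => x) t = c * t ->
  measurable_fun setT h -> 0 <= w -> (forall x, 0 <= h x) ->
  (forall x, `|t| <= `|x| -> w * `|x| <= h x) ->
  (\int[m]_x (h x * `|k x|)%:E <= B%:E)%E ->
  w * `|cv m k neg_relu t - c * neg_relu t| <= B.
Proof.
move=> kk kid mh w0 h0 wh hB.
have lr := @lip_neg_relu R; have li := @lip_id R.
have [t0|t0] := leP 0 t.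
  have -> : neg_relu t = 0 by rewrite /neg_relu /relu maxEle; case: ifPn; lra.
  rewrite mulr0 subr0; apply: cv_abs_le hB => // x.
  rewrite /neg_relu /relu maxEle; case: ifPn => hx; first by rewrite normr0 mulr0.
  move: hx; rewrite -ltNge => hx; have x0 : 0 < x by lra.
  have tx : `|t| <= `|x| by rewrite (ger0_norm t0) (gtr0_norm x0); lra.
  apply: le_trans (wh x tx); rewrite ler_wpM2l// (gtr0_norm hx) (gtr0_norm x0); lra.
have -> : cv m k neg_relu t - c * neg_relu t = cv m k (fun x => neg_relu x + x) t.
  rewrite cvD// kid; have -> : neg_relu t = - t; last by ring.
  by rewrite /neg_relu /relu maxEle; case: ifPn; lra.
apply: cv_abs_le hB => //; first exact: lipD.
move=> x; rewrite /neg_relu /relu maxEle; case: ifPn => hx.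
  have x0 : x < 0 by lra.
  have tx : `|t| <= `|x| by rewrite (ltr0_norm t0) (ltr0_norm x0); lra.
  have hx' : 0 <= t - x by lra.
  apply: le_trans (wh x tx); rewrite ler_wpM2l// add0r (ltr0_norm x0) (ger0_norm hx'); lra.
by rewrite addNr normr0 mulr0.
Qed.

Lemma expR_gd0 u x : 0 < u ->
  expR (x ^+ 2 / (4 * u)) * gd u 0 x = Num.sqrt 2 * gd (2 * u) 0 x.
Proof.
move=> u0; rewrite !gd0_scale /std_gauss.
have e (w y : R) : 0 < w -> - (y / Num.sqrt w) ^+ 2 / 2 = - y ^+ 2 / (2 * w).
  move=> w0'; rewrite exprMn exprVn sqr_sqrtr ?ltW//; field.
  by rewrite gt_eqF.
rewrite !e ?mulr_gt0// (sqrtrM u)// (invfM (Num.sqrt 2)).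
have r2 : Num.sqrt 2 != 0 :> R by rewrite gt_eqF// sqrtr_gt0.
set c := (Num.sqrt (2 * pi))^-1; set s := (Num.sqrt u)^-1.
rewrite [LHS](_ : _ = s * c * (expR (x ^+ 2 / (4 * u)) * expR (- x ^+ 2 / (2 * u)))); last by ring.
rewrite [RHS](_ : _ = s * c * expR (- x ^+ 2 / (2 * (2 * u)))); last by field.
by rewrite -expRD; congr (_ * expR _); field; rewrite gt_eqF.
Qed.

(** The tail estimate with an exponential weight gives size [sqrt u] and decay [exp(- t^2 / (4 u))].
    As [2 u <= v], this decay is at most [exp(- t^2 / (2 v))], a constant times
    [sqrt v * gd v 0 t]. *)
Lemma rho_sub_bound : exists2 C, 0 <= C & forall u v t, 0 < u -> 2 * u <= v ->
  `|rho u t - neg_relu t| <= C * (Num.sqrt u * Num.sqrt v) * gd v 0 t.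
Proof.
have [C C0 gC] := @gd_intw R 0.
pose c := (Num.sqrt (2 * pi))^-1 : R.
have c0 : 0 < c by rewrite invr_gt0 sqrtr_gt0 mulr_gt0// pi_gt0.
exists (2 * C / c); first by rewrite divr_ge0 ?(ltW c0)// mulr_ge0.
move=> u v t u0 uv; have v0 : 0 < v by lra.
have su : 0 < Num.sqrt u by rewrite sqrtr_gt0.
have sv : 0 < Num.sqrt v by rewrite sqrtr_gt0.
have u2 : 0 < 2 * u by rewrite mulr_gt0.
have su2 : 0 < Num.sqrt (2 * u) by rewrite sqrtr_gt0.
pose w := expR (t ^+ 2 / (4 * u)); have w0 : 0 < w by exact: expR_gt0.
pose h x := `|x| * expR (x ^+ 2 / (4 * u)).
have mh : measurable_fun setT h.
  apply: measurable_funM => //.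
  apply: measurableT_comp => //; apply: measurable_funM => //.
have key : w * `|rho u t - 1 * neg_relu t| <= 2 * C * Num.sqrt u.
  apply: (@cv_neg_relu_tail _ _ h 1 t) => //.
  - exact: gd_kernel1.
  - by rewrite cv_gd0_id// mul1r.
  - exact: ltW.
  - by move=> x; rewrite mulr_ge0// expR_ge0.
  - move=> x tx; rewrite mulrC ler_wpM2l// ler_expR ler_wpM2r ?invr_ge0 ?mulr_ge0 ?(ltW u0)//.
    by rewrite -[t ^+ 2]real_normK ?num_real// -[x ^+ 2]real_normK ?num_real// lerXn2r// nnegrE.
  apply: (@le_trans _ _ (\int[leb]_x ((2 * Num.sqrt u) *
     (wgt (Num.sqrt (2 * u)) x ^+ 5 * `|gd (2 * u) 0 x|))%:E)%E).
    apply: ge0_int_le.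
    - by apply: measurable_funM => //; apply: measurableT_comp => //; exact: gd_measurable.
    - apply: measurable_funM => //; apply: measurable_funM; first exact: wgt_measurable.
      by apply: measurableT_comp => //; exact: gd_measurable.
    - by move=> x; rewrite mulr_ge0// mulr_ge0// expR_ge0.
    - move=> x; rewrite /h (gtr0_norm (gd0_gt0 x u0)) -[leLHS]mulrA expR_gd0//.
      rewrite (gtr0_norm (gd0_gt0 x u2)) mulrA [leRHS]mulrA ler_wpM2r ?(ltW (gd0_gt0 _ _))//.
      apply: (@le_trans _ _ (2 * Num.sqrt u * wgt (Num.sqrt (2 * u)) x)); last first.
        rewrite ler_wpM2l ?mulr_ge0 ?(ltW su)//.
        by rewrite -[leLHS]expr1 ler_weXn2l ?wgt_ge1.
      have -> : `|x| * Num.sqrt 2 = 2 * Num.sqrt u * (`|x| / Num.sqrt (2 * u)).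
        have r2 : Num.sqrt 2 != 0 :> R by rewrite gt_eqF// sqrtr_gt0.
        have e2 : 2 = Num.sqrt 2 * Num.sqrt 2 :> R by rewrite -expr2 sqr_sqrtr.
        rewrite sqrtrM// {2}e2; field; rewrite r2 gt_eqF//.
      by rewrite ler_wpM2l ?mulr_ge0 ?(ltW su)// /wgt lerDr.
  rewrite ge0_intZl.
  - rewrite (_ : 2 * C * Num.sqrt u = (2 * Num.sqrt u) * (C * (Num.sqrt (2 * u))^-1 ^+ 0)); last by rewrite expr0; ring.
    by rewrite [leRHS]EFinM lee_wpmul2l ?gC// lee_fin mulr_ge0// ltW.
  - apply: measurable_funM; first exact: wgt_measurable.
    by apply: measurableT_comp => //; exact: gd_measurable.
  - by move=> x; rewrite mulr_ge0// exprn_ge0// wgt_ge0.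
  - by rewrite mulr_ge0// ltW.
rewrite mul1r in key.
have : w^-1 <= Num.sqrt v / c * gd v 0 t.
  rewrite gd0_scale /std_gauss -/c.
  rewrite [leRHS](_ : _ = expR (- (t / Num.sqrt v) ^+ 2 / 2)); last first.
    by field; rewrite !gt_eqF.
  rewrite -expRN ler_expR exprMn exprVn (sqr_sqrtr (ltW v0)).
  rewrite mulNr lerN2 -mulrA ler_wpM2l ?sqr_ge0// -invfM lef_pV2 ?posrE ?mulr_gt0//.
  lra.
move=> wv; apply: (@le_trans _ _ (2 * C * Num.sqrt u * w^-1)).
  by rewrite ler_pdivlMr// mulrC.
rewrite [leRHS](_ : _ = 2 * C * Num.sqrt u * (Num.sqrt v / c * gd v 0 t)); last by ring.
by rewrite ler_wpM2l// mulr_ge0 ?(ltW su)// mulr_ge0.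
Qed.

(** The fourth moment pays for the cubic weight and for the ramp: [|x| (1 + |x| / a)^3 <= 8 a (1 +
    (x / a)^4)]. *)
Lemma prob_neg_relu_bound (nu : probability mR R) a t : 0 < a ->
  nu.-integrable setT (fun y => (y ^+ 4)%:E) -> \int[nu]_y y = 0 ->
  wgt a t ^+ 3 * `|cv nu (cst 1) neg_relu t - neg_relu t| <=
  8 * a * (1 + (\int[nu]_y y ^+ 4) / a ^+ 4).
Proof.
move=> a0 i4 M1; have k1 := moment_kernel1 i4.
have i1 : nu.-integrable setT (fun y => y%:E).
  by have := moment_integrable i4 (isT : 1 <= 4)%N; apply: eq_integrable.
rewrite -[X in _ - X]mul1r; pose h x := `|x| * wgt a x ^+ 3.
have mh : measurable_fun setT h.
  by apply: measurable_funM => //; exact: wgt_measurable.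
apply: (@cv_neg_relu_tail _ _ h) => //.
- rewrite /cv mul1r; under eq_Rintegral do rewrite mul1r.
  rewrite RintegralB//; last exact: prob_integrable_cst.
  by rewrite prob_Rintegral_cst M1 subr0.
- by rewrite exprn_ge0// wgt_ge0.
- by move=> x; rewrite mulr_ge0// exprn_ge0// wgt_ge0.
- move=> x tx; rewrite mulrC ler_wpM2l// lerXn2r ?nnegrE ?wgt_ge0//.
  by rewrite lerD2l ler_wpM2r// invr_ge0 ltW.
have i4' := integrableZl measurableT (8 / a ^+ 3) i4.
have iB := integrableD measurableT (prob_integrable_cst nu (8 * a)) i4'.
apply: (@le_trans _ _ (\int[nu]_x (8 * a + 8 / a ^+ 3 * x ^+ 4)%:E)%E).
  apply: ge0_int_le.
  - by apply: measurable_funM => //; apply: measurableT_comp.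
  - by apply: measurable_funD => //; exact: measurable_funM.
  - by move=> x; rewrite mulr_ge0// mulr_ge0// exprn_ge0// wgt_ge0.
  - move=> x; rewrite normr1 mulr1 /h /wgt.
    have e4 : x ^+ 4 = `|x| ^+ 4 by rewrite -normrX ger0_norm// exprn_even_ge0.
    rewrite e4; set y := `|x| / a; have y0 : 0 <= y by rewrite divr_ge0// ltW.
    have -> : `|x| = a * y by rewrite /y; field; rewrite gt_eqF.
    rewrite -subr_ge0 (_ : _ - _ = a * (8 + 7 * y ^+ 4 - y - 3 * y ^+ 2 - 3 * y ^+ 3)); last first.
      by field; rewrite gt_eqF.
    rewrite mulr_ge0 ?(ltW a0)//.
    have h1 := @norm_exp_le4 R y 1 isT; have h2 := @norm_exp_le4 R y 2 isT.
    have h3 := @norm_exp_le4 R y 3 isT; rewrite !(ger0_norm y0) in h1 h2 h3.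
    by rewrite expr1 in h1; lra.
rewrite -Rintegral_EFin// lee_fin RintegralD//; last exact: prob_integrable_cst.
rewrite prob_Rintegral_cst RintegralZl//.
by rewrite le_eqVlt; apply/orP; left; apply/eqP; field; rewrite gt_eqF.
Qed.

Lemma gprob_fourth v : 0 < v ->
  [/\ (gprob v).-integrable setT (fun y => (y ^+ 4)%:E), \int[gprob v]_y y = 0 &
      \int[gprob v]_y y ^+ 4 = 3 * v ^+ 2].
Proof.
move=> v0; have [M1 M2 M3 M4] := gd0_moments v0.
have I f : measurable_fun setT f ->
    \int[gprob v]_y f y = \int[leb]_y (gd v 0 y * f y).
  by move=> mf; rewrite /Rintegral integral_gprob.
split; [|by rewrite I|by rewrite I].
by apply: gprob_integrable => //; exact: gd0_moment_integrable.
Qed.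

Lemma rho_bound v t : 0 < v ->
  wgt (Num.sqrt v) t ^+ 3 * `|rho v t - neg_relu t| <= 32 * Num.sqrt v.
Proof.
move=> v0; have s0 : 0 < Num.sqrt v by rewrite sqrtr_gt0.
have [i4 M1 M4] := gprob_fourth v0.
have := prob_neg_relu_bound t s0 i4 M1; rewrite cv_gprob//; last exact: lip_neg_relu.
move=> /le_trans; apply; rewrite M4.
have -> : Num.sqrt v ^+ 4 = v ^+ 2 by rewrite (exprM _ 2 2) sqr_sqrtr// ltW.
have -> : 3 * v ^+ 2 / v ^+ 2 = 3 by field; rewrite gt_eqF.
by rewrite le_eqVlt; apply/orP; left; apply/eqP; ring.
Qed.

Lemma rem_kernel_kernel1 (mu : probability mR R) m3 b4 v : 0 < v ->
  std_law mu m3 b4 -> kernel1 leb (rem_kernel mu m3 v).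
Proof.
move=> v0 hmu; have [i4 _ _ _ _] := hmu; have mu1 := moment_kernel1 i4.
have v1 : 0 < v + 1 by rewrite addr_gt0.
have k1 := smooth_kernel1 mu1 (gd_kernel1 0 v0) (gd_lip 0 v0).
have k2 := gd_kernel1 0 v1; have k3 := gd_kernel1 3 v0.
split.
  apply: measurable_funD; last by apply: measurable_funM => //; exact: gd_measurable.
  by apply: measurable_funB; [exact: k1.1|exact: k2.1].
have := integrableD measurableT (integrableB measurableT k1.2 k2.2)
   (integrableZl measurableT (m3 / 6) k3.2).
by apply: eq_integrable => // x _; rewrite /= /rem_kernel; congr EFin; ring.
Qed.

Lemma cv_rem_kernel (mu : probability mR R) m3 b4 v f t : 0 < v ->
  std_law mu m3 b4 -> lip f ->
  cv leb (rem_kernel mu m3 v) f t =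
  cv mu (cst 1) (cv leb (gd v 0) f) t - cv leb (gd (v + 1) 0) f t
  + m3 / 6 * cv leb (gd v 3) f t.
Proof.
move=> v0 hmu lf; have [i4 _ _ _ _] := hmu; have mu1 := moment_kernel1 i4.
have v1 : 0 < v + 1 by rewrite addr_gt0.
have k1 := smooth_kernel1 mu1 (gd_kernel1 0 v0) (gd_lip 0 v0).
have k2 := gd_kernel1 0 v1; have k3 := gd_kernel1 3 v0.
rewrite /cv /rem_kernel.
have j1 := cv_integrable t k1 lf; have j2 := cv_integrable t k2 lf.
have j3 := cv_integrable t k3 lf.
have j3' := integrableZl measurableT (m3 / 6) j3.
have j12 := integrableB measurableT j1 j2.
transitivity (\int[leb]_x (cv mu (cst 1) (gd v 0) x * f (t - x) - gd (v + 1) 0 x * f (t - x)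
   + m3 / 6 * (gd v 3 x * f (t - x)))).
  by apply: eq_Rintegral => x _; ring.
rewrite RintegralD// RintegralB// RintegralZl//; congr (_ - _ + _).
by have := cv_smooth_kernel t mu1 (gd_kernel1 0 v0) (gd_lip 0 v0) lf.
Qed.

Definition rem_rho (mu : probability mR R) m3 v t :=
  cv mu (cst 1) (rho v) t - rho (v + 1) t + m3 / 6 * gd v 1 t.

(** [rem_rho] is [rem_kernel] applied to the ramp, and this kernel kills the identity function, so
    the tail estimate applies with [c = 0]. For [|x| >= |t|] one has
    [|x| w(t)^3 <= sqrt v * w(x)^4], which is why the kernel was bounded with a fourth power of the
    weight. *)
Lemma rem_rho_bound : exists2 C, 0 <= C &
  forall (mu : probability mR R) m3 b4 v t, 0 < v -> std_law mu m3 b4 ->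
  wgt (Num.sqrt v) t ^+ 3 * `|rem_rho mu m3 v t| <= Num.sqrt v * (C * (b4 / v ^+ 2)).
Proof.
have [C C0 hC] := @rem_kernel_int R; exists C => // mu m3 b4 v t v0 hmu.
have s0 : 0 < Num.sqrt v by rewrite sqrtr_gt0.
have v1 : 0 < v + 1 by rewrite addr_gt0.
have kk := rem_kernel_kernel1 v0 hmu.
have -> : rem_rho mu m3 v t = cv leb (rem_kernel mu m3 v) neg_relu t - 0 * neg_relu t.
  rewrite mul0r subr0 (cv_rem_kernel t v0 hmu (@lip_neg_relu R)).
  by rewrite cv_gd_neg_relu.
pose h x := Num.sqrt v * wgt (Num.sqrt v) x ^+ 4.
have mh : measurable_fun setT h by apply: measurable_funM => //; exact: wgt_measurable.
apply: (@cv_neg_relu_tail _ _ h) => //.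
- rewrite (cv_rem_kernel t v0 hmu (@lip_id R)) cv_gdSS_id// cv_gd0_id// mulr0 addr0.
  have [i4 M1 _ _ _] := hmu.
  rewrite (@eq_cv _ _ _ _ (fun x => x)); last by move=> x; rewrite cv_gd0_id.
  rewrite /cv; under eq_Rintegral do rewrite mul1r.
  rewrite RintegralB//; last 2 first.
  + exact: prob_integrable_cst.
  + by have := moment_integrable i4 (isT : 1 <= 4)%N; apply: eq_integrable.
  by rewrite prob_Rintegral_cst M1 subr0 subrr mul0r.
- by rewrite exprn_ge0// wgt_ge0.
- by move=> x; rewrite mulr_ge0 ?exprn_ge0 ?wgt_ge0// ltW.
- move=> x tx; rewrite /h [wgt _ x ^+ 4]exprS mulrA [leLHS]mulrC.
  have p3 : 0 <= wgt (Num.sqrt v) t ^+ 3 by rewrite exprn_ge0// wgt_ge0.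
  have hx : `|x| <= Num.sqrt v * wgt (Num.sqrt v) x.
    by rewrite /wgt mulrDr mulr1 mulrCA divff ?mulr1 ?gt_eqF// lerDr ltW.
  have ht : wgt (Num.sqrt v) t ^+ 3 <= wgt (Num.sqrt v) x ^+ 3.
    rewrite lerXn2r ?nnegrE ?wgt_ge0//.
    by rewrite lerD2l ler_wpM2r// invr_ge0 ltW.
  exact: ler_pM.
rewrite /h; under eq_integral do rewrite -mulrA.
rewrite ge0_intZl.
- by rewrite [leRHS]EFinM lee_wpmul2l ?lee_fin ?(ltW s0)// hC.
- apply: measurable_funM; first exact: wgt_measurable.
  by apply: measurableT_comp => //; case: kk.
- by move=> x; rewrite mulr_ge0// exprn_ge0// wgt_ge0.
- exact: ltW.
Qed.

End tails.

(** * Exchanging a summand for a Gaussian *)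

Section iterates.
Context {R : realType}.
Local Notation mR := (measurableTypeR R).
Local Notation leb := (@lebesgue_measure R).
Local Notation gd := gauss_der.
Implicit Types (u v x y z t a b : R) (f g k h : R -> R) (mu : probability mR R).

Definition iter_cv mu i f := iter i (cv mu (cst 1)) f.

Lemma iter_cv_lip mu i f : kernel1 mu (cst 1) -> lip f -> lip (iter_cv mu i f).
Proof. by move=> k1 lf; elim: i => // i IH; exact: cv_lip. Qed.

Lemma iter_cvSr mu i f : iter_cv mu i.+1 f = iter_cv mu i (cv mu (cst 1) f).
Proof. by rewrite /iter_cv iterSr. Qed.

Lemma iter_cvB mu i f g t : kernel1 mu (cst 1) -> lip f -> lip g ->
  iter_cv mu i (fun x => f x - g x) t = iter_cv mu i f t - iter_cv mu i g t.
Proof.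
move=> k1 lf lg; elim: i t => // i IH t.
rewrite /= -(cvB t k1 (iter_cv_lip i k1 lf) (iter_cv_lip i k1 lg)).
by apply: eq_cv => x; exact: IH.
Qed.

Lemma iter_cvZ mu i c f t : kernel1 mu (cst 1) -> lip f ->
  iter_cv mu i (fun x => c * f x) t = c * iter_cv mu i f t.
Proof.
move=> k1 lf; elim: i t => // i IH t.
rewrite /= -(cvZ c t k1 (iter_cv_lip i k1 lf)).
by apply: eq_cv => x; exact: IH.
Qed.

Lemma iter_cv_comm mu i k f t : kernel1 mu (cst 1) -> kernel1 leb k -> lip f ->
  iter_cv mu i (cv leb k f) t = cv leb k (iter_cv mu i f) t.
Proof.
move=> k1 kk lf; elim: i t => // i IH t.
rewrite /= -(cv_comm t k1 kk (iter_cv_lip i k1 lf)).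
by apply: eq_cv => x; exact: IH.
Qed.

Lemma iter_cv_le mu i f g t : kernel1 mu (cst 1) -> lip f -> lip g ->
  (forall x, `|f x| <= g x) -> `|iter_cv mu i f t| <= iter_cv mu i g t.
Proof.
move=> k1 lf lg fg; elim: i t => // i IH t.
have lfi := iter_cv_lip i k1 lf; have lgi := iter_cv_lip i k1 lg.
have if_ := cv_integrable t k1 lfi.
apply: le_trans (le_normr_Rintegral _ _) _ => //.
apply: le_Rintegral => //.
- by have := integrable_norm if_.
- by have := cv_integrable t k1 lgi.
- by move=> x _; rewrite [cst 1 x]/= !mul1r; exact: IH.
Qed.

Lemma wgt_submul j a : 0 < a -> forall x y, wgt a (x + y) ^+ j <= wgt a x ^+ j * wgt a y ^+ j.
Proof. by move=> a0 x y; exact: wgtXM. Qed.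

Lemma wgt_geX0 j a x : 0 < a -> 0 <= wgt a x ^+ j.
Proof. by move=> a0; rewrite exprn_ge0// wgt_ge0. Qed.

Lemma gd_sup_scaled j : exists2 C, 0 <= C & forall (a u x : R), 0 < a -> 0 < u ->
  Num.sqrt u <= 2 * a -> wgt a x ^+ 3 * `|gd u j x| <= C * (Num.sqrt u)^-1 ^+ j.+1.
Proof.
have [C C0 hC] := @gd_sup R j; exists (8 * C); first by rewrite mulr_ge0.
move=> a u x a0 u0 ua; have s0 : 0 < Num.sqrt u by rewrite sqrtr_gt0.
apply: (@le_trans _ _ (2 ^+ 3 * (wgt (Num.sqrt u) x ^+ 5 * `|gd u j x|))).
  rewrite mulrA ler_wpM2r//; apply: le_trans (wgt_double 3 x a0 s0 ua) _.
  by rewrite ler_wpM2l ?exprn_ge0// wgtX_le.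
rewrite -mulrA (_ : 2 ^+ 3 = 8); last by ring.
by rewrite ler_wpM2l// hC.
Qed.

Lemma gd_int_scaled j : exists2 C, 0 <= C & forall (a u : R), 0 < a -> 0 < u ->
  Num.sqrt u <= 2 * a ->
  (\int[leb]_x (wgt a x ^+ 3 * `|gd u j x|)%:E <= (C * (Num.sqrt u)^-1 ^+ j)%:E)%E.
Proof.
have [C C0 hC] := @gd_intw R j; exists (8 * C); first by rewrite mulr_ge0.
move=> a u a0 u0 ua; have s0 : 0 < Num.sqrt u by rewrite sqrtr_gt0.
have mg : measurable_fun setT (fun x => `|gd u j x|).
  by apply: measurableT_comp => //; exact: gd_measurable.
apply: (@le_trans _ _ (\int[leb]_x (8 * (wgt (Num.sqrt u) x ^+ 5 * `|gd u j x|))%:E)%E).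
  apply: ge0_int_le.
  - by apply: measurable_funM => //; exact: wgt_measurable.
  - by apply: measurable_funM => //; apply: measurable_funM => //; exact: wgt_measurable.
  - by move=> x; rewrite mulr_ge0// wgt_geX0.
  - move=> x; rewrite mulrA ler_wpM2r//; apply: le_trans (wgt_double 3 x a0 s0 ua) _.
    rewrite (_ : 2 ^+ 3 = 8); last by ring.
    by rewrite ler_wpM2l// wgtX_le.
rewrite ge0_intZl//.
- by rewrite -mulrA [leRHS]EFinM lee_wpmul2l ?lee_fin// hC.
- by apply: measurable_funM => //; exact: wgt_measurable.
- by move=> x; rewrite mulr_ge0// wgt_geX0.
Qed.

(* The one-step kernel: replacing the smoothing N(0, u + 1) by N(0, u) + mu. *)
Definition swap_kernel mu u x := cv mu (cst 1) (gd u 0) x - gd (u + 1) 0 x.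

Section law.
Context (mu : probability mR R) (m3 b4 : R) (hmu : std_law mu m3 b4).

Let i4 : mu.-integrable setT (fun y => (y ^+ 4)%:E). Proof. by case: hmu. Qed.
Let mu1 : kernel1 mu (cst 1). Proof. exact: moment_kernel1 i4. Qed.

Lemma swap_kernel_kernel1 u : 0 < u -> kernel1 leb (swap_kernel mu u).
Proof.
move=> u0; have u1 : 0 < u + 1 by rewrite addr_gt0.
have k1 := smooth_kernel1 mu1 (gd_kernel1 0 u0) (gd_lip 0 u0).
have k2 := gd_kernel1 0 u1; split.
  by apply: measurable_funB; [exact: k1.1|exact: k2.1].
have := integrableB measurableT k1.2 k2.2.
by apply: eq_integrable => // x _; rewrite /= /swap_kernel; congr EFin; ring.
Qed.

Lemma cv_swap_kernel u f t : 0 < u -> lip f ->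
  cv leb (swap_kernel mu u) f t =
  cv mu (cst 1) (cv leb (gd u 0) f) t - cv leb (gd (u + 1) 0) f t.
Proof.
move=> u0 lf; have u1 : 0 < u + 1 by rewrite addr_gt0.
have k1 := smooth_kernel1 mu1 (gd_kernel1 0 u0) (gd_lip 0 u0).
rewrite (cvBk t k1 (gd_kernel1 0 u1) lf); congr (_ - _).
exact: cv_smooth_kernel (gd_kernel1 0 u0) (gd_lip 0 u0) lf.
Qed.

(** At [i = 0] the Gaussian terms would have variance 0, where the formula for the density
    degenerates; hence [0 < i] below and the separate treatment of the index 0 in the sums. *)
Definition edgeworth_err (i : nat) t :=
  iter_cv mu i neg_relu t - rho i%:R t + i%:R * (m3 / 6) * gd i%:R 1 t.

Lemma edgeworth_err_lip i : (0 < i)%N -> lip (edgeworth_err i).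
Proof.
move=> i0; have iR : 0 < i%:R :> R by rewrite ltr0n.
apply: lipD; first by apply: lipB; [exact: iter_cv_lip mu1 lip_neg_relu|exact: rho_lip].
by apply: lipZ; exact: gd_lip.
Qed.

(** The iterates commute with [k], so the expansion of the iterated ramp can be inserted under the
    convolution. Each test kernel then sees the error [edgeworth_err] instead of the law of the
    sum. *)
Lemma iter_cv_expand i k t : (0 < i)%N -> kernel1 leb k ->
  iter_cv mu i (cv leb k neg_relu) t =
  cv leb k (rho i%:R) t - i%:R * (m3 / 6) * cv leb k (gd i%:R 1) t
  + cv leb k (edgeworth_err i) t.
Proof.
move=> i0 kk; have iR : 0 < i%:R :> R by rewrite ltr0n.
rewrite (iter_cv_comm i t mu1 kk (@lip_neg_relu R)).
have lg := gd_lip 1 iR; have lr := rho_lip iR; have le := edgeworth_err_lip i0.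
have lz := lipZ (i%:R * (m3 / 6)) lg.
rewrite -(cvZ _ t kk lg) -(cvB t kk lr lz) -(cvD t kk (lipB lr lz) le).
by apply: eq_cv => x; rewrite /edgeworth_err; ring.
Qed.

(** The total variance is the same for every [i]: the Gaussian of variance [i] from the expansion
    and the smoothing of variance [v - i] combine to variance [v]. The first two terms therefore
    depend on [i] only through the factor [i], and the error term is the one to be summed with
    care. *)
Lemma swap_step i v t : i%:R < v ->
  iter_cv mu i.+1 (rho (v - i%:R)) t - iter_cv mu i (rho (v - i%:R + 1)) t =
  (cv mu (cst 1) (rho v) t - rho (v + 1) t)
  - i%:R * (m3 / 6) * (cv mu (cst 1) (gd v 1) t - gd (v + 1) 1 t)
  + (if i == 0 then 0 else cv leb (swap_kernel mu (v - i%:R)) (edgeworth_err i) t).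
Proof.
move=> iv; have u0 : 0 < v - i%:R by lra.
have u1 : 0 < v - i%:R + 1 by lra.
have [->|i0] := eqVneq i 0%N.
  by rewrite !mul0r !subr0 addr0.
have {}i0 : (0 < i)%N by rewrite lt0n.
have iR : 0 < i%:R :> R by rewrite ltr0n.
have lr : lip (@neg_relu R) by exact: lip_neg_relu.
rewrite iter_cvSr -iter_cvB//; [|exact: cv_lip mu1 (rho_lip u0)|exact: rho_lip].
have -> : (fun x => cv mu (cst 1) (rho (v - i%:R)) x - rho (v - i%:R + 1) x) =
    cv leb (swap_kernel mu (v - i%:R)) neg_relu.
  by apply/funext => x; rewrite cv_swap_kernel.
rewrite iter_cv_expand//; last exact: swap_kernel_kernel1.
congr (_ - _ * _ + _).
- rewrite cv_swap_kernel//; last exact: rho_lip.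
  have e1 : i%:R + (v - i%:R + 1) = v + 1 by ring.
  have e0 : i%:R + (v - i%:R) = v by ring.
  have h1 := cv_gd0_rho t iR u1; rewrite e1 in h1.
  have h0 x := cv_gd0_rho x iR u0; rewrite e0 in h0.
  exact: (congr2 (fun p q => p - q) (eq_cv mu (cst 1) t h0) h1).
- rewrite cv_swap_kernel//; last exact: gd_lip.
  have e1 : i%:R + (v - i%:R + 1) = v + 1 by ring.
  have e0 : i%:R + (v - i%:R) = v by ring.
  have h1 := cv_gd0_gd 1 t iR u1; rewrite e1 in h1.
  have h0 x := cv_gd0_gd 1 x iR u0; rewrite e0 in h0.
  exact: (congr2 (fun p q => p - q) (eq_cv mu (cst 1) t h0) h1).
Qed.

(** From [(1 + y)^3 <= 4 (1 + y^3)], together with a third absolute moment of at most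
    [sqrt b4 <= a <= a^3]. *)
Lemma wgt_law_le (a : R) : 0 < a -> b4 <= a ^+ 2 -> 
  (\int[mu]_x (wgt a x ^+ 3 * `|cst 1 x|)%:E <= 8%:E)%E.
Proof.
move=> a0 ba; have b1 := std_law_ge1 hmu.
have [h3 _] := third_moment_le hmu.
have sb : Num.sqrt b4 <= a by rewrite -(ler_pXn2r (n := 2))// ?nnegrE ?sqrtr_ge0 ?(ltW a0)// sqr_sqrtr//; lra.
have a1 : 1 <= a by rewrite -(ler_pXn2r (n := 2))// ?nnegrE ?(ltW a0)// expr1n; lra.
have i3 : mu.-integrable setT (fun y => (`|y| ^+ 3)%:E).
  have := integrable_norm (moment_integrable i4 (isT : 3 <= 4)%N).
  by apply: eq_integrable => // y _; rewrite /= normrX.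
have i3' := integrableZl measurableT (4 / a ^+ 3) i3.
have iB := integrableD measurableT (prob_integrable_cst mu 4) i3'.
apply: (@le_trans _ _ (\int[mu]_x (4 + 4 / a ^+ 3 * `|x| ^+ 3)%:E)%E).
  apply: ge0_int_le.
  - apply: measurable_funM; first exact: wgt_measurable.
    by apply: measurableT_comp.
  - apply: measurable_funD => //; apply: measurable_funM => //.
    by apply: measurable_funX.
  - by move=> x; rewrite mulr_ge0// wgt_geX0.
  - move=> x; rewrite normr1 mulr1 /wgt.
    have -> : 4 / a ^+ 3 * `|x| ^+ 3 = 4 * (`|x| / a) ^+ 3 by field; rewrite gt_eqF.
    set y := `|x| / a; have y0 : 0 <= y by rewrite divr_ge0// ltW.
    rewrite -subr_ge0 (_ : _ - _ = 3 * ((1 - y) ^+ 2 * (1 + y))); last by ring.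
    by rewrite mulr_ge0// mulr_ge0 ?sqr_ge0// addr_ge0.
rewrite -Rintegral_EFin// lee_fin RintegralD//; last exact: prob_integrable_cst.
rewrite prob_Rintegral_cst RintegralZl//.
have : 4 / a ^+ 3 * \int[mu]_x `|x| ^+ 3 <= 4.
  rewrite mulrAC ler_pdivrMr ?exprn_gt0// ler_wpM2l//.
  apply: le_trans h3 (le_trans sb _).
  by rewrite -[leLHS]expr1 ler_weXn2l.
lra.
Qed.

End law.

(** The third-order term dominates, with mass of order [|m3| u^(-3/2)] and [|m3| <= sqrt b4]. The
    remainder, of order [b4 / u^2], is no larger because [b4 <= u]. *)
Lemma swap_kernel_int : exists2 C, 0 <= C &
  forall mu m3 b4 (a u : R), std_law mu m3 b4 -> 0 < a -> b4 <= u ->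
  Num.sqrt u <= 2 * a ->
  (\int[leb]_x (wgt a x ^+ 3 * `|swap_kernel mu u x|)%:E <=
   (C * (Num.sqrt b4 * (Num.sqrt u)^-1 ^+ 3))%:E)%E.
Proof.
have [C C0 hC] := @rem_kernel_int R; have [D D0 hD] := gd_int_scaled 3.
exists (8 * C + D); first by rewrite addr_ge0// mulr_ge0.
move=> mu m3 b4 a u hmu a0 bu ua.
have b1 := std_law_ge1 hmu; have [_ hm3] := third_moment_le hmu.
have u0 : 0 < u by lra.
have s0 : 0 < Num.sqrt u by rewrite sqrtr_gt0.
have mw : measurable_fun setT (fun x => wgt a x ^+ 3) by exact: wgt_measurable.
have mr : measurable_fun setT (fun x => `|rem_kernel mu m3 u x|).
  by apply: measurableT_comp => //; have [] := rem_kernel_kernel1 u0 hmu.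
have mg : measurable_fun setT (fun x => `|gd u 3 x|).
  by apply: measurableT_comp => //; exact: gd_measurable.
have ms : measurable_fun setT (fun x => `|swap_kernel mu u x|).
  by apply: measurableT_comp => //; have [] := swap_kernel_kernel1 hmu u0.
have mw4 : measurable_fun setT (fun x => wgt (Num.sqrt u) x ^+ 4 * `|rem_kernel mu m3 u x|).
  by apply: measurable_funM => //; exact: wgt_measurable.
have mw3 : measurable_fun setT (fun x => wgt a x ^+ 3 * `|gd u 3 x|).
  exact: measurable_funM.
have p4 x : 0 <= wgt (Num.sqrt u) x ^+ 4 * `|rem_kernel mu m3 u x| by rewrite mulr_ge0// wgt_geX0.
have p3 x : 0 <= wgt a x ^+ 3 * `|gd u 3 x| by rewrite mulr_ge0// wgt_geX0.
have L0 : 0 <= Num.sqrt b4 by [].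
apply: (@le_trans _ _ (\int[leb]_x (8 * (wgt (Num.sqrt u) x ^+ 4 * `|rem_kernel mu m3 u x|) +
   Num.sqrt b4 * (wgt a x ^+ 3 * `|gd u 3 x|))%:E)%E).
  apply: ge0_int_le.
  - exact: measurable_funM.
  - by apply: measurable_funD; apply: measurable_funM.
  - by move=> x; rewrite mulr_ge0// wgt_geX0.
  - move=> x; have -> : swap_kernel mu u x = rem_kernel mu m3 u x - m3 / 6 * gd u 3 x.
      by rewrite /swap_kernel /rem_kernel; ring.
    apply: (@le_trans _ _ (wgt a x ^+ 3 * (`|rem_kernel mu m3 u x| + Num.sqrt b4 * `|gd u 3 x|))).
      rewrite ler_wpM2l ?wgt_geX0//; apply: le_trans (ler_normB _ _) _.
      rewrite lerD2l normrM ler_wpM2r// normrM (ger0_norm (_ : 0 <= 6^-1))//.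
      by have := normr_ge0 m3; lra.
    rewrite mulrDr lerD//; last by rewrite mulrCA.
    rewrite mulrA ler_wpM2r//; apply: le_trans (wgt_double 3 x a0 s0 ua) _.
    rewrite (_ : 2 ^+ 3 = 8); last by ring.
    by rewrite ler_wpM2l// wgtX_le.
have q4 x : 0 <= 8 * (wgt (Num.sqrt u) x ^+ 4 * `|rem_kernel mu m3 u x|) by rewrite mulr_ge0.
have q3 x : 0 <= Num.sqrt b4 * (wgt a x ^+ 3 * `|gd u 3 x|) by rewrite mulr_ge0.
rewrite ge0_intD//; [|exact: measurable_funM..].
rewrite !ge0_intZl//.
apply: (@le_trans _ _ (8%:E * (C * (b4 / u ^+ 2))%:E + (Num.sqrt b4)%:E * (D * (Num.sqrt u)^-1 ^+ 3)%:E)%E).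
  by apply: leeD; apply: lee_wpmul2l; rewrite ?lee_fin//; [exact: hC|exact: hD].
rewrite -!EFinM -EFinD lee_fin [leRHS]mulrDl lerD//; last by rewrite le_eqVlt; apply/orP; left; apply/eqP; ring.
rewrite [leLHS]mulrA; apply: ler_wpM2l; first by rewrite mulr_ge0.
have sbu : Num.sqrt b4 <= Num.sqrt u by exact: ler_wsqrtr.
have -> : b4 / u ^+ 2 = Num.sqrt b4 * (Num.sqrt b4 / Num.sqrt u) * (Num.sqrt u)^-1 ^+ 3.
  rewrite -[in LHS](sqr_sqrtr (ltW u0)) -[in LHS](sqr_sqrtr (_ : 0 <= b4)); last by lra.
  by field; rewrite gt_eqF.
rewrite ler_wpM2r ?exprn_ge0 ?invr_ge0 ?(ltW s0)// ler_piMr//.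
by rewrite ler_pdivrMr// mul1r.
Qed.

(** A change of variance from [n] to [n + u] is the convolution of a Gaussian derivative with
    [rho u - neg_relu]. Both factors are dominated by Gaussian densities, of variances [2 n] and
    [2 u], and their convolution is at most of order [1 / sqrt n]. *)
Lemma psi_conv_bound j : exists2 C, 0 <= C & forall (n u t : R), 0 < u -> u <= n ->
  wgt (Num.sqrt n) t ^+ 3 * `|cv leb (gd n j) (fun x => rho u x - neg_relu x) t| <=
  C * u * (Num.sqrt n)^-1 ^+ j.+1.
Proof.
have [C C0 hC] := @rho_sub_bound R; have [D D0 hD] := @gd_bound R j.
have [E E0 hE] := gd_sup_scaled 0.
exists (C * 2 * D * E); first by rewrite !mulr_ge0.
move=> n u t u0 un; have n0 : 0 < n by lra.
set a := Num.sqrt n; have a0 : 0 < a by rewrite sqrtr_gt0.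
have u2 : 0 < 2 * u by lra. have n2 : 0 < 2 * n by lra.
have s0 : 0 < 2 * u + 2 * n by lra.
have lpsi : lip (fun x => rho u x - neg_relu x).
  by apply: lipB; [exact: rho_lip|exact: lip_neg_relu].
pose c1 := C * 2 * u; pose c2 := D * a^-1 ^+ j.
have c10 : 0 <= c1 by rewrite !mulr_ge0// ltW.
have c20 : 0 <= c2 by rewrite mulr_ge0// exprn_ge0// invr_ge0 ltW.
have main : 1 * `|cv leb (gd n j) (fun x => rho u x - neg_relu x) t| <= c1 * c2 * gd (2 * u + 2 * n) 0 t.
  apply: (@cv_abs_le _ leb (gd n j) _ (fun x => c1 * gd (2 * u) 0 (t - x))) => //.
  - exact: gd_kernel1.
  - by apply: measurable_funM => //; apply: (measurableT_comp (gd_measurable _ 0)); exact: measurable_funB.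
  - move=> x; rewrite mul1r; apply: le_trans (hC u (2 * u) (t - x) u0 (lexx _)) _.
    rewrite ler_wpM2r ?(ltW (gd0_gt0 _ _))// /c1 -mulrA ler_wpM2l//.
    apply: (@le_trans _ _ (Num.sqrt (2 * u) * Num.sqrt (2 * u))).
      by rewrite ler_wpM2r// ler_sqrt//; lra.
    by rewrite -expr2 sqr_sqrtr// ltW.
  have mg (w : R) (m : nat) (uu : R) : measurable_fun setT (fun x => gd uu m (w - x)).
    by apply: (measurableT_comp (gd_measurable _ m)); exact: measurable_funB.
  apply: (@le_trans _ _ (\int[leb]_x (c1 * c2 * (gd (2 * n) 0 x * gd (2 * u) 0 (t - x)))%:E)%E).
    apply: ge0_int_le.
    - apply: measurable_funM; first by apply: measurable_funM => //; exact: mg.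
      by apply: measurableT_comp => //; exact: gd_measurable.
    - apply: measurable_funM => //.
      by apply: measurable_funM; [exact: gd_measurable|exact: mg].
    - move=> x; apply: mulr_ge0 => //; apply: mulr_ge0 => //.
      exact/ltW/gd0_gt0.
    - move=> x; rewrite [leRHS](_ : _ = c1 * gd (2 * u) 0 (t - x) * (c2 * gd (2 * n) 0 x)); last by ring.
      apply: ler_wpM2l; first by rewrite mulr_ge0// ltW// gd0_gt0.
      rewrite /c2 -mulrA; apply: le_trans (hD n x n0).
      by rewrite ler_peMl// exprn_ege1// lerDl divr_ge0// ltW.
  rewrite ge0_intZl; last exact: mulr_ge0.
  - have i := cv_integrable t (gd_kernel1 0 n2) (gd_lip 0 u2).
    have e : \int[leb]_x (gd (2 * n) 0 x * gd (2 * u) 0 (t - x)) = gd (2 * u + 2 * n) 0 t.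
      exact: cv_gd0_gd0.
    by rewrite -Rintegral_EFin// e -EFinM.
  - by apply: measurable_funM; [exact: gd_measurable|exact: mg].
  - by move=> x; apply: mulr_ge0; exact/ltW/gd0_gt0.
rewrite mul1r in main.
apply: (@le_trans _ _ (c1 * c2 * (wgt a t ^+ 3 * `|gd (2 * u + 2 * n) 0 t|))).
  by rewrite mulrCA ler_wpM2l ?wgt_geX0// (gtr0_norm (gd0_gt0 _ s0)).
have sa : Num.sqrt (2 * u + 2 * n) <= 2 * a.
  have -> : 2 * a = Num.sqrt (4 * n).
    rewrite sqrtrM// (_ : 4 = 2 ^+ 2); last by ring.
    by rewrite sqrtr_sqr ger0_norm.
  by rewrite ler_sqrt ?mulr_ge0//; lra.
apply: (@le_trans _ _ (c1 * c2 * (E * (Num.sqrt (2 * u + 2 * n))^-1 ^+ 1))).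
  by apply: ler_wpM2l; [exact: mulr_ge0|exact: hE].
rewrite [leRHS](_ : _ = c1 * c2 * (E * a^-1)); last by rewrite /c1 /c2 exprS; ring.
apply: ler_wpM2l; first exact: mulr_ge0.
rewrite ler_wpM2l// expr1 lef_pV2 ?posrE ?sqrtr_gt0//.
by apply: ler_wsqrtr; lra.
Qed.

End iterates.

(** * The sums met in the exchange, and the telescoping identity *)

Section induction_step.
Context {R : realType}.
Local Notation mR := (measurableTypeR R).
Local Notation leb := (@lebesgue_measure R).
Local Notation gd := gauss_der.
Implicit Types (u v x y z t a b s : R) (mu : probability mR R) (n i j : nat).

Lemma sum_inv_sqrt n : \sum_(i < n) (Num.sqrt i.+1%:R)^-1 <= 2 * Num.sqrt n%:R :> R.
Proof.
elim: n => [|n IH]; first by rewrite big_ord0 mulr_ge0.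
rewrite big_ord_recr/=; apply: le_trans (lerD IH (lexx _)) _.
set a := Num.sqrt n%:R; set b := Num.sqrt n.+1%:R.
have b0 : 0 < b by rewrite sqrtr_gt0 ltr0n.
have e1 : a ^+ 2 = n%:R by rewrite sqr_sqrtr.
have e2 : b ^+ 2 = n%:R + 1 by rewrite sqr_sqrtr// natr1.
have a0 : 0 <= a by exact: sqrtr_ge0.
have ab : 2 * a * b + 1 <= 2 * b ^+ 2.
  have := sqr_ge0 (b - a); rewrite sqrrB; lra.
rewrite -lerBrDl -[leLHS]mul1r ler_pdivrMr//; lra.
Qed.

(** Comparison with the telescoping sum of [2 / sqrt (x - 1) - 2 / sqrt x]. With [a = sqrt (x - 1)]
    and [b = sqrt x] the gap is [(b - a)^2 (2 b + a) / (a b^3)], where [b^2 - a^2 = 1] has been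
    used. *)
Lemma sum_inv_sqrt3 n s : 2 <= s ->
  \sum_(i < n) (Num.sqrt (s + i%:R))^-1 ^+ 3 <= 4 * (Num.sqrt s)^-1.
Proof.
move=> s2.
have step x : 2 <= x -> (Num.sqrt x)^-1 ^+ 3 <= 2 * (Num.sqrt (x - 1))^-1 - 2 * (Num.sqrt x)^-1.
  move=> x2; set a := Num.sqrt (x - 1); set b := Num.sqrt x.
  have a0 : 0 < a by rewrite sqrtr_gt0; lra.
  have b0 : 0 < b by rewrite sqrtr_gt0; lra.
  have e1 : a ^+ 2 = x - 1 by rewrite sqr_sqrtr//; lra.
  have e2 : b ^+ 2 = x by rewrite sqr_sqrtr//; lra.
  have ab : a <= b by rewrite ler_sqrt; lra.
  rewrite -subr_ge0 (_ : _ - _ = (2 * b ^+ 3 - 2 * a * b ^+ 2 - a) / (a * b ^+ 3)); last first.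
    by field; rewrite !gt_eqF.
  apply: divr_ge0; last by rewrite mulr_ge0 ?exprn_ge0// ltW.
  have -> : 2 * b ^+ 3 - 2 * a * b ^+ 2 - a = 2 * b ^+ 2 * (b - a) - a * (b ^+ 2 - a ^+ 2).
    have e3 : b ^+ 2 - a ^+ 2 = 1 by rewrite e1 e2; ring.
    by rewrite e3; ring.
  have -> : 2 * b ^+ 2 * (b - a) - a * (b ^+ 2 - a ^+ 2) = (b - a) * ((b - a) * (2 * b + a)).
    by ring.
  by rewrite mulr_ge0 ?subr_ge0// mulr_ge0 ?subr_ge0// addr_ge0 ?mulr_ge0// ltW.
apply: (@le_trans _ _ (2 * (Num.sqrt (s - 1))^-1 - 2 * (Num.sqrt (s + n%:R - 1))^-1)).
  elim: n => [|n IH]; first by rewrite big_ord0 addr0 subrr.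
  rewrite big_ord_recr/=; apply: le_trans (lerD IH (step (s + n%:R) _)) _.
    by rewrite ler_wpDr.
  have -> : s + n.+1%:R - 1 = s + n%:R by rewrite -natr1; ring.
  by lra.
have p : 0 <= 2 * (Num.sqrt (s + n%:R - 1))^-1 by rewrite mulr_ge0// invr_ge0.
suff : (Num.sqrt (s - 1))^-1 <= 2 * (Num.sqrt s)^-1 by lra.
have a0 : 0 < Num.sqrt (s - 1) by rewrite sqrtr_gt0; lra.
have b0 : 0 < Num.sqrt s by rewrite sqrtr_gt0; lra.
rewrite -[leLHS]mul1r ler_pdivrMr// mulrAC ler_pdivlMr// mul1r.
rewrite -(ler_pXn2r (n := 2))// ?nnegrE ?mulr_ge0//.
rewrite exprMn !sqr_sqrtr; lra.
Qed.

(** Split at [i = n / 2]. Above it [i^(-1/2) <= (3/2) n^(-1/2)] and the other factor sums to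
    [4 / sqrt s]; below it [(v - i)^(-3/2) <= 4 n^(-3/2)] and the sum of [i^(-1/2)] is at most
    [2 sqrt n]. This gives [6 + 8 = 14], as [s <= n]. *)
Lemma sum_mixed n s v : (0 < n)%N -> 2 <= s -> s <= n%:R -> v = n%:R - 1 + s ->
  \sum_(i < n) (if (i : nat) == 0%N then 0 else
     (Num.sqrt (v - i%:R))^-1 ^+ 3 * (Num.sqrt i%:R)^-1) <=
  14 * ((Num.sqrt n%:R)^-1 * (Num.sqrt s)^-1).
Proof.
move=> n0 s2 sn ev.
have nR : 0 < n%:R :> R by rewrite ltr0n.
have n1 : 1 <= n%:R :> R by rewrite ler1n.
set q := (Num.sqrt n%:R)^-1.
have qn : 0 < Num.sqrt n%:R :> R by rewrite sqrtr_gt0.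
have q0 : 0 < q by rewrite invr_gt0.
have half x : n%:R / 2 <= x -> (Num.sqrt x)^-1 <= 3 / 2 * q.
  move=> hx; have x0 : 0 < x by lra.
  have b0 : 0 < Num.sqrt x by rewrite sqrtr_gt0.
  rewrite -[leLHS]mul1r ler_pdivrMr// /q mulrAC ler_pdivlMr// mul1r.
  rewrite -(ler_pXn2r (n := 2))// ?nnegrE ?mulr_ge0//.
  rewrite exprMn !sqr_sqrtr//; lra.
have term (i : 'I_n) : (if (i : nat) == 0%N then 0 else
     (Num.sqrt (v - i%:R))^-1 ^+ 3 * (Num.sqrt i%:R)^-1) <=
   3 / 2 * q * (Num.sqrt (v - i%:R))^-1 ^+ 3 +
   (if (i : nat) == 0%N then 0 else 4 * q ^+ 3 * (Num.sqrt i%:R)^-1).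
  case: ifPn => [_|i0].
    by rewrite addr0 !mulr_ge0 ?exprn_ge0 ?invr_ge0// ltW.
  have p1 : 0 <= (Num.sqrt (v - i%:R))^-1 ^+ 3 by rewrite exprn_ge0// invr_ge0.
  have p2 : 0 <= (Num.sqrt i%:R)^-1 :> R by rewrite invr_ge0.
  have [hi|hi] := leP (n%:R / 2) (i%:R : R).
    apply: ler_wpDr; first by rewrite !mulr_ge0 ?exprn_ge0 ?invr_ge0// ltW.
    by rewrite mulrC ler_wpM2r// half.
  apply: ler_wpDl; first by rewrite !mulr_ge0// ltW.
  rewrite ler_wpM2r//; apply: (@le_trans _ _ ((3 / 2 * q) ^+ 3)).
    rewrite lerXn2r ?nnegrE ?invr_ge0 ?mulr_ge0 ?(ltW q0)// half//.
    by rewrite ev; lra.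
  by rewrite exprMn ler_wpM2r ?exprn_ge0 ?(ltW q0)//; lra.
apply: (@le_trans _ _ (\sum_(i < n) (3 / 2 * q * (Num.sqrt (v - i%:R))^-1 ^+ 3 +
   (if (i : nat) == 0%N then 0 else 4 * q ^+ 3 * (Num.sqrt i%:R)^-1)))).
  by apply: ler_sum => i _; exact: term.
rewrite big_split/= -mulr_sumr.
have h1 : \sum_(i < n) (Num.sqrt (v - i%:R))^-1 ^+ 3 <= 4 * (Num.sqrt s)^-1.
  apply: le_trans (sum_inv_sqrt3 n s2).
  rewrite (reindex_inj rev_ord_inj)/= ler_sum// => i _.
  rewrite (_ : v - (n - i.+1)%:R = s + i%:R)//.
  by rewrite ev natrB// -natr1; ring.
have h2 : \sum_(i < n) (if (i : nat) == 0%N then 0 else 4 * q ^+ 3 * (Num.sqrt i%:R)^-1)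
    <= 4 * q ^+ 3 * (2 * Num.sqrt n%:R).
  case: n n0 {sn ev nR n1 h1 term half} @q qn q0 => // n _ q qn q0.
  rewrite big_ord_recl/= add0r -mulr_sumr ler_wpM2l//.
    by rewrite mulr_ge0// exprn_ge0// ltW.
  apply: le_trans (sum_inv_sqrt n) _.
  by rewrite ler_wpM2l// ler_sqrt// ler_nat.
apply: le_trans (lerD (ler_wpM2l _ h1) h2) _; first by rewrite mulr_ge0// ltW.
have s0 : 0 < Num.sqrt s by rewrite sqrtr_gt0; lra.
have e : q * Num.sqrt n%:R = 1 by rewrite /q mulVf// gt_eqF.
have -> : 4 * q ^+ 3 * (2 * Num.sqrt n%:R) = 8 * q ^+ 2 * (q * Num.sqrt n%:R) by ring.
rewrite e mulr1.
have qs : q <= (Num.sqrt s)^-1 by rewrite lef_pV2 ?posrE// ler_sqrt//; lra.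
have := ler_wpM2l (ltW q0) qs; lra.
Qed.

(* Lindeberg telescoping of [T^n rho_s] into [rho_(n+s)], where the mean of each
   exchanged kernel applied to [rho] is corrected by its third-order term. *)
Lemma edgeworth_err_decomp mu m3 b4 n s t : std_law mu m3 b4 -> (0 < n)%N -> 1 < s ->
  let v := n%:R - 1 + s in
  edgeworth_err mu m3 n t =
    - iter_cv mu n (fun x => rho s x - neg_relu x) t
    + (rho (n%:R + s) t - rho n%:R t)
    + n%:R * rem_rho mu m3 v t
    - n%:R * (m3 / 6) * (gd v 1 t - gd n%:R 1 t)
    - (\sum_(i < n) i%:R) * (m3 / 6) * (cv mu (cst 1) (gd v 1) t - gd (v + 1) 1 t)
    + \sum_(i < n) (if (i : nat) == 0%N then 0 else
        cv leb (swap_kernel mu (v - i%:R)) (edgeworth_err mu m3 i) t).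
Proof.
move=> hmu n0 s1 v; have [i4 _ _ _ _] := hmu; have mu1 := moment_kernel1 i4.
have s0 : 0 < s by lra.
rewrite (iter_cvB n t mu1 (rho_lip s0) (@lip_neg_relu R)).
have alg (N c S X1 X2 r1 r2 p gv gn D E : R) :
    X2 - r1 = N * (p - c * gv) - S * c * D + E ->
    X1 - r2 + N * c * gn =
    - (X2 - X1) + (r1 - r2) + N * p - N * c * (gv - gn) - S * c * D + E.
  move=> h; rewrite [in RHS](_ : X2 = r1 + (X2 - r1)); last by ring.
  by rewrite h; ring.
have iv (i : 'I_n) : i%:R < v.
  have : i.+1%:R <= n%:R :> R by rewrite ler_nat.
  by rewrite -natr1 /v; lra.
(* After [i] exchanges the variance of the Gaussian part is [v + 1 - i], where [v + 1 = n + s]; it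
   runs from [n + s] down to [s]. *)
pose a (i : nat) := iter_cv mu i (rho (v + 1 - i%:R)) t.
have tel : a n - a 0%N = \sum_(i < n) (a i.+1 - a i).
  by rewrite -(big_mkord xpredT (fun i => a i.+1 - a i)) telescope_sumr.
have an : a n = iter_cv mu n (rho s) t.
  by rewrite /a (_ : v + 1 - n%:R = s) // /v; ring.
have e0 : v + 1 - 0%:R = n%:R + s by rewrite /v; ring.
have a0 : a 0%N = rho (n%:R + s) t.
  by rewrite -e0.
have st (i : 'I_n) : a i.+1 - a i =
   (rem_rho mu m3 v t - m3 / 6 * gd v 1 t)
  - i%:R * (m3 / 6) * (cv mu (cst 1) (gd v 1) t - gd (v + 1) 1 t)
  + (if (i : nat) == 0%N then 0 else cv leb (swap_kernel mu (v - i%:R)) (edgeworth_err mu m3 i) t).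
  have e1 : v + 1 - i.+1%:R = v - i%:R by rewrite -natr1; clear; ring.
  have e2 : v + 1 - i%:R = v - i%:R + 1 by clear; ring.
  have h := swap_step hmu t (iv i).
  rewrite /a e1 e2; apply: etrans h _; congr (_ - _ + _); rewrite /rem_rho.
  move: (cv mu (cst 1) (rho v) t) (rho (v + 1) t) (gd v 1 t) => p q r; clear; ring.
have {}tel := etrans tel (eq_bigr _ (fun (i : 'I_n) _ => st i)).
rewrite an a0 in tel.
rewrite big_split sumrB/= sumr_const card_ord -[(rem_rho mu m3 v t - _) *+ n]mulr_natl in tel.
rewrite -!mulr_suml in tel.
by apply: alg; exact: tel.
Qed.

End induction_step.

(** * Weighted bounds on the terms of the telescoping identity *)

Section step_bounds.
Context {R : realType}.
Local Notation mR := (measurableTypeR R).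
Local Notation leb := (@lebesgue_measure R).
Local Notation gd := gauss_der.
Implicit Types (n u v x y z t a b s : R) (mu : probability mR R) (i j : nat).

Lemma rho_shift_bound : exists2 C, 0 <= C & forall n s t, 0 < s -> s <= n ->
  wgt (Num.sqrt n) t ^+ 3 * `|rho (n + s) t - rho n t| <= C * s * (Num.sqrt n)^-1.
Proof.
have [C C0 hC] := @psi_conv_bound R 0; exists C => // n s t s0 sn.
have n0 : 0 < n by lra.
have := hC n s t s0 sn; rewrite expr1.
rewrite (cvB t (gd_kernel1 0 n0) (rho_lip s0) (@lip_neg_relu R)).
by rewrite (cv_gd0_rho t s0 n0) [s + n]addrC.
Qed.

(** The third derivative of the density of variance [n] sends [rho s] to [gd (n + s) 1] and the ramp
    to [gd n 1], so the difference is [psi_conv_bound] with [j = 3]. *)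
Lemma gd_shift_bound : exists2 C, 0 <= C & forall n s t, 0 < s -> s <= n ->
  wgt (Num.sqrt n) t ^+ 3 * `|gd (n + s) 1 t - gd n 1 t| <=
  C * s * (Num.sqrt n)^-1 ^+ 4.
Proof.
have [C C0 hC] := @psi_conv_bound R 3; exists C => // n s t s0 sn.
have n0 : 0 < n by lra.
have := hC n s t s0 sn.
rewrite (cvB t (gd_kernel1 3 n0) (rho_lip s0) (@lip_neg_relu R)).
by rewrite (cv_gdSS_rho 1 t n0 s0) (cv_gd_neg_relu 1 t n0).
Qed.

Lemma sqrt_double n v : 0 < n -> v <= 4 * n -> Num.sqrt v <= 2 * Num.sqrt n.
Proof.
move=> n0 vn; have -> : 2 * Num.sqrt n = Num.sqrt (4 * n).
  rewrite sqrtrM// (_ : 4 = 2 ^+ 2); last by ring.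
  by rewrite sqrtr_sqr ger0_norm.
exact: ler_wsqrtr.
Qed.

Lemma inv_sqrt_le n v : 0 < n -> n <= v -> (Num.sqrt v)^-1 <= (Num.sqrt n)^-1.
Proof.
move=> n0 nv; rewrite lef_pV2 ?posrE ?sqrtr_gt0//; last by lra.
exact: ler_wsqrtr.
Qed.

Lemma inv_sqrt_double n v : 0 < n -> 0 < v -> n <= 4 * v ->
  (Num.sqrt v)^-1 <= 2 * (Num.sqrt n)^-1.
Proof.
move=> n0 v0 nv; have h := sqrt_double v0 nv.
have sn : 0 < Num.sqrt n by rewrite sqrtr_gt0.
have sv : 0 < Num.sqrt v by rewrite sqrtr_gt0.
by rewrite -[leLHS]mul1r ler_pdivrMr// mulrAC ler_pdivlMr// mul1r.
Qed.

Lemma rem_rho_scaled : exists2 C, 0 <= C &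
  forall mu m3 b4 n v t, std_law mu m3 b4 -> 0 < n -> n <= v -> v <= 4 * n ->
  wgt (Num.sqrt n) t ^+ 3 * `|rem_rho mu m3 v t| <= C * b4 * (Num.sqrt n)^-1 ^+ 3.
Proof.
have [C C0 hC] := @rem_rho_bound R; exists (8 * C); first by rewrite mulr_ge0.
move=> mu m3 b4 n v t hmu n0 nv vn; have b1 := std_law_ge1 hmu.
have v0 : 0 < v by lra.
have sn : 0 < Num.sqrt n by rewrite sqrtr_gt0.
have sv : 0 < Num.sqrt v by rewrite sqrtr_gt0.
apply: (@le_trans _ _ (8 * (wgt (Num.sqrt v) t ^+ 3 * `|rem_rho mu m3 v t|))).
  rewrite mulrA ler_wpM2r//.
  have := wgt_double 3 t sn sv (sqrt_double n0 vn).
  by rewrite (_ : 2 ^+ 3 = 8) //; ring.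
apply: (@le_trans _ _ (8 * (Num.sqrt v * (C * (b4 / v ^+ 2))))).
  by rewrite ler_wpM2l//; exact: (hC mu m3 b4 v t v0 hmu).
have -> : 8 * (Num.sqrt v * (C * (b4 / v ^+ 2))) = 8 * C * b4 * (Num.sqrt v)^-1 ^+ 3.
  rewrite -[v in v ^+ 2](sqr_sqrtr (ltW v0)); field.
  by rewrite gt_eqF.
apply: ler_wpM2l; first by rewrite !mulr_ge0//; lra.
rewrite lerXn2r ?nnegrE ?invr_ge0 ?(ltW sn) ?(ltW sv)//.
exact: inv_sqrt_le.
Qed.

Lemma swap_conv_bound : exists2 C, 0 <= C &
  forall mu m3 b4 n u t f E, std_law mu m3 b4 -> 0 < n -> b4 <= u -> u <= 4 * n ->
  lip f -> (forall x, wgt (Num.sqrt n) x ^+ 3 * `|f x| <= E) ->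
  wgt (Num.sqrt n) t ^+ 3 * `|cv leb (swap_kernel mu u) f t| <=
  C * (Num.sqrt b4 * (Num.sqrt u)^-1 ^+ 3) * E.
Proof.
have [C C0 hC] := @swap_kernel_int R; exists C => //.
move=> mu m3 b4 n u t f E hmu n0 bu un lf fE; have b1 := std_law_ge1 hmu.
have u0 : 0 < u by lra.
have sn : 0 < Num.sqrt n by rewrite sqrtr_gt0.
apply: (@cv_weight _ leb (fun x => wgt (Num.sqrt n) x ^+ 3)) => //.
- exact: swap_kernel_kernel1 hmu u u0.
- exact: wgt_measurable.
- by move=> x; exact: wgt_geX0.
- exact: wgt_submul.
- exact: (hC mu m3 b4 (Num.sqrt n) u hmu sn bu (sqrt_double n0 un)).
Qed.

(** The variance is halved: one half smooths the exchanged law, giving mass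
    [sqrt b4 * (v/2)^(-3/2)], and the other half carries the derivative, of size [(v/2)^(-1)]. Since
    [n <= 4 (v/2)], the five factors [1 / sqrt (v/2)] cost [2^5 = 32]. *)
Lemma swap_gd_bound : exists2 C, 0 <= C &
  forall mu m3 b4 n v t, std_law mu m3 b4 -> 0 < n -> 2 * b4 <= n ->
  n <= v -> v <= 4 * n ->
  wgt (Num.sqrt n) t ^+ 3 * `|cv mu (cst 1) (gd v 1) t - gd (v + 1) 1 t| <=
  C * Num.sqrt b4 * (Num.sqrt n)^-1 ^+ 5.
Proof.
have [C C0 hC] := swap_conv_bound; have [D D0 hD] := @gd_sup_scaled R 1.
exists (C * D * 32); first by rewrite !mulr_ge0.
move=> mu m3 b4 n v t hmu n0 bn nv vn; have b1 := std_law_ge1 hmu.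
have v2 : 0 < v / 2 by lra.
have sn : 0 < Num.sqrt n by rewrite sqrtr_gt0.
have v21 : 0 < v / 2 + 1 by lra.
have e1 : v / 2 + (v / 2 + 1) = v + 1 by lra.
have e0 : v / 2 + v / 2 = v by lra.
have -> : cv mu (cst 1) (gd v 1) t - gd (v + 1) 1 t = cv leb (swap_kernel mu (v / 2)) (gd (v / 2) 1) t.
  have h := cv_swap_kernel hmu t v2 (gd_lip 1 v2).
  apply: esym; apply: etrans h _.
  have h1 := cv_gd0_gd 1 t v2 v21; rewrite e1 in h1.
  have h0 x := cv_gd0_gd 1 x v2 v2; rewrite e0 in h0.
  exact: (congr2 (fun p q => p - q) (eq_cv mu (cst 1) t h0) h1).
have v4 : v / 2 <= 4 * n by lra.
have bv : b4 <= v / 2 by lra.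
have sv : 0 < Num.sqrt (v / 2) by rewrite sqrtr_gt0.
have hE x : wgt (Num.sqrt n) x ^+ 3 * `|gd (v / 2) 1 x| <= D * (Num.sqrt (v / 2))^-1 ^+ 2.
  exact: (hD _ _ x sn v2 (sqrt_double n0 v4)).
apply: le_trans (hC mu m3 b4 n (v / 2) t _ _ hmu n0 bv v4 (gd_lip 1 v2) hE) _.
have -> : C * (Num.sqrt b4 * (Num.sqrt (v / 2))^-1 ^+ 3) * (D * (Num.sqrt (v / 2))^-1 ^+ 2) =
   C * D * Num.sqrt b4 * (Num.sqrt (v / 2))^-1 ^+ 5 by ring.
have -> : C * D * 32 * Num.sqrt b4 * (Num.sqrt n)^-1 ^+ 5 =
   C * D * Num.sqrt b4 * (2 * (Num.sqrt n)^-1) ^+ 5 by ring.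
apply: ler_wpM2l; first by rewrite !mulr_ge0.
rewrite lerXn2r ?nnegrE ?mulr_ge0 ?invr_ge0 ?sqrtr_ge0//.
by apply: inv_sqrt_double => //; lra.
Qed.

(** A Gaussian density is its own second derivative convolved with the ramp, and the weighted mass
    of [gd s' 2] is of order [1 / s']: hence [E / s']. The expansion uses [i] summands, because the
    error for [i + 1] is what the induction is about to bound; the last summand costs the factor 8
    of [wgt_law_le]. *)
Lemma concentration_bound : exists2 C, 0 <= C &
  forall mu m3 b4 (i : nat) s' E t, std_law mu m3 b4 -> (0 < i)%N ->
  0 < s' -> s' <= i.+1%:R -> b4 <= i.+1%:R ->
  (forall x, wgt (Num.sqrt i.+1%:R) x ^+ 3 * `|edgeworth_err mu m3 i x| <= E) ->
  wgt (Num.sqrt i.+1%:R) t ^+ 3 * `|iter_cv mu i.+1 (gd s' 0) t| <=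
  C * ((Num.sqrt i.+1%:R)^-1 + E / s').
Proof.
have [C1 C10 h1] := @gd_sup_scaled R 0; have [C3 C30 h3] := @gd_sup_scaled R 3.
have [D D0 hD] := @gd_int_scaled R 2.
exists (8 * (2 * C1 + 3 * C3 + D)); first by rewrite mulr_ge0// !addr_ge0// mulr_ge0.
move=> mu m3 b4 i s' E t hmu i0 s0 sn bn hE.
have b1 := std_law_ge1 hmu; have [_ hm3] := third_moment_le hmu.
have [i4 _ _ _ _] := hmu; have mu1 := moment_kernel1 i4.
set n : R := i.+1%:R; have n0 : 0 < n by rewrite ltr0n.
have iR : 0 < i%:R :> R by rewrite ltr0n.
have ni : n = i%:R + 1 by rewrite /n natr1.
have i1 : 1 <= i%:R :> R by rewrite ler1n.
set q := (Num.sqrt n)^-1.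
have sn0 : 0 < Num.sqrt n by rewrite sqrtr_gt0.
have q0 : 0 < q by rewrite invr_gt0.
have v0 : 0 < s' + i%:R by lra.
have v2 : Num.sqrt (s' + i%:R) <= 2 * Num.sqrt n by apply: sqrt_double => //; lra.
have s2 : Num.sqrt s' <= 2 * Num.sqrt n by apply: sqrt_double => //; lra.
have qv : (Num.sqrt (s' + i%:R))^-1 <= 2 * q.
  by apply: inv_sqrt_double => //; lra.
have lg0 := gd_lip 0 s0.
have E0 : 0 <= E by apply: le_trans (hE 0); rewrite mulr_ge0// wgt_geX0.
have Lq : Num.sqrt b4 * q <= 1.
  rewrite /q ler_pdivrMr// mul1r; exact: ler_wsqrtr.
have main x : wgt (Num.sqrt n) x ^+ 3 * `|iter_cv mu i (gd s' 0) x| <=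
    2 * C1 * q + 16 / 6 * C3 * q + D * (E / s').
  have -> : iter_cv mu i (gd s' 0) x =
      gd (s' + i%:R) 0 x - i%:R * (m3 / 6) * gd (s' + i%:R) 3 x + cv leb (gd s' 2) (edgeworth_err mu m3 i) x.
    have -> : gd s' 0 = cv leb (gd s' 2) neg_relu.
      by apply/funext => y; rewrite cv_gd_neg_relu.
    have := iter_cv_expand hmu x i0 (gd_kernel1 2 s0).
    by rewrite (cv_gdSS_rho 0 x s0 iR) (cv_gd2_gd1 x s0 iR).
  have w0 : 0 <= wgt (Num.sqrt n) x ^+ 3 by exact: wgt_geX0.
  have p1 := h1 _ _ x sn0 v0 v2; have p3 := h3 _ _ x sn0 v0 v2.
  have pE : wgt (Num.sqrt n) x ^+ 3 * `|cv leb (gd s' 2) (edgeworth_err mu m3 i) x| <=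
      D * (Num.sqrt s')^-1 ^+ 2 * E.
    apply: (@cv_weight _ leb (fun x => wgt (Num.sqrt n) x ^+ 3)) => //.
    - exact: gd_kernel1.
    - exact: edgeworth_err_lip hmu i i0.
    - exact: wgt_measurable.
    - by move=> y; exact: wgt_geX0.
    - exact: wgt_submul.
    - exact: hD.
  rewrite [(Num.sqrt s')^-1 ^+ 2]exprVn (sqr_sqrtr (ltW s0)) in pE.
  move: p1 p3 pE; move: (gd _ 0 x) (gd _ 3 x) (cv leb _ _ x) => A B G p1 p3 pE.
  apply: (@le_trans _ _ (wgt (Num.sqrt n) x ^+ 3 * (`|A| + `|i%:R * (m3 / 6) * B| + `|G|))).
    apply: ler_wpM2l => //; apply: le_trans (ler_normD _ _) _; rewrite lerD2r.
    exact: ler_normB.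
  rewrite !mulrDr; apply: lerD; last first.
    by apply: le_trans pE _; rewrite le_eqVlt; apply/orP; left; apply/eqP; ring.
  apply: lerD.
    apply: le_trans p1 _; rewrite expr1 (_ : 2 * C1 * q = C1 * (2 * q)); last by ring.
    exact: ler_wpM2l.
  rewrite normrM mulrCA.
  apply: (@le_trans _ _ (`|i%:R * (m3 / 6)| * (C3 * (2 * q) ^+ 4))).
    apply: ler_wpM2l => //; apply: le_trans p3 _; apply: ler_wpM2l => //.
    by rewrite lerXn2r ?nnegrE ?invr_ge0 ?sqrtr_ge0 ?mulr_ge0 ?(ltW q0).
  have hm : `|i%:R * (m3 / 6)| <= n * (Num.sqrt b4 / 6).
    rewrite normrM ger0_norm// normrM (ger0_norm (_ : 0 <= 6^-1))//.
    by apply: ler_pM => //; [lra|rewrite ler_wpM2r].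
  apply: le_trans (ler_wpM2r _ hm) _.
    by rewrite mulr_ge0// exprn_ge0// mulr_ge0// ltW.
  have nq : n * q ^+ 2 = 1.
    by rewrite /q exprVn sqr_sqrtr ?(ltW n0)// divff// gt_eqF.
  have -> : n * (Num.sqrt b4 / 6) * (C3 * (2 * q) ^+ 4) =
      16 / 6 * C3 * q * ((n * q ^+ 2) * (Num.sqrt b4 * q)) by ring.
  rewrite nq mul1r; apply: ler_piMr => //.
  by rewrite !mulr_ge0// ltW.
have k1 : lip (iter_cv mu i (gd s' 0)) by exact: iter_cv_lip.
have W : (\int[mu]_x (wgt (Num.sqrt n) x ^+ 3 * `|cst 1 x|)%:E <= 8%:E)%E.
  by apply: (wgt_law_le hmu) => //; rewrite sqr_sqrtr// ltW.
have := @cv_weight _ mu (fun x => wgt (Num.sqrt n) x ^+ 3) (cst 1) (iter_cv mu i (gd s' 0)) 8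
  (2 * C1 * q + 16 / 6 * C3 * q + D * (E / s')) t mu1 k1 (wgt_measurable 3 _)
  (fun x => wgt_geX0 3 x sn0) (wgt_submul 3 sn0) W main.
move=> /le_trans; apply.
have e0 : 0 <= E / s' by rewrite divr_ge0// ltW.
have := mulr_ge0 C10 (ltW q0); have := mulr_ge0 C30 (ltW q0); have := mulr_ge0 D0 (ltW q0).
have := mulr_ge0 C10 e0; have := mulr_ge0 C30 e0; have := mulr_ge0 D0 e0.
clear; lra.
Qed.

End step_bounds.

(** * One step of the induction on the number of summands *)

Section edgeworth_induction.
Context {R : realType}.
Local Notation mR := (measurableTypeR R).
Local Notation leb := (@lebesgue_measure R).
Local Notation gd := gauss_der.
Implicit Types (t x A B K : R) (mu : probability mR R) (n i : nat).

(** The six terms of the decomposition are bounded separately. The unknown [K] enters at two places: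
    through [K / B] in the smoothing term, where the law of the sum is tested with a Gaussian
    window, and through [K / sqrt A] in the exchanges made on earlier errors. *)
Lemma induction_step : exists2 C, 0 <= C & forall mu m3 b4 n A B K t,
  std_law mu m3 b4 -> 2 <= A -> 2 * A <= B -> B * b4 <= n%:R -> 0 <= K ->
  (forall i x, (0 < i < n)%N ->
    wgt (Num.sqrt i%:R) x ^+ 3 * `|edgeworth_err mu m3 i x| <=
    K * b4 * (Num.sqrt i%:R)^-1) ->
  wgt (Num.sqrt n%:R) t ^+ 3 * `|edgeworth_err mu m3 n t| <=
  C * (b4 * (Num.sqrt n%:R)^-1 *
    (Num.sqrt A * Num.sqrt B * (1 + K / B) + A + K / Num.sqrt A)).
Proof.
have [Cp Cp0 hp] := @rho_sub_bound R; have [Cc Cc0 hc] := @concentration_bound R.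
have [C2 C20 h2] := @rho_shift_bound R; have [C3 C30 h3] := @rem_rho_scaled R.
have [C4 C40 h4] := @gd_shift_bound R; have [C5 C50 h5] := @swap_gd_bound R.
have [C6 C60 h6] := @swap_conv_bound R.
exists (2 * Cp * Cc + C2 + C3 + C4 + C5 + 14 * C6).
  by rewrite !addr_ge0// !mulr_ge0.
move=> mu m3 b4 n A B K t hmu A2 AB Bn K0 IH.
have b1 := std_law_ge1 hmu; have [_ hm3] := third_moment_le hmu.
have [i4 _ _ _ _] := hmu; have mu1 := moment_kernel1 i4.
have b40 : 0 <= b4 by clear -b1; lra.
have A0 : 0 < A by clear -A2; lra.
have B0 : 0 < B by clear -A2 AB; lra.
have n4 : 4 * b4 <= n%:R.
  by apply: le_trans Bn; rewrite ler_wpM2r//; clear -A2 AB; lra.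
case: n Bn IH n4 => [|k]; first by rewrite mulr0n => ? _; clear -b1; lra.
set n := k.+1 => Bn IH n4.
have k0 : (0 < k)%N by rewrite -ltnS -(ltr_nat R); apply: lt_le_trans n4; clear -b1; lra.
have kn : n%:R = k%:R + 1 :> R by rewrite /n natr1.
set q := (Num.sqrt n%:R)^-1; set L := Num.sqrt b4 in hm3 *.
have n0 : 0 < n%:R :> R by rewrite ltr0n.
have sn : 0 < Num.sqrt n%:R :> R by rewrite sqrtr_gt0.
have q0 : 0 < q by rewrite invr_gt0.
have L0 : 0 < L by rewrite sqrtr_gt0; clear -b1; lra.
have LL : L ^+ 2 = b4 by rewrite sqr_sqrtr.
have nq : n%:R * q ^+ 2 = 1 by rewrite /q exprVn sqr_sqrtr// divff// gt_eqF.
have Lq : L * q <= 1.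
  by rewrite /q ler_pdivrMr// mul1r; apply: ler_wsqrtr; clear -n4 b1; lra.
(* [s] is the smoothing variance and [s'] that of the window. [2 A <= B] becomes [2 s <= s'], as
   [rho_sub_bound] demands, [B b4 <= n] puts both below [n], and [A >= 2] with [b4 >= 1] gives the
   [2 <= s] of the sum estimates. *)
pose s := A * b4; pose s' := B * b4.
have s2 : 2 <= s by rewrite -[leLHS]mulr1; apply: ler_pM.
have ss : 2 * s <= s' by rewrite /s /s' mulrA ler_wpM2r.
have bs : b4 <= s by rewrite /s ler_peMl//; clear -A2; lra.
have s0 : 0 < s by clear -s2; lra.
have sln : s <= n%:R by apply: le_trans Bn; apply: le_trans ss; clear -s0; lra.
pose v := n%:R - 1 + s.
have w0 (a x : R) : 0 < a -> 0 <= wgt a x ^+ 3 by move=> a0; exact: wgt_geX0.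
have s'0 : 0 < s' by clear -s0 ss; lra.
have sA : 0 < Num.sqrt A by rewrite sqrtr_gt0.
have sB : 0 < Num.sqrt B by rewrite sqrtr_gt0.
have es : Num.sqrt s = Num.sqrt A * L by rewrite /s sqrtrM// ltW.
have es' : Num.sqrt s' = Num.sqrt B * L by rewrite /s' sqrtrM// ltW.
(* A weight at a larger scale is smaller, so bounds at scale [sqrt i] hold at scale [sqrt n]. *)
have IHn i x : (0 < i < n)%N ->
    wgt (Num.sqrt n%:R) x ^+ 3 * `|edgeworth_err mu m3 i x| <= K * b4 * (Num.sqrt i%:R)^-1.
  move=> iN; have /andP[i0 iln] := iN; apply: le_trans (IH i x iN); rewrite ler_wpM2r//.
  apply: wgt_anti; first by rewrite sqrtr_gt0 ltr0n.
  by apply: ler_wsqrtr; rewrite ler_nat ltnW.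
have p1 : 0 <= 1 + K / B by rewrite addr_ge0// divr_ge0// ltW.
have T1 : wgt (Num.sqrt n%:R) t ^+ 3 * `|iter_cv mu n (fun x => rho s x - neg_relu x) t| <=
    2 * Cp * Cc * (b4 * q * (Num.sqrt A * Num.sqrt B * (1 + K / B))).
  pose c := Cp * (Num.sqrt s * Num.sqrt s').
  have c0 : 0 <= c by rewrite mulr_ge0// mulr_ge0 ?sqrtr_ge0.
  have lpsi : lip (fun x => rho s x - neg_relu x).
    by apply: lipB; [exact: rho_lip|exact: lip_neg_relu].
  have lg := gd_lip 0 s'0.
  have h1 := iter_cv_le n t mu1 lpsi (lipZ c lg) (fun x => hp s s' x s0 ss).
  rewrite (iter_cvZ n c t mu1 lg) in h1.
  have hE x : wgt (Num.sqrt n%:R) x ^+ 3 * `|edgeworth_err mu m3 k x| <= K * b4 * (2 * q).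
    apply: le_trans (IHn k x _) _; first by rewrite k0 /n ltnSn.
    apply: ler_wpM2l; first exact: mulr_ge0.
    apply: inv_sqrt_double; rewrite ?ltr0n//.
    have : 1 <= k%:R :> R by rewrite ler1n.
    by rewrite kn; clear; lra.
  have bn : b4 <= n%:R by clear -n4 b40; lra.
  have := hc mu m3 b4 k s' _ t hmu k0 s'0 Bn bn hE.
  rewrite -/n -/q => h.
  apply: (@le_trans _ _ (c * (wgt (Num.sqrt n%:R) t ^+ 3 * `|iter_cv mu n (gd s' 0) t|))).
    rewrite mulrCA; apply: ler_wpM2l; first exact: w0.
    by apply: le_trans h1 _; rewrite ler_wpM2l// ler_norm.
  apply: le_trans (ler_wpM2l c0 h) _.
  rewrite /c es es'.
  have -> : Cp * (Num.sqrt A * L * (Num.sqrt B * L)) * (Cc * (q + K * b4 * (2 * q) / s')) =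
     Cp * Cc * (b4 * q * (Num.sqrt A * Num.sqrt B * (1 + 2 * (K / B)))).
    by rewrite /s' -LL; field; rewrite !gt_eqF.
  have hK : 1 + 2 * (K / B) <= 2 * (1 + K / B) by clear; lra.
  have -> : 2 * Cp * Cc * (b4 * q * (Num.sqrt A * Num.sqrt B * (1 + K / B))) =
    Cp * Cc * (b4 * q * (Num.sqrt A * Num.sqrt B * (2 * (1 + K / B)))) by ring.
  apply: ler_wpM2l; first exact: mulr_ge0.
  apply: ler_wpM2l; first exact: mulr_ge0 b40 (ltW q0).
  by apply: ler_wpM2l hK; rewrite mulr_ge0// ltW.
have T2 : wgt (Num.sqrt n%:R) t ^+ 3 * `|rho (n%:R + s) t - rho n%:R t| <= C2 * (b4 * q * A).
  apply: le_trans (h2 _ _ t s0 sln) _; rewrite -/q /s le_eqVlt; apply/orP; left; apply/eqP; ring.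
have nv : n%:R <= v by rewrite /v; clear -s2; lra.
have vn : v <= 4 * n%:R by rewrite /v; clear -sln n0; lra.
have T3 : wgt (Num.sqrt n%:R) t ^+ 3 * `|n%:R * rem_rho mu m3 v t| <= C3 * (b4 * q).
  rewrite normrM (ger0_norm (ltW n0)) mulrCA.
  apply: le_trans (ler_wpM2l (ltW n0) (h3 mu m3 b4 _ _ t hmu n0 nv vn)) _.
  have -> : n%:R * (C3 * b4 * (Num.sqrt n%:R)^-1 ^+ 3) = C3 * (b4 * q) * (n%:R * q ^+ 2).
    by rewrite -/q; ring.
  by rewrite nq mulr1.
have m6 : `|m3 / 6| <= L.
  by rewrite normrM (ger0_norm (_ : 0 <= 6^-1))//; have := normr_ge0 m3; clear -hm3; lra.
(* Here [v = n + (s - 1)]. The prefactor [n |m3|] meets [s q^4], and [n q^2 = 1] with [L q <= 1]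
   reduces the product to [s q]. *)
have T4 : wgt (Num.sqrt n%:R) t ^+ 3 * `|n%:R * (m3 / 6) * (gd v 1 t - gd n%:R 1 t)| <=
    C4 * (b4 * q * A).
  have s10 : 0 < s - 1 by clear -s2; lra.
  have s1n : s - 1 <= n%:R by clear -sln; lra.
  have := h4 _ _ t s10 s1n; rewrite (_ : n%:R + (s - 1) = v); last by rewrite /v; ring.
  rewrite -/q => h; rewrite normrM mulrCA.
  have hm : `|n%:R * (m3 / 6)| <= n%:R * L by rewrite normrM (ger0_norm (ltW n0)) ler_wpM2l.
  apply: le_trans (ler_pM (normr_ge0 _) (mulr_ge0 (w0 _ _ sn) (normr_ge0 _)) hm h) _.
  have -> : n%:R * L * (C4 * (s - 1) * q ^+ 4) = C4 * (s - 1) * q * ((n%:R * q ^+ 2) * (L * q)) by ring.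
  rewrite nq mul1r; apply: (@le_trans _ _ (C4 * (s - 1) * q)).
    by apply: ler_piMr => //; rewrite !mulr_ge0// ltW.
  have -> : C4 * (b4 * q * A) = C4 * s * q by rewrite /s; ring.
  apply: ler_wpM2r; first exact: ltW.
  by apply: ler_wpM2l => //; clear; lra.
(* The sum of the indices is at most [n^2], the exchanged derivative has size [L q^5] and [m3]
   another [L]: [n^2 q^5 = q] and [L^2 = b4]. *)
have T5 : wgt (Num.sqrt n%:R) t ^+ 3 * `|(\sum_(i < n) i%:R) * (m3 / 6) *
    (cv mu (cst 1) (gd v 1) t - gd (v + 1) 1 t)| <= C5 * (b4 * q).
  have n2 : 2 * b4 <= n%:R by clear -n4 b40; lra.
  have := h5 mu m3 b4 _ _ t hmu n0 n2 nv vn; rewrite -/q -/L => h.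
  rewrite normrM mulrCA.
  have hS : `|\sum_(i < n) i%:R| <= n%:R * n%:R :> R.
    rewrite ger0_norm ?sumr_ge0// mulr_natl.
    have -> : n%:R *+ n = \sum_(i < n) n%:R :> R by rewrite sumr_const card_ord.
    by apply: ler_sum => i _; rewrite ler_nat ltnW.
  have hm : `|(\sum_(i < n) i%:R) * (m3 / 6)| <= n%:R * n%:R * L.
    by rewrite normrM; apply: ler_pM.
  apply: le_trans (ler_pM (normr_ge0 _) (mulr_ge0 (w0 _ _ sn) (normr_ge0 _)) hm h) _.
  have -> : n%:R * n%:R * L * (C5 * L * q ^+ 5) = C5 * (L ^+ 2 * q) * (n%:R * q ^+ 2) ^+ 2 by ring.
  by rewrite nq expr1n mulr1 LL.
have T6 : wgt (Num.sqrt n%:R) t ^+ 3 * `|\sum_(i < n) (if (i : nat) == 0%N then 0 else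
        cv leb (swap_kernel mu (v - i%:R)) (edgeworth_err mu m3 i) t)| <=
    14 * C6 * (b4 * q * (K / Num.sqrt A)).
  apply: (@le_trans _ _ (\sum_(i < n) C6 * L * K * b4 * (if (i : nat) == 0%N then 0 else
     (Num.sqrt (v - i%:R))^-1 ^+ 3 * (Num.sqrt i%:R)^-1))).
    apply: le_trans (ler_wpM2l (w0 _ _ sn) (ler_norm_sum _ _ _)) _.
    rewrite mulr_sumr; apply: ler_sum => i _.
    case: ifPn => [_|i0]; first by rewrite normr0 !mulr0.
    have iN : (0 < i < n)%N by rewrite lt0n i0/=.
    have ilen : i.+1%:R <= n%:R :> R by rewrite ler_nat.
    have bu : b4 <= v - i%:R by move: ilen bs; rewrite -natr1 /v; clear; lra.
    have un : v - i%:R <= 4 * n%:R by have : 0 <= i%:R :> R by []; clear -vn; lra.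
    have := h6 mu m3 b4 _ _ t _ _ hmu n0 bu un (edgeworth_err_lip hmu (proj1 (andP iN)))
      (fun x => IHn i x iN).
    move=> h; apply: le_trans h _.
    by rewrite -/L le_eqVlt; apply/orP; left; apply/eqP; ring.
  rewrite -mulr_sumr.
  have cc0 : 0 <= C6 * L * K * b4 by rewrite !mulr_ge0// ltW.
  apply: le_trans (ler_wpM2l cc0 (sum_mixed (ltn0Sn k) s2 sln (erefl v))) _.
  rewrite -/n -/q es.
  by rewrite le_eqVlt; apply/orP; left; apply/eqP; field; rewrite !gt_eqF.
have s1 : 1 < s by clear -s2; lra.
have tri (w X1 X2 X3 X4 X5 X6 : R) : 0 <= w ->
    w * `|- X1 + X2 + X3 - X4 - X5 + X6| <=
    w * `|X1| + w * `|X2| + w * `|X3| + w * `|X4| + w * `|X5| + w * `|X6|.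
  move=> ww; rewrite -!mulrDr ler_wpM2l//.
  have := ler_normD (- X1 + X2 + X3 - X4 - X5) X6; have := ler_normB (- X1 + X2 + X3 - X4) X5.
  have := ler_normB (- X1 + X2 + X3) X4; have := ler_normD (- X1 + X2) X3.
  have := ler_normD (- X1) X2; rewrite normrN; clear; lra.
rewrite (edgeworth_err_decomp t hmu (ltn0Sn k) s1).
apply: le_trans (tri _ _ _ _ _ _ _ (w0 _ t sn)) _.
apply: le_trans (lerD (lerD (lerD (lerD (lerD T1 T2) T3) T4) T5) T6) _.
clear T1 T2 T3 T4 T5 T6 hp hc h2 h3 h4 h5 h6 IH IHn.
have bq : 0 <= b4 * q by exact: mulr_ge0 b40 (ltW q0).
have P : 0 <= Num.sqrt A * Num.sqrt B * (1 + K / B) by rewrite !mulr_ge0// ltW.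
have Q : 0 <= K / Num.sqrt A by rewrite divr_ge0// ltW.
move: P Q; set P := Num.sqrt A * _ * _; set Q := K / Num.sqrt A => P0 Q0.
(* The single constant [C] multiplies all three contributions; the cross terms this creates are
   nonnegative and are collected in the last parenthesis. *)
rewrite [leRHS](_ : _ = 2 * Cp * Cc * (b4 * q * P) + C2 * (b4 * q * A) + C3 * (b4 * q * A) +
  C4 * (b4 * q * A) + C5 * (b4 * q * A) + 14 * C6 * (b4 * q * Q) +
  (2 * Cp * Cc * (b4 * q * (A + Q)) + (C2 + C3 + C4 + C5) * (b4 * q * (P + Q)) +
   14 * C6 * (b4 * q * (P + A)))); last by ring.
apply: ler_wpDr.
  have A0' := ltW A0.
  have p2 (x y : R) : 0 <= x -> 0 <= y -> 0 <= b4 * q * (x + y).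
    by move=> x0 y0; apply: mulr_ge0 => //; exact: addr_ge0.
  by apply: addr_ge0; [apply: addr_ge0|]; apply: mulr_ge0; rewrite ?p2//;
    rewrite ?addr_ge0// ?mulr_ge0.
have bqA : b4 * q <= b4 * q * A by rewrite ler_peMr//; clear -A2; lra.
by rewrite !lerD// ler_wpM2l.
Qed.

End edgeworth_induction.

(** * The law of the sum *)

Section convolution_law.
Context {R : realType}.
Local Notation mR := (measurableTypeR R).
Implicit Types (x y t : R) (f : R -> R) (mu nu : probability mR R).

Definition add_pair (z : mR * mR) : mR := z.1 + z.2.

Lemma measurable_add_pair : measurable_fun setT add_pair.
Proof. by apply: measurable_funD; [exact: measurable_fst|exact: measurable_snd]. Qed.

HB.instance Definition _ := isMeasurableFun.Build _ _ _ _ add_pair measurable_add_pair.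

Definition law_conv nu mu : probability mR R :=
  distribution (nu \x mu)%E [the {mfun _ >-> _} of add_pair].

Lemma ge0_integral_law_conv nu mu f : measurable_fun setT f -> (forall x, 0 <= f x) ->
  (\int[law_conv nu mu]_z (f z)%:E = \int[nu]_x \int[mu]_y (f (x + y))%:E)%E.
Proof.
move=> mf f0; rewrite /law_conv ge0_integral_distribution//; last exact/measurable_EFinP.
rewrite fubini_tonelli1//; last by move=> z; rewrite lee_fin.
by apply/measurable_EFinP; apply: (measurableT_comp mf); exact: measurable_add_pair.
Qed.

Lemma integral_law_conv nu mu f : measurable_fun setT f ->
  (law_conv nu mu).-integrable setT (fun x => (f x)%:E) ->
  (\int[law_conv nu mu]_z (f z)%:E = \int[nu]_x \int[mu]_y (f (x + y))%:E)%E.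
Proof.
move=> mf fi.
have mF : measurable_fun setT (fun z : mR * mR => (f (z.1 + z.2))%:E).
  by apply/measurable_EFinP; apply: (measurableT_comp mf); exact: measurable_add_pair.
have Fi : ((nu \x mu)%E).-integrable setT (fun z : mR * mR => (f (z.1 + z.2))%:E).
  apply/integrableP; split => //.
  have := integrable_int_lty fi; rewrite ge0_integral_distribution//.
  by apply/measurable_EFinP; exact: measurableT_comp.
rewrite /law_conv integral_distribution//; last exact/measurable_EFinP.
exact/esym/(integral12_prod_meas1 Fi).
Qed.

Fixpoint law_iter mu i : probability mR R :=
  if i is i'.+1 then law_conv (law_iter mu i') mu else \d_(0 : mR).

Lemma integral_quartic nu (c0 c1 c2 c3 c4 : R) :
  nu.-integrable setT (fun y => (y ^+ 4)%:E) ->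
  let f y := c0 + c1 * y + c2 * y ^+ 2 + c3 * y ^+ 3 + c4 * y ^+ 4 in
  nu.-integrable setT (fun y => (f y)%:E) /\
  \int[nu]_y f y =
   c0 + c1 * \int[nu]_y y + c2 * \int[nu]_y y ^+ 2 + c3 * \int[nu]_y y ^+ 3 +
    c4 * \int[nu]_y y ^+ 4.
Proof.
move=> i4 f.
have step (g : R -> R) (a c : R) j : (j <= 4)%N ->
    nu.-integrable setT (fun y => (g y)%:E) /\ \int[nu]_y g y = a ->
    nu.-integrable setT (fun y => (g y + c * y ^+ j)%:E) /\
    \int[nu]_y (g y + c * y ^+ j) = a + c * \int[nu]_y y ^+ j.
  move=> j4 [ig <-]; have ij := moment_integrable i4 j4.
  have icj : nu.-integrable setT (fun y => (c * y ^+ j)%:E).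
    exact: (integrableZl measurableT c ij).
  split; first exact: (integrableD measurableT ig icj).
  by rewrite RintegralD// RintegralZl.
do 3 apply: (step) => //.
apply: (@step _ _ _ 1) => //.
by split; [exact: prob_integrable_cst|exact: prob_Rintegral_cst].
Qed.

(** By induction, expanding [(x + y)^j]: centring removes the odd mixed terms, and the fourth moment
    grows by [b4 + 6 i], which fits since [3 i^2 + 6 i <= 3 (i + 1)^2]. *)
Lemma law_iter_moments mu m3 b4 i : std_law mu m3 b4 ->
  [/\ (law_iter mu i).-integrable setT (fun y => (y ^+ 4)%:E),
      \int[law_iter mu i]_y y = 0, \int[law_iter mu i]_y y ^+ 2 = i%:R &
      \int[law_iter mu i]_y y ^+ 4 <= i%:R * b4 + 3 * i%:R ^+ 2].
Proof.
move=> [i4 M1 M2 M3 M4].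
elim: i => [|i [j4 N1 N2 N4]].
  have D f : measurable_fun setT f ->
      (\int[(\d_(0%R : mR) : probability mR R)]_y (f y)%:E = (f 0)%:E)%E.
    move=> mf; rewrite integral_dirac//; last exact/measurable_EFinP.
    by rewrite diracE in_setT mul1e.
  split.
  - apply: int_lty_integrable => //.
    have := D (fun y => `|y ^+ 4|); rewrite /= => -> //; first by rewrite ltry.
    by apply: measurableT_comp => //; exact: measurable_funX.
  - by rewrite /Rintegral (D id).
  - by rewrite /Rintegral (D (fun x => x ^+ 2))//= expr0n.
  - by rewrite /Rintegral (D (fun x => x ^+ 4))//= !expr0n/= mulr0 addr0 mul0r.
set nu := law_iter mu i in j4 N1 N2 N4 *.
pose B4 := \int[mu]_y y ^+ 4.
have [E1 E2 E4] : [/\ forall x, (\int[mu]_y (x + y)%:E = x%:E)%E,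
    forall x, (\int[mu]_y ((x + y) ^+ 2)%:E = (1 + 0 * x + 1 * x ^+ 2)%:E)%E &
    forall x, (\int[mu]_y ((x + y) ^+ 4)%:E =
      (B4 + 4 * m3 * x + 6 * x ^+ 2 + 0 * x ^+ 3 + 1 * x ^+ 4)%:E)%E].
  have Q (g : R -> R) (c0 c1 c2 c3 c4 : R) :
      (forall y, g y = c0 + c1 * y + c2 * y ^+ 2 + c3 * y ^+ 3 + c4 * y ^+ 4) ->
      (\int[mu]_y (g y)%:E = (c0 + c1 * 0 + c2 * 1 + c3 * m3 + c4 * B4)%:E)%E.
    move=> /funext ->; have [ii e] := integral_quartic c0 c1 c2 c3 c4 i4.
    by rewrite -Rintegral_EFin// e M1 M2 M3.
  split=> x.
  - by rewrite (Q _ x 1 0 0 0) => [|y]; [congr EFin|]; ring.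
  - by rewrite (Q _ (x ^+ 2) (2 * x) 1 0 0) => [|y]; [congr EFin|]; ring.
  - by rewrite (Q _ (x ^+ 4) (4 * x ^+ 3) (6 * x ^+ 2) (4 * x) 1) => [|y]; [congr EFin|]; ring.
have [I4 V4] := integral_quartic B4 (4 * m3) 6 0 1 j4.
set f4 := (fun y => B4 + _ + _ + _ + _) in I4 V4.
have nn4 (x : R) : 0 <= x ^+ 4 by rewrite exprn_even_ge0.
have c4 : (law_iter mu i.+1).-integrable setT (fun y => (y ^+ 4)%:E).
  apply: int_lty_integrable => //.
  rewrite ge0_integral_law_conv//; last exact: measurableT_comp.
  rewrite (_ : integral _ _ _ = (\int[nu]_x f4 x)%:E) ?ltry// Rintegral_EFin//.
  apply: eq_integral => x _; rewrite -E4.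
  by apply: eq_integral => y _; rewrite ger0_norm.
have val j f : (j <= 4)%N -> nu.-integrable setT (fun y => (f y)%:E) ->
    (forall x, (\int[mu]_y ((x + y) ^+ j)%:E = (f x)%:E)%E) ->
    \int[law_iter mu i.+1]_y (y ^+ j) = \int[nu]_y f y.
  move=> j4' fi E; apply: EFin_inj.
  rewrite Rintegral_EFin; last exact: moment_integrable.
  rewrite integral_law_conv//; last exact: moment_integrable.
  by rewrite Rintegral_EFin//; apply: eq_integral => x _; exact: E.
split => //.
- rewrite -N1; exact: (val 1%N id isT (@moment_integrable _ nu 1 j4 isT) E1).
- have := integral_quartic 1 0 1 0 0 j4; set f2 := (fun y => _) => -[I2 V2].
  rewrite (val 2%N f2)// => [|x]; last by rewrite E2 /f2; congr EFin; ring.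
  by rewrite V2 N1 N2 -natr1; ring.
- by rewrite (val 4%N _ _ I4 E4)// V4 N1 N2 -natr1 /B4; move: N4 M4; clear; lra.
Qed.

(** It connects the operator, on which the exchange is carried out, with the law of the sum, whose
    moments start the induction and which is identified with the random variables. *)
Lemma iter_cv_law mu m3 b4 i f t : std_law mu m3 b4 -> lip f ->
  iter_cv mu i f t = cv (law_iter mu i) (cst 1) f t.
Proof.
move=> hmu; have k1 := moment_kernel1 (let: And5 i4 _ _ _ _ := hmu in i4).
have ki j : kernel1 (law_iter mu j) (cst 1).
  by have [/moment_kernel1] := law_iter_moments j hmu.
elim: i f t => [|i IH] f t lf.
  rewrite /cv /Rintegral integral_dirac//.
    by rewrite [X in (X * _)%E]diracE in_setT mul1e/= subr0 mul1r.
  apply/measurable_EFinP/measurable_funM => //.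
  by apply: lip_measurable; exact: lip_comp_sub.
rewrite iter_cvSr IH; last exact: cv_lip.
apply: EFin_inj; rewrite /cv [RHS]Rintegral_EFin; last exact: cv_integrable.
have mf (x : R) : measurable_fun setT (fun y => f (x - y)).
  by apply: lip_measurable; exact: lip_comp_sub.
rewrite [RHS]integral_law_conv.
- rewrite [LHS]Rintegral_EFin; last exact: (cv_integrable t (ki i) (cv_lip k1 lf)).
  apply: eq_integral => x _; rewrite [cst 1 x]/= mul1r Rintegral_EFin; last exact: cv_integrable.
  by apply: eq_integral => y _; rewrite opprD addrA.
- by apply: measurable_funM.
- exact: (cv_integrable t (ki i.+1) lf).
Qed.

End convolution_law.

(** * Closing the induction *)

Section edgeworth_bound.
Context {R : realType}.
Local Notation mR := (measurableTypeR R).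
Local Notation gd := gauss_der.
Implicit Types (t x A B K : R) (mu : probability mR R) (n i : nat).

(** For [n <= B b4] even [sqrt n] is at most [B b4 / sqrt n], so no cancellation is sought: the
    iterated ramp and the Gaussian one are each compared with the ramp itself. *)
Lemma base_step B : 1 <= B -> exists2 K, 0 <= K & forall mu m3 b4 n t,
  std_law mu m3 b4 -> (0 < n)%N -> n%:R <= B * b4 ->
  wgt (Num.sqrt n%:R) t ^+ 3 * `|edgeworth_err mu m3 n t| <=
  K * b4 * (Num.sqrt n%:R)^-1.
Proof.
move=> B1; have [C C0 hC] := @gd_sup_scaled R 1.
exists (64 * B + 8 + C * B); first by rewrite !addr_ge0// ?mulr_ge0//; move: B1; clear; lra.
move=> mu m3 b4 n t hmu n0 nB.
have b1 : 1 <= b4 by exact: std_law_ge1 hmu.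
have [_ hm3] := third_moment_le hmu.
have nR : 0 < n%:R :> R by rewrite ltr0n.
set a := Num.sqrt n%:R; set L := Num.sqrt b4 in hm3 *.
have a0 : 0 < a by rewrite sqrtr_gt0.
have aa : a ^+ 2 = n%:R by rewrite sqr_sqrtr// ltW.
have LL : L ^+ 2 = b4 by rewrite sqr_sqrtr//; move: b1; clear; lra.
have L0 : 0 <= L by exact: sqrtr_ge0.
have w0 : 0 <= wgt a t ^+ 3 by rewrite exprn_ge0// wgt_ge0.
have [j4 N1 N2 N4] := law_iter_moments n hmu.
have T1 : wgt a t ^+ 3 * `|cv (law_iter mu n) (cst 1) neg_relu t - neg_relu t| <=
    32 * a + 8 * (b4 * a^-1).
  apply: le_trans (prob_neg_relu_bound t a0 j4 N1) _.
  have -> : 32 * a + 8 * (b4 * a^-1) = 8 * a * (1 + (n%:R * b4 + 3 * n%:R ^+ 2) / a ^+ 4).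
    by rewrite -aa; field; rewrite gt_eqF.
  by rewrite ler_pM2l ?mulr_gt0// lerD2l ler_pM2r// invr_gt0 exprn_gt0.
have T2 : wgt a t ^+ 3 * `|rho n%:R t - neg_relu t| <= 32 * a by exact: rho_bound.
have T3 : wgt a t ^+ 3 * `|n%:R * (m3 / 6) * gd n%:R 1 t| <= C * L.
  have h : wgt a t ^+ 3 * `|gd n%:R 1 t| <= C * a^-1 ^+ 2.
    by apply: hC => //; rewrite -/a; move: a0; clear; lra.
  have hm : `|m3 / 6| <= L.
    by rewrite normrM (ger0_norm (_ : 0 <= 6^-1))//; have := normr_ge0 m3; move: hm3; clear; lra.
  rewrite -mulrA 2!normrM (ger0_norm (ltW nR)).
  have -> : wgt a t ^+ 3 * (n%:R * (`|m3 / 6| * `|gd n%:R 1 t|)) =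
    `|m3 / 6| * (n%:R * (wgt a t ^+ 3 * `|gd n%:R 1 t|)) by ring.
  have -> : C * L = L * (n%:R * (C * a^-1 ^+ 2)) by rewrite -aa; field; rewrite gt_eqF.
  have nR' := ltW nR.
  by apply: ler_pM => //; [exact: mulr_ge0 nR' (mulr_ge0 w0 _)|exact: ler_wpM2l].
have B0 : 0 <= B by move: B1; clear; lra.
have aBL : a <= B * L.
  rewrite -ler_sqr ?nnegrE ?(ltW a0) ?mulr_ge0// aa exprMn LL.
  by apply: le_trans nB _; rewrite ler_wpM2r//; move: B1 b1; clear; nra.
have La : L <= B * (b4 * a^-1).
  rewrite mulrA ler_pdivlMr// -LL (_ : B * _ = L * (B * L)); last by ring.
  by rewrite ler_wpM2l.
have aB : a <= B * (b4 * a^-1).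
  by rewrite mulrA ler_pdivlMr// -expr2 aa.
have bB : b4 * a^-1 <= B * (b4 * a^-1).
  by rewrite ler_peMl// mulr_ge0// ?invr_ge0 ?(ltW a0)//; move: b1; clear; lra.
have tri (w x y z : R) : 0 <= w -> w * `|x - y + z| <= w * `|x| + w * `|y| + w * `|z|.
  move=> ww; rewrite -!mulrDr ler_wpM2l//.
  by have := ler_normD (x - y) z; have := ler_normB x y; clear; lra.
rewrite /edgeworth_err (iter_cv_law n t hmu lip_neg_relu).
set I := cv _ _ _ _ in T1 *; set G := n%:R * (m3 / 6) * _ in T3 *.
have -> : I - rho n%:R t + G = (I - neg_relu t) - (rho n%:R t - neg_relu t) + G by ring.
apply: le_trans (tri _ _ _ _ w0) _.
apply: le_trans (lerD (lerD T1 T2) T3) _.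
have CL := ler_wpM2l C0 La.
have -> : (64 * B + 8 + C * B) * b4 * a^-1 =
  64 * (B * (b4 * a^-1)) + 8 * (b4 * a^-1) + C * (B * (b4 * a^-1)) by ring.
by move: CL aB; clear; lra.
Qed.

Lemma edgeworth_bound : exists2 K, 0 <= K & forall mu m3 b4 n t,
  std_law mu m3 b4 -> (0 < n)%N ->
  wgt (Num.sqrt n%:R) t ^+ 3 * `|edgeworth_err mu m3 n t| <=
  K * b4 * (Num.sqrt n%:R)^-1.
Proof.
have [C C0 hC] := @induction_step R.
(* [4 C] makes the total factor [2 C / a] of [K] at most 1/2; the 2 ensures [A >= 4], from which
   [2 <= A] and [2 A <= B] follow. *)
pose a := 4 * C + 2; pose A := a ^+ 2.
have a2 : 2 <= a by rewrite /a; move: C0; clear; lra.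
have sA : Num.sqrt A = a by rewrite sqrtr_sqr ger0_norm//; move: a2; clear; lra.
(* The two contributions of [K] are then [C a b K / B = C K / a] and [C K / sqrt A = C K / a]. *)
pose b := a ^+ 2; pose B := b ^+ 2.
have b4 : 4 <= b by rewrite /b; move: a2; clear; nra.
have sB : Num.sqrt B = b by rewrite sqrtr_sqr ger0_norm//; move: b4; clear; lra.
have B1 : 1 <= B by rewrite /B; move: b4; clear; nra.
have [K1 K10 hK1] := base_step B1.
(* [D / 2] is the contribution free of [K]. As [D <= K], the step returns at most
   [D / 2 + K / 2 <= K]; [K1] takes care of small [n]. *)
pose D := 2 * C * (a * b + A); pose K := K1 + D.
have D0 : 0 <= D.
  by rewrite /D !mulr_ge0// /A addr_ge0 ?sqr_ge0// mulr_ge0//; move: a2 b4; clear; lra.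
have K0 : 0 <= K by rewrite addr_ge0.
exists K => // mu m3 c4 n t hmu.
have c40 : 0 <= c4 by have := std_law_ge1 hmu; clear; lra.
elim/ltn_ind: n t => n IH t n0.
have q0 : 0 <= (Num.sqrt n%:R)^-1 :> R by rewrite invr_ge0 sqrtr_ge0.
have [nB|nB] := leP n%:R (B * c4).
  apply: le_trans (hK1 _ _ _ _ t hmu n0 nB) _.
  by rewrite ler_wpM2r// ler_wpM2r// /K lerDl.
apply: le_trans (hC mu m3 c4 n A B K t hmu _ _ (ltW nB) K0 _) _.
- by rewrite /A; move: a2; clear; nra.
- by rewrite /B /b -/A; have : 4 <= A := b4; clear; nra.
- by move=> i x /andP[i0 ilt]; exact: IH.
rewrite sA sB.
have a0 : 0 < a by move: a2; clear; lra.
have -> : C * (c4 * (Num.sqrt n%:R)^-1 * (a * b * (1 + K / B) + A + K / a)) =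
    c4 * (Num.sqrt n%:R)^-1 * (D / 2 + (2 * C / a) * K).
  move: (Num.sqrt n%:R)^-1 (lt0r_neq0 a0) => q aN; rewrite /D /K /A /B /b; move: aN.
  by clearbody a; clear; move=> aN; field.
rewrite -(mulrA K) [leRHS]mulrC; apply: ler_wpM2l; first exact: mulr_ge0.
have : 2 * C / a <= 1 / 2 by rewrite ler_pdivrMr// /a; clear; lra.
move=> /(ler_wpM2r K0); rewrite {2 4}/K; move: K10; clear; lra.
Qed.

End edgeworth_bound.

(** * Independent summands and iterated convolution *)

Section law_of_sums.
Context {R : realType} {d : measure_display} {T : measurableType d} (P : probability T R).
Local Notation mR := (measurableTypeR R).
Implicit Types (mu nu : probability mR R).

(** The event [E] carries the variables still to be added. Under [P] restricted to [E], the pair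
    agrees on rectangles with the product of [nu] and [P E] times [mu]; uniqueness of the product
    measure extends this to the set where the sum lies in [A]. *)
Lemma law_conv_sum nu mu (X Y : T -> mR) (E : set T) :
  measurable_fun setT X -> measurable_fun setT Y -> measurable E ->
  (forall A B, measurable A -> measurable B ->
    P (X @^-1` A `&` Y @^-1` B `&` E) = nu A * (mu B * P E))%E ->
  forall A, measurable A ->
  P ((fun w => (X w + Y w)%R) @^-1` A `&` E) = (law_conv nu mu A * P E)%E.
Proof.
move=> mX mY mE XY A mA.
have PE : P E \is a fin_num by exact: fin_num_measure.
have c0 : 0 <= fine (P E) by exact: fine_ge0.
pose c := NngNum c0.
have mXY : measurable_fun setT (fun w => (X w, Y w) : mR * mR).
  exact: measurable_fun_pair.
pose pXY := [the {measure set (mR * mR) -> \bar R} of pushforward (mrestr P mE) (fun w => (X w, Y w) : mR * mR)].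
have mD : measurable (add_pair @^-1` A).
  by rewrite -[X in measurable X]setTI; exact: measurable_add_pair.
have rect (B C : set mR) : measurable B -> measurable C ->
    pXY mXY (B `*` C) = (nu B * mscale c mu C)%E.
  move=> mB mC; rewrite /pXY/= /pushforward /mrestr /= /mscale/=.
  have -> : (fun w => (X w, Y w) : mR * mR) @^-1` (B `*` C) = X @^-1` B `&` Y @^-1` C by [].
  by rewrite XY// fineK// [(P E * _)%E]muleC.
have := @product_measure_unique _ _ _ _ _ nu (mscale c mu) (pXY mXY) rect _ mD.
rewrite [RHS]/= /pushforward /mrestr => <-.
rewrite /law_conv /distribution /pushforward.
rewrite muleC /product_measure1 -ge0_integralZl//.
- by apply: eq_integral => x _; rewrite /= /mscale/= fineK.
- exact: measurable_fun_xsection.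
Qed.

Definition partial_sum n (W : 'I_n -> {RV P >-> R}) (s : R) k (w : T) : mR :=
  \sum_(i < n | (i < k)%N) W i w / s.

Lemma measurable_partial_sum n (W : 'I_n -> {RV P >-> R}) s k :
  measurable_fun setT (partial_sum W s k).
Proof.
rewrite (_ : partial_sum W s k = fun w =>
    \sum_(i <- [seq i <- index_enum 'I_n | (nat_of_ord i < k)%N]) W i w / s); last first.
  by apply/funext => w; rewrite /partial_sum big_filter.
by apply: measurable_sum => i; exact: measurable_funM.
Qed.

(** Independence is given as a product rule for the individual variables, not for sums. Intersecting
    with events of variables of index at least [k] makes the statement strong enough for induction
    on [k]. *)
Lemma partial_sum_law n (W : 'I_n -> {RV P >-> R}) s mu k (J : {set 'I_n})
    (B : 'I_n -> set R) :
  mutually_independent W ->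
  (forall i A, measurable A -> P ((fun w => W i w / s) @^-1` A) = mu A) ->
  (k <= n)%N -> (forall i, i \in J -> (k <= i)%N) ->
  (forall i, i \in J -> measurable (B i)) ->
  forall A, measurable A ->
  P (partial_sum W s k @^-1` A `&` \bigcap_(i in [set` J]) (W i @^-1` B i)) =
  (law_iter mu k A * \prod_(i in J) P (W i @^-1` B i))%E.
Proof.
move=> ind hmu; elim: k J B => [|k IH] J B kn kJ mB A mA.
  rewrite -ind//= diracE.
  have -> : partial_sum W s 0 @^-1` A = if (0 : mR) \in A then setT else set0.
    have e w : partial_sum W s 0 w = 0 by rewrite /partial_sum big_pred0.
    case: ifPn => [/set_mem A0|/negP A0]; apply/seteqP; split => w //=; rewrite e//.
    by move=> /mem_set.
  by case: ifPn => _; rewrite ?setTI ?set0I ?mul1e ?mul0e ?measure0.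
have mE : measurable (\bigcap_(i in [set` J]) (W i @^-1` B i)).
  apply: fin_bigcap_measurable => // i iJ.
  by rewrite -[X in measurable X]setTI; apply: measurable_funP => //; exact: mB.
pose j := Ordinal kn.
have jJ : j \notin J by apply/negP => /kJ; rewrite ltnn.
rewrite (_ : partial_sum W s k.+1 = fun w => partial_sum W s k w + W j w / s); last first.
  apply/funext => w; rewrite /partial_sum (bigD1 j)//= addrC; congr (_ + _).
  by apply: eq_bigl => i; rewrite ltnS ltn_neqAle andbC -val_eqE.
rewrite -ind//.
apply: law_conv_sum => //; [exact: measurable_partial_sum|exact: measurable_funM|].
move=> A1 B1 mA1 mB1.
have mB1' : measurable ((fun x : R => x / s) @^-1` B1).
  by rewrite -[X in measurable X]setTI; apply: (measurable_funM _ _) => //.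
(* To add the summand [j], the induction hypothesis is used on the family enlarged by [j], with the
   event that [W j / s] lies in [B1]. *)
pose B' i := if i == j then (fun x : R => x / s) @^-1` B1 else B i.
have B'J i : i \in J -> B' i = B i.
  by rewrite /B'; case: eqP => // -> /(negP jJ).
have B'j : B' j = (fun x : R => x / s) @^-1` B1 by rewrite /B' eqxx.
have := IH (j |: J) B' (ltnW kn) _ _ A1 mA1.
rewrite big_setU1//= B'j (eq_bigr (fun i => P (W i @^-1` B i))); last first.
  by move=> i /B'J ->.
rewrite ind//.
rewrite (_ : \bigcap_(i in [set` j |: J]) _ =
   W j @^-1` ((fun x : R => x / s) @^-1` B1) `&` \bigcap_(i in [set` J]) (W i @^-1` B i)).
  rewrite setIA => ->.
  - by rewrite hmu.
  - by move=> i; rewrite !inE => /orP[/eqP ->//|/kJ/ltnW].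
  - move=> i; rewrite !inE /B'; case: eqP => //= _; exact: mB.
apply/seteqP; split => w /=.
  move=> h; split; first by have := h j; rewrite /= setU11 B'j; apply.
  by move=> i /= iJ; have := h i; rewrite /= in_setU1 iJ orbT B'J//; apply.
by move=> [hj h] i /=; rewrite !inE => /orP[/eqP ->|iJ]; [rewrite B'j|rewrite B'J//; exact: h].
Qed.

End law_of_sums.

(** * The law of a standardised summand *)

Section standardised_law.
Context {R : realType} {d : measure_display} {T : measurableType d} (P : probability T R).
Local Notation mR := (measurableTypeR R).

Lemma std_law_of_moments (W : {RV P >-> R}) (s : R) : 0 < s ->
  ('E_P[W] = 0)%E -> ('V_P[W] = (s ^+ 2)%R%:E)%E ->
  ('E_P[fun w => (`|W w| ^+ 4)%R] < +oo)%E ->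
  exists mu : probability mR R,
   (forall A, measurable A -> P ((fun w => W w / s) @^-1` A) = mu A) /\
   std_law mu (rexpectation P (fun w => W w ^+ 3) / s ^+ 3)
     (rexpectation P (fun w => `|W w| ^+ 4) / s ^+ 4).
Proof.
move=> s0 E1 V2 E4.
have mX : measurable_fun setT ((fun w => W w / s) : T -> mR) by exact: measurable_funM.
pose X : {mfun T >-> mR} :=
  MeasurableFun.Pack (MeasurableFun.Class (isMeasurableFun.Build _ _ T mR _ mX)).
exists (distribution P X); split => //.
have mW : measurable_fun setT (W : T -> R) by [].
have i4 : P.-integrable setT (fun w => (W w ^+ 4)%:E).
  apply/integrableP; split; first by apply/measurable_EFinP; exact: measurable_funX.
  move: E4; rewrite unlock; apply: le_lt_trans; rewrite le_eqVlt; apply/orP; left; apply/eqP.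
  by apply: eq_integral => w _; rewrite /= normrX.
have X4 : P.-integrable setT (fun w => (X w ^+ 4)%:E).
  have := integrableZl measurableT (s^-1 ^+ 4) i4; apply: eq_integrable => // w _.
  by rewrite -EFinM -exprMn mulrC.
have j4 : (distribution P X).-integrable setT (fun y => (y ^+ 4)%:E).
  apply: int_lty_integrable; first exact: measurable_funX.
  rewrite ge0_integral_distribution//; first exact: integrable_int_lty.
  by apply/measurable_EFinP; apply: measurableT_comp => //; exact: measurable_funX.
have Xj j : (j <= 4)%N -> P.-integrable setT (fun w => (X w ^+ j)%:E).
  move=> j5; have := integrable_int_lty (moment_integrable j4 j5).
  rewrite ge0_integral_distribution//; last first.
    by apply/measurable_EFinP; apply: measurableT_comp => //; exact: measurable_funX.
  move=> h; apply/integrableP; split => //.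
  by apply/measurable_EFinP; apply: measurable_funX.
have v j : (j <= 4)%N -> \int[distribution P X]_y y ^+ j =
    rexpectation P (fun w => W w ^+ j) / s ^+ j.
  move=> j5; rewrite /Rintegral integral_distribution//=; last 2 first.
  - by apply/measurable_EFinP; exact: measurable_funX.
  - exact: Xj.
  rewrite /rexpectation unlock.
  transitivity (\int[P]_w (X w ^+ j)); first by [].
  have Wj : P.-integrable setT (fun w => (W w ^+ j)%:E).
    have := integrableZl measurableT (s ^+ j) (Xj _ j5); apply: eq_integrable => // w _.
    by rewrite -EFinM -exprMn mulrC divfK// gt_eqF.
  rewrite -[RHS](RintegralZr (s ^+ j)^-1 measurableT Wj).
  by apply: eq_Rintegral => w _; rewrite exprMn exprVn.
split => //.
- have := v 1%N isT; rewrite !expr1 => ->.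
  by rewrite /rexpectation E1 mul0r.
- rewrite v//; move: V2; rewrite /variance unlock E1/= => V2.
  rewrite /rexpectation (_ : 'E_P[_] = (s ^+ 2)%:E)%E; last first.
    rewrite -V2; congr (expectation _ _); apply/funext => w.
    by rewrite expr2 -[RHS]/((W w - 0) * (W w - 0)) subr0.
  by rewrite /= divff// gt_eqF// exprn_gt0.
- by rewrite v.
- rewrite v// /rexpectation (_ : (fun w => `|W w| ^+ 4) = (fun w => W w ^+ 4))//.
  by apply/funext => w; rewrite -normrX ger0_norm// exprn_even_ge0.
Qed.

End standardised_law.

(** * The two expectations as convolutions, at scale [sqrt n] *)

Section relu_expectations.
Context {R : realType}.
Local Notation mR := (measurableTypeR R).
Local Notation leb := (@lebesgue_measure R).
Local Notation gd := gauss_der.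
Implicit Types (s t u x : R).

Lemma neg_relu_scale s x : 0 <= s -> neg_relu (s * x) = s * neg_relu x.
Proof. by move=> s0; rewrite /neg_relu /relu maxr_pMr// mulr0 mulrN. Qed.

Lemma gd0_dilate s x : 0 < s -> gd (s ^+ 2) 0 (s * x) = s^-1 * gd 1 0 x.
Proof.
move=> s0; rewrite !gd0_scale sqrtr_sqr sqrtr1 ger0_norm ?(ltW s0)//.
by rewrite invr1 mulr1 mul1r mulrAC divff ?mul1r// gt_eqF.
Qed.

(** Positive homogeneity of the ramp and a linear substitution. It carries the Gaussian of variance
    [n] at [sqrt n * t] to the standard one at [t]. *)
Lemma rho_dilate s t : 0 < s -> rho (s ^+ 2) (s * t) = s * rho 1 t.
Proof.
move=> s0; have dF x : is_derive x 1 (fun y : R => s * y) s.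
  by apply: is_derive_eq; rewrite /GRing.scale/= mulr1.
have F' : derive1 (fun y : R => s * y) = cst s.
  by apply/funext => x; rewrite derive1E; have [_ ->] := dF x.
have r0 x : 0 <= neg_relu x by rewrite /neg_relu /relu le_max lexx orbT.
have g0 u x : 0 < u -> 0 <= gd u 0 x by move=> u0; rewrite ltW// gd0_gt0.
have ss : 0 < s ^+ 2 by rewrite exprn_gt0.
have cr a : continuous (fun x => neg_relu (a - x)).
  by apply: lip_continuous; apply: lip_comp_sub; exact: lip_neg_relu.
rewrite /rho /cv -RintegralZl//; last exact: (cv_integrable t (gd_kernel1 0 ltr01) lip_neg_relu).
rewrite /Rintegral; congr fine.
rewrite (@increasing_ge0_integration_by_substitutionT _ (fun y => s * y)) //.
- apply: eq_integral => x _; rewrite F'.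
  rewrite [X in X%:E](_ : _ = gd (s ^+ 2) 0 (s * x) * neg_relu (s * t - s * x) * s)//.
  rewrite gd0_dilate// -mulrBr neg_relu_scale ?(ltW s0)//; congr EFin.
  by field; rewrite gt_eqF.
- by move=> x y xy; rewrite ltr_pM2l.
- by rewrite F' => x; exact: cvg_cst.
- rewrite F'; apply: is_cvg_cst.
- rewrite F'; apply: is_cvg_cst.
- by apply: gt0_cvgMrNy.
- by apply: gt0_cvgMry.
- by move=> x; apply: cvgM; [exact: gd_continuous|exact: cr].
- by move=> x; rewrite mulr_ge0// g0.
Qed.

Lemma expectation_relu_gauss {d : measure_display} {T : measurableType d}
    (Q : probability T R) (Z : {RV Q >-> R}) t :
  has_distribution Z (normal_prob 0 1) ->
  ('E_Q[fun z => relu (Z z - t)%R] = (rho 1 t)%:E)%E.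
Proof.
move=> hZ; have mr : measurable_fun [set: mR] (fun y => neg_relu (t - y)).
  by apply: lip_measurable; apply: lip_comp_sub; exact: lip_neg_relu.
have mZ0 : measurable_fun setT (Z : T -> R) by [].
have mZ : measurable_fun setT (Z : T -> mR) := mZ0.
pose Z' : {mfun T >-> mR} :=
  MeasurableFun.Pack (MeasurableFun.Class (isMeasurableFun.Build _ _ T mR _ mZ)).
rewrite unlock.
transitivity (\int[Q]_z (neg_relu (t - Z' z))%:E)%E.
  by apply: eq_integral => z _; rewrite /neg_relu opprB.
have r0 x : 0 <= neg_relu x by rewrite /neg_relu /relu le_max lexx orbT.
transitivity (\int[distribution Q Z']_y (neg_relu (t - y))%:E)%E.
  by rewrite ge0_integral_distribution => [//||y]; [exact/measurable_EFinP|rewrite lee_fin].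
transitivity (\int[gprob 1]_y (neg_relu (t - y))%:E)%E.
  apply: (@eq_measure_integral _ mR R setT (gprob 1) (distribution Q Z')) => A mA _.
  rewrite [LHS](hZ A mA).
  by rewrite /gprob sqrtr1.
rewrite integral_gprob// /rho -Rintegral_EFin//.
exact: (cv_integrable t (gd_kernel1 0 ltr01) lip_neg_relu).
Qed.

Lemma expectation_relu_sum {d : measure_display} {T : measurableType d}
    (P : probability T R) n (W : 'I_n -> {RV P >-> R}) (mu : probability mR R) m3 b4 s t :
  (0 < n)%N -> 0 < s -> mutually_independent W ->
  (forall i A, measurable A -> P ((fun w => W i w / s) @^-1` A) = mu A) ->
  std_law mu m3 b4 ->
  ('E_P[fun w => relu (1 / Num.sqrt (n%:R * s ^+ 2) * (\sum_(i < n) W i w) - t)%R] =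
   ((Num.sqrt n%:R)^-1 * iter_cv mu n neg_relu (Num.sqrt n%:R * t))%:E)%E.
Proof.
move=> n0 s0 ind hmu std; set a := Num.sqrt n%:R.
have a0 : 0 < a by rewrite sqrtr_gt0 ltr0n.
have mr : measurable_fun [set: mR] (fun y => neg_relu (a * t - y)).
  by apply: lip_measurable; apply: lip_comp_sub; exact: lip_neg_relu.
have r0 x : 0 <= neg_relu x by rewrite /neg_relu /relu le_max lexx orbT.
have mS := measurable_partial_sum W s n.
pose S : {mfun T >-> mR} :=
  MeasurableFun.Pack (MeasurableFun.Class (isMeasurableFun.Build _ _ T mR _ mS)).
have kn : kernel1 (law_iter mu n) (cst 1).
  by have [/moment_kernel1] := law_iter_moments n std.
rewrite unlock (iter_cv_law n _ std lip_neg_relu).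
transitivity (\int[P]_w (a^-1 * neg_relu (a * t - S w))%:E)%E.
  apply: eq_integral => w _; rewrite -neg_relu_scale ?invr_ge0 ?(ltW a0)//.
  congr (_%:E); rewrite /neg_relu; congr relu.
  rewrite sqrtrM// sqrtr_sqr (ger0_norm (ltW s0)) -/a.
  have -> : S w = (\sum_(i < n) W i w) / s.
    rewrite /S/= /partial_sum mulr_suml; apply: eq_bigl => i.
    by rewrite ltn_ord.
  by field; rewrite !gt_eqF.
transitivity (\int[distribution P S]_y (a^-1 * neg_relu (a * t - y))%:E)%E.
  rewrite ge0_integral_distribution => [//||y].
    by apply/measurable_EFinP; exact: measurable_funM.
  by rewrite lee_fin mulr_ge0// invr_ge0 ltW.
transitivity (\int[law_iter mu n]_y (a^-1 * neg_relu (a * t - y))%:E)%E.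
  apply: (@eq_measure_integral _ mR R setT (law_iter mu n) (distribution P S)) => A mA _.
  (* With no remaining variables [J] is empty, and the product rule reduces to the law of the full
     sum. *)
  have := @partial_sum_law _ _ _ P n W s mu n finset.set0 (fun=> setT) ind hmu (leqnn n).
  move=> /(_ _ _ A mA); rewrite big_set0 mule1 => h.
  apply: etrans (h _ _); last 2 first.
  - by move=> i; rewrite inE.
  - by move=> i; rewrite inE.
  rewrite (_ : \bigcap_(i in _) _ = setT) ?setIT//.
  by apply/seteqP; split => // w _ i /=; rewrite inE.
rewrite EFinM /cv Rintegral_EFin; last exact: (cv_integrable _ kn lip_neg_relu).
rewrite ge0_intZl ?invr_ge0 ?(ltW a0)//; congr (_ * _)%E.
by apply: eq_integral => y _; rewrite mul1r.
Qed.

End relu_expectations.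

(** * Comparison with [kappa] and integration over the half-line *)

Section kappa_bounds.
Context {R : realType}.
Local Notation leb := (@lebesgue_measure R).
Implicit Types (t x : R).

(** For [t >= 0] this is an equality; for [t < 0] the left side is at most 1 and [kappa t] at least
    1/3. *)
Lemma kappa_ge t : ((1 + `|t|) ^+ 3)^-1 <= 3 * kappa t.
Proof.
rewrite /kappa; have p x : 0 <= x -> 0 < (1 + x) ^+ 3.
  by move=> x0; rewrite exprn_gt0// ltr_wpDr.
case: ifPn => [t0|].
  rewrite ger0_norm// le_eqVlt; apply/orP; left; apply/eqP.
  by field; move: t0; clear; lra.
rewrite -ltNge => t0; rewrite ltr0_norm//.
have nt : 0 <= - t by move: t0; clear; lra.
have h : ((1 - t) ^+ 3)^-1 <= 1 by rewrite invf_le1 ?p// exprn_ege1// lerDl.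
have -> : 1 / (3 * (1 - t) ^+ 3) = ((1 - t) ^+ 3)^-1 / 3.
  by field; move: t0; clear; lra.
by move: h; clear; lra.
Qed.

Lemma kappa_nonneg t : 0 <= kappa t.
Proof.
have := kappa_ge t; have : 0 <= ((1 + `|t|) ^+ 3)^-1 by rewrite invr_ge0 exprn_ge0// addr_ge0.
by clear; lra.
Qed.

Lemma continuous_cube_decay : continuous (fun t : R => ((1 + `|t|) ^+ 3)^-1).
Proof.
move=> t; apply: cvgV; first by rewrite expf_neq0// gt_eqF// ltr_wpDr.
apply: (@continuous_comp _ _ _ (fun x : R => 1 + `|x|) (fun y => y ^+ 3)).
  by apply: cvgD; [exact: cvg_cst|exact: norm_continuous].
exact: exprn_continuous.
Qed.

Lemma integral_cube_decay :
  (\int[leb]_(t in `[0%R, +oo[) (((1 + `|t|) ^+ 3)^-1)%:E = (1 / 2)%:E)%E.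
Proof.
pose f t : R := ((1 + `|t|) ^+ 3)^-1.
pose F t : R := - (1 / 2 * ((1 + t) ^+ 2)^-1).
have dF t : 0 <= t -> is_derive t 1 F (f t).
  move=> t0; have t1 : 1 + t != 0 by rewrite gt_eqF// ltr_wpDr.
  have d2 : is_derive t 1 (fun x : R => (1 + x) ^+ 2) (2 * (1 + t)).
    by apply: is_derive_eq; rewrite /GRing.scale/=; ring.
  have d3 := @is_deriveV _ (fun x : R => (1 + x) ^+ 2) t _ _ (expf_neq0 2 t1) d2.
  apply: is_derive_eq; rewrite /f ger0_norm// /GRing.scale/=; field.
  exact: t1.
rewrite (@ge0_continuous_FTC2y _ f F 0 0).
- by rewrite /F -EFinB; congr EFin; rewrite addr0 expr1n; field.
- by move=> t _; rewrite /f invr_ge0 exprn_ge0// addr_ge0.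
- by apply: continuous_subspaceT; exact: continuous_cube_decay.
- rewrite -[X in _ --> X]oppr0 -[X in - X](mulr0 (1 / 2)).
  apply: (@cvgN _ R^o); apply: cvgMl_tmp.
  apply/(@gtr0_cvgV0 _ _ _ _ (fun x : R => (1 + x) ^+ 2)).
    by near=> x; rewrite exprn_gt0// ltr_wpDr//; near: x; exact: nbhs_pinfty_ge.
  apply/cvgryPge => M; near=> x.
  have x0 : 0 <= x by near: x; exact: nbhs_pinfty_ge.
  have Mx : M <= x by near: x; apply: nbhs_pinfty_ge; exact: num_real.
  by move: x0 Mx; clear; nra.
- by move=> t t0; have [] := dF t (ltW t0).
- apply: cvg_at_right_filter; apply: differentiable_continuous.
  by apply/derivable1_diffP; have [] := dF 0 (lexx 0).
- by move=> t; rewrite in_itv/= andbT => /ltW t0; rewrite derive1E; have [_ ->] := dF t t0.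
Unshelve. all: by end_near. Qed.

(** Integrability of [g] is part of the conclusion: [g] is [f] plus a difference dominated by an
    integrable function, and the integral of [(1 + t)^(-3)] over the half-line is 1/2. *)
Lemma halfline_integral_close (g f : R -> R) (c Mf : R) : 0 <= c ->
  measurable_fun [set: R] g -> leb.-integrable setT (fun t => (f t)%:E) ->
  \int[leb]_(t in `[0%R, +oo[) f t = Mf ->
  (forall t, `|g t - f t| <= c * ((1 + `|t|) ^+ 3)^-1) ->
  (`| \int[leb]_(t in `[0%R, +oo[) (g t)%:E - Mf%:E | <= (c / 2)%:E)%E.
Proof.
move=> c0 mg fi <- gf.
pose D : set (measurableTypeR R) := `[0%R, +oo[%classic.
have mD : measurable D by exact: measurable_itv.
have fD : leb.-integrable D (fun t => (f t)%:E).
  by apply: (@integrableS _ _ _ leb setT).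
have mf : measurable_fun setT f.
  by apply/measurable_EFinP; exact: measurable_int fi.
have mq : measurable_fun setT (fun t : R => ((1 + `|t|) ^+ 3)^-1).
  exact: continuous_measurable_fun continuous_cube_decay.
have q0 (t : R) : 0 <= ((1 + `|t|) ^+ 3)^-1 by rewrite invr_ge0 exprn_ge0// addr_ge0.
have qE : (\int[leb]_(t in D) (c * ((1 + `|t|) ^+ 3)^-1)%:E = (c / 2)%:E)%E.
  rewrite (_ : (c / 2)%:E = (c%:E * (1 / 2)%:E)%E); last by rewrite -EFinM mulrA mulr1.
  rewrite -integral_cube_decay -ge0_integralZl//.
  - by apply/measurable_EFinP; apply: measurable_funTS.
have qi : leb.-integrable D (fun t => (c * ((1 + `|t|) ^+ 3)^-1)%:E).
  apply/integrableP; split.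
    by apply/measurable_EFinP; apply: measurable_funTS; exact: measurable_funM.
  under eq_integral do rewrite /= ger0_norm ?mulr_ge0//.
  by rewrite qE ltry.
have ei : leb.-integrable D (fun t => (g t - f t)%:E).
  apply: le_integrable qi => //.
    by apply/measurable_EFinP; apply: measurable_funTS; exact: measurable_funB.
  by move=> t _; rewrite lee_fin (le_trans (gf t))// ler_norm.
have -> : (\int[leb]_(t in D) (g t)%:E = \int[leb]_(t in D) ((f t)%:E + (g t - f t)%:E))%E.
  by apply: eq_integral => t _; rewrite -EFinD addrCA subrr addr0.
rewrite integralD// /Rintegral fineK; last exact: integrable_fin_num.
rewrite addeAC subee ?add0e; last exact: integrable_fin_num.
apply: le_trans (le_abse_integral leb mD _) _.
  exact: measurable_int ei.
rewrite -qE; apply: ge0_le_integral => //.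
- by apply: measurableT_comp => //; exact: measurable_int ei.
- exact: measurable_int qi.
- by move=> t _; rewrite lee_fin.
Qed.

End kappa_bounds.

(** * From the Edgeworth error to the ReLU difference *)

Lemma error_term_ge {d : measure_display} {T : measurableType d} {R : realType}
    (P : probability T R) n (W : T -> R) (s : R) :
  rexpectation P (fun w => `|W w| ^+ 4) / (s ^+ 4 * n%:R) <= error_term P n W s.
Proof.
rewrite /error_term lerDl; apply: mulr_ge0; first exact: exprn_ge0.
apply: exprn_ge0; apply: addr_ge0; last by rewrite divr_ge0// mulr_ge0.
set E := [set _ | _ in _].
have E0 x : E x -> 0 <= x by move=> [b _ <-]; case: (char_fun _ _ _) => a c; exact: sqrtr_ge0.
(* If the set has no supremum, [sup] takes the value 0, which is nonnegative as well. *)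
have [supE|supE] := pselect (has_sup E); last by rewrite sup_out.
have [[x Ex] hE] := supE.
by apply: le_trans (E0 _ Ex) _; exact: ub_le_sup.
Qed.

(** [edgeworth_bound] at the point [sqrt n * t], where the weight becomes [(1 + |t|)^3]. Homogeneity
    of the ramp supplies a second factor [1 / sqrt n], which yields the order [1 / n]. *)
Lemma Delta_relu_approx (R : realType) : exists2 K, 0 <= K &
  forall (d d' : measure_display) (T : measurableType d) (T' : measurableType d')
    (P : probability T R) (Q : probability T' R) (n : nat) (hn : (0 < n)%N)
    (W : 'I_n -> {RV P >-> R}) (Z : {RV Q >-> R}) (sigma : R),
  let W1 := W (Ordinal hn) in
  mutually_independent W -> identically_distributed W ->
  ('E_P[W1] = 0)%E -> 0 < sigma -> ('V_P[W1] = (sigma ^+ 2)%R%:E)%E ->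
  ('E_P[fun w => (`|W1 w| ^+ 4)%R] < +oo)%E ->
  has_distribution Z (normal_prob 0 1) ->
  exists D : R -> R,
  [/\ forall t, Delta_relu W Z sigma t = (D t)%:E, measurable_fun [set: R] D &
   forall t, `|D t - (- (rexpectation P (fun w => W1 w ^+ 3) / sigma ^+ 3) / 6 *
          (Num.sqrt n%:R)^-1 * gauss_der 1 1 t)| <=
       K * (rexpectation P (fun w => `|W1 w| ^+ 4) / (sigma ^+ 4 * n%:R)) *
         ((1 + `|t|) ^+ 3)^-1].
Proof.
have [K K0 hK] := @edgeworth_bound R; exists K => //.
move=> d d' T T' P Q n hn W Z s W1 ind idd E1 s0 V2 E4 hZ.
have [mu [hmu std]] := std_law_of_moments s0 E1 V2 E4.
set m3 := rexpectation _ _ / _ in std *; set b4 := rexpectation _ _ / _ in std.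
have hW i A : measurable A -> P ((fun w => W i w / s) @^-1` A) = mu A.
  move=> mA; rewrite -hmu//.
  have mB : measurable ((fun x : R => x / s) @^-1` A).
    by rewrite -[X in measurable X]setTI; apply: (measurable_funM _ _) => //.
  exact: idd i (Ordinal hn) _ mB.
set a := Num.sqrt n%:R; have a0 : 0 < a by rewrite sqrtr_gt0 ltr0n.
have aa : n%:R = a ^+ 2 by rewrite sqr_sqrtr.
have k1 : kernel1 mu (cst 1) by have [/moment_kernel1] := std.
pose D t := a^-1 * iter_cv mu n neg_relu (a * t) - rho 1 t.
exists D; split.
- move=> t; rewrite /Delta_relu (expectation_relu_sum t hn s0 ind hW std).
  by rewrite (expectation_relu_gauss t hZ).
- apply: measurable_funB; last by apply: lip_measurable; exact: rho_lip.
  apply: measurable_funM => //.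
  apply: (measurableT_comp (lip_measurable (iter_cv_lip n k1 lip_neg_relu))).
  exact: measurable_funM.
- move=> t.
  have e : D t - (- m3 / 6 * a^-1 * gauss_der 1 1 t) = a^-1 * edgeworth_err mu m3 n (a * t).
    rewrite /edgeworth_err aa (rho_dilate t a0) /D.
    have -> : gauss_der (a ^+ 2) 1 (a * t) = a^-1 ^+ 2 * gauss_der 1 1 t.
      by rewrite !gd1E ?exprn_gt0// gd0_dilate//; field; rewrite gt_eqF.
    move: (iter_cv _ _ _ _) (rho _ _) (gauss_der _ _ _) => x y z.
    by field; rewrite gt_eqF.
  rewrite e normrM ger0_norm ?invr_ge0 ?(ltW a0)//.
  have := hK mu m3 b4 n (a * t) std hn; rewrite -/a.
  have -> : wgt a (a * t) = 1 + `|t|.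
    by rewrite /wgt normrM gtr0_norm// mulrAC divff ?mul1r// gt_eqF.
  have p : 0 < (1 + `|t|) ^+ 3 by rewrite exprn_gt0// ltr_wpDr.
  rewrite mulrC -ler_pdivlMr// => h.
  apply: le_trans (ler_wpM2l _ h) _; first by rewrite invr_ge0 ltW.
  rewrite le_eqVlt; apply/orP; left; apply/eqP; rewrite /b4 aa.
  by field; rewrite !gt_eqF//; apply: lt_le_trans (ltr01) _; rewrite lerDl.
Qed.

Lemma Rintegral_halfline_gd1 {R : realType} (c : R) :
  \int[lebesgue_measure]_(t in `[0%R, +oo[) (c * gauss_der 1 1 t) =
  - c * (Num.sqrt (2 * pi))^-1.
Proof.
have gi := kernel1_integrable (gd_kernel1 1 (@ltr01 R)).
have giD : (@lebesgue_measure R).-integrable `[0%R, +oo[ (fun t => (gauss_der 1 1 t)%:E).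
  by apply: (@integrableS _ _ _ lebesgue_measure setT).
rewrite RintegralZl//.
have [C _ hC] := gd_decay 0 (@ltr01 R).
have hC1 x : (1 + `|x|) * `|gauss_der 1 0 x| <= C.
  apply: le_trans (hC x); rewrite ler_wpM2r// -[leLHS]expr1.
  by apply: ler_weXn2l => //; rewrite lerDl.
rewrite (FTC_halfline 0 (is_derive_gd 1 0) (gd_continuous (u := 1) (m := 1)) gi hC1).
rewrite gd0_scale sqrtr1 invr1 mul1r mul0r /std_gauss expr0n/= oppr0 mul0r expR0.
by rewrite mulr1 mulrN mulNr.
Qed.

Theorem proposition4p2 (R : realType) :
  exists C : R, 0 < C /\
  forall (d d' : measure_display)
    (T : measurableType d) (T' : measurableType d')
    (P : probability T R) (Q : probability T' R)
    (n : nat) (hn : (0 < n)%N)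
    (W : 'I_n -> {RV P >-> R}) (Z : {RV Q >-> R}) (sigma : R),
  let W1 := W (Ordinal hn) in
  mutually_independent W ->
  identically_distributed W ->
  ('E_P[W1] = 0)%E ->
  0 < sigma ->
  ('V_P[W1] = (sigma ^+ 2)%R%:E)%E ->
  ('E_P[fun w => (`|W1 w| ^+ 4)%R] < +oo)%E ->
  has_distribution Z (normal_prob 0 1) ->
  (forall t : R,
    (`| Delta_relu W Z sigma t
        - (t * expR (- (t ^+ 2) / 2) * rexpectation P (fun w => W1 w ^+ 3)
           / (6 * Num.sqrt (2 * pi * n%:R) * sigma ^+ 3))%R%:E |
     <= (C * error_term P n W1 sigma * kappa t)%R%:E)%E)
  /\
  (`| \int[lebesgue_measure]_(t in `[0%R, +oo[) Delta_relu W Z sigma t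
      - (rexpectation P (fun w => W1 w ^+ 3)
         / rexpectation P (fun w => `|W1 w| ^+ 2) `^ (3 / 2)
         * (1 / (6 * Num.sqrt (2 * pi * n%:R))))%R%:E |
   <= (C / 6 * error_term P n W1 sigma)%R%:E)%E.
Proof.
have [K K0 hK] := Delta_relu_approx R.
(* The 3 comes from [kappa_ge]. It also suits the integral, where [C / 6] must dominate [K / 2]. The
   1 makes [C] positive. *)
exists (3 * K + 1); split; first by rewrite ltr_wpDl// mulr_ge0.
move=> d d' T T' P Q n hn W Z s W1 ind idd E1 s0 V2 E4 hZ.
have [D [DE mD hD]] := hK _ _ _ _ P Q n hn W Z s ind idd E1 s0 V2 E4 hZ.
have := error_term_ge P n W1 s; set B := rexpectation _ _ / (s ^+ 4 * n%:R) in hD *.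
set err := error_term _ _ _ _ => Berr.
have B0 : 0 <= B.
  rewrite /B divr_ge0//; last by rewrite mulr_ge0// exprn_ge0// ltW.
  by rewrite /rexpectation fine_ge0//; apply: expectation_ge0 => w /=; rewrite exprn_ge0.
set m3 := rexpectation P (fun w => W1 w ^+ 3) in hD *.
have p0 : 0 < Num.sqrt (2 * pi) :> R by rewrite sqrtr_gt0 mulr_gt0// pi_gt0.
have a0 : 0 < Num.sqrt n%:R :> R by rewrite sqrtr_gt0 ltr0n.
have sE : Num.sqrt (2 * pi * n%:R) = Num.sqrt (2 * pi) * Num.sqrt n%:R :> R.
  by rewrite sqrtrM// mulr_ge0// pi_ge0.
split=> [t|].
  rewrite DE lee_fin.
  (* The derivative of the standard Gaussian density at [t] is [- t exp(- t^2 / 2) / sqrt (2 pi)],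
     which accounts for the sign. *)
  have -> : t * expR (- t ^+ 2 / 2) * m3 / (6 * Num.sqrt (2 * pi * n%:R) * s ^+ 3) =
      - (m3 / s ^+ 3) / 6 * (Num.sqrt n%:R)^-1 * gauss_der 1 1 t.
    rewrite gd1E// gd0_scale sqrtr1 invr1 mul1r !mulr1 /std_gauss sE.
    by field; rewrite !gt_eqF.
  apply: le_trans (hD t) _.
  apply: le_trans (ler_wpM2l (mulr_ge0 K0 B0) (kappa_ge t)) _.
  rewrite mulrA ler_wpM2r//; first by have := kappa_nonneg t.
  rewrite mulrC mulrA; apply: ler_pM => //; first exact: mulr_ge0.
  by rewrite lerDl.
under eq_integral do rewrite DE.
have V2' : rexpectation P (fun w => `|W1 w| ^+ 2) = s ^+ 2.
  rewrite /rexpectation; move: V2; rewrite /variance unlock E1/= => V2.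
  rewrite (_ : (fun w => `|W1 w| ^+ 2) = (W1 \- cst 0) * (W1 \- cst 0)).
    by rewrite V2.
  apply/funext => w; rewrite -normrX ger0_norm ?sqr_ge0//.
  by rewrite expr2 -[RHS]/((W1 w - 0) * (W1 w - 0)) subr0.
have s3 : (s ^+ 2) `^ (3 / 2) = s ^+ 3.
  rewrite -powR_mulrn ?(ltW s0)// -powRrM.
  by rewrite (_ : 2 * (3 / 2) = 3%:R) ?powR_mulrn ?(ltW s0)//; field.
rewrite V2' s3.
have gi := kernel1_integrable (gd_kernel1 1 (@ltr01 R)).
set c := - (m3 / s ^+ 3) / 6 * (Num.sqrt n%:R)^-1 in hD.
have fi := integrableZl measurableT c gi.
apply: le_trans (halfline_integral_close (mulr_ge0 K0 B0) mD fi _ hD) _.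
  rewrite Rintegral_halfline_gd1 sE /c; field.
  by rewrite !gt_eqF.
rewrite lee_fin.
have : K * B <= K * err by exact: ler_wpM2l.
by move: Berr B0; clear; lra.
Qed.
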